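(* Let $\lambda_h=u_h|_{\partial\mathcal T_H}$ and let $\lambda_h^{{\rm ms},\Pi}\in\Lambda_h^{{\rm ms},\Pi}$ be the solution of $$s(\nu_h^{{\rm ms},\Pi},\lambda_h^{{\rm ms},\Pi})=(\rho g,T\nu_h^{{\rm ms},\Pi})\quad\text{for all }\nu_h^{{\rm ms},\Pi}\in\Lambda_h^{{\rm ms},\Pi}.$$ Set $u_h^{\mathbb H}=T\lambda_h$ and $u_h^{{\rm ms},\Pi}=T\lambda_h^{{\rm ms},\Pi}$. Then $\lambda_h-\lambda_h^{{\rm ms},\Pi}\in\widetilde\Lambda_h^\triangle$ and $$|u_h^{\mathbb H}-u_h^{{\rm ms},\Pi}|^2_{H^1_{\mathcal A}(\Omega)}\le 9\,\alpha_{\rm stab}\,\mathcal H^2\,\|g\|^2_{L^2_\rho(\Omega)}.$$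
   Context: Setting. $\Omega\subset\mathbb R^2$ is an open bounded domain with polygonal boundary; $\mathcal A\in[L^\infty(\Omega)]^{2\times2}_{\rm sym}$ satisfies $a_{\min}|v|^2\le\mathcal A(x)v\cdot v\le a_{\max}|v|^2$ for a.e. $x\in\Omega$ and all $v\in\mathbb R^2$, with constants $a_{\min},a_{\max}>0$. $\rho\in L^\infty(\Omega)$ with $\rho(x)\in[\rho_{\min},\rho_{\max}]$ a.e., for positive constants $\rho_{\min},\rho_{\max}$. $f\in L^2(\Omega)$ is given and $g$ is defined by $f=\rho g$. $(\cdot,\cdot)$ is the $L^2(\Omega)$ inner product, $a(v,w)=\int_\Omega\mathcal A\nabla v\cdot\nabla w\,dx$, $\|v\|_{L^2_\rho(D)}=\|\rho^{1/2}v\|_{L^2(D)}$, $|v|_{H^1_{\mathcal A}(D)}=\|\mathcal A^{1/2}\nabla v\|_{L^2(D)}$. Meshes. $\mathcal T_H$ is a regular finite element partition of $\Omega$ into triangles of characteristic length $H>0$, with skeleton $\partial\mathcal T_H$. For $h<H$, $\mathcal T_h$ is a refinement of $\mathcal T_H$ (every edge of $\mathcal T_H$ is a union of edges of $\mathcal T_h$). $\mathcal N_H$, resp. $\mathcal N_h$, is the set of nodes of $\mathcal T_H$, resp. $\mathcal T_h$, on $\partial\mathcal T_H\setminus\partial\Omega$. Spaces. $V_h\subset H^1_0(\Omega)$: continuous piecewise linear functions on $\mathcal T_h$. $u_h\in V_h$ solves $a(u_h,v_h)=(\rho g,v_h)$ for all $v_h\in V_h$. $V_h^B=\{v_h\in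 V_h: v_h=0\text{ on }\partial\tau\ \forall\tau\in\mathcal T_H\}$; $V_h^{\mathbb H}=\{u\in V_h:a(u,v)=0\ \forall v\in V_h^B\}$; $\Lambda_h=\{v_h|_{\partial\mathcal T_H}:v_h\in V_h^{\mathbb H}\}$. $T:\Lambda_h\to V_h^{\mathbb H}$ is the discrete harmonic extension: $(T\mu_h)|_{\partial\mathcal T_H}=\mu_h$ and $a(T\mu_h,v_h^B)=0$ for all $v_h^B\in V_h^B$; $T$ acts elementwise, so $T$ of a trace on $\partial\tau$ makes sense on $\tau$. $s_\tau(\mu_h,\nu_h)=\int_\tau\mathcal A\nabla T\mu_h\cdot\nabla T\nu_h\,dx$, $s=\sum_{\tau\in\mathcal T_H}s_\tau$. $\widetilde\Lambda_h=\{\tilde\lambda_h\in\Lambda_h:\tilde\lambda_h(x_i)=0\ \forall x_i\in\mathcal N_H\}$. Edge operators. For an edge $e\not\subset\partial\Omega$ of $\tau\in\mathcal T_H$, $\widetilde\Lambda_h^e$, $\widetilde\Lambda_h^\tau$ are the restrictions of $\widetilde\Lambda_h$ to $e$ and to $\partial\tau$. $R_{e,\tau}^T:\widetilde\Lambda_h^e\to\widetilde\Lambda_h^\tau$ is extension by zero to $\partial\tau\setminus e$; $R_{e,\tau}:\widetilde\Lambda_h^\tau\to\widetilde\Lambda_h^e$ is restriction to $e$. $S^\tau:\widetilde\Lambda_h^\tau\to(\widetilde\Lambda_h^\tau)'$, $(\mu,S^\tau\nu)_{\partial\tau}=\int_\tau\mathcal A\nabla T\mu\cdot\nabla T\nu\,dx$.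 $S^\tau_{ee}$, $S^\tau_{ee^c}$, $S^\tau_{e^ce}$, $S^\tau_{e^ce^c}$ are the blocks of $S^\tau$ with respect to splitting the nodal degrees of freedom into those in $(\mathcal N_h\setminus\mathcal N_H)\cap e$ and those in $e^c=(\mathcal N_h\setminus\mathcal N_H)\cap(\partial\tau\setminus e)$; in particular $(\mu,S^\tau_{ee}\nu)_e=(R_{e,\tau}^T\mu,S^\tau R_{e,\tau}^T\nu)_{\partial\tau}$. $M^\tau_{ee}$: $(\mu,M^\tau_{ee}\nu)_e=\int_\tau\rho\,(TR_{e,\tau}^T\mu)(TR_{e,\tau}^T\nu)\,dx$. $\widehat S^\tau_{ee}=\mathcal H^{-2}M^\tau_{ee}+S^\tau_{ee}$, where $\mathcal H>0$ is the target precision set by the user. $\widetilde S^\tau_{ee}=S^\tau_{ee}-S^\tau_{ee^c}(S^\tau_{e^ce^c})^{-1}S^\tau_{e^ce}$. Eigenvalue problem. For an edge $e$ shared by $\tau,\tau'\in\mathcal T_H$, let $(\alpha_i^e,\tilde\psi_{h,i}^e)\in\mathbb R\times\widetilde\Lambda_h^e$ be the eigenpairs, $\alpha_1^e\ge\alpha_2^e\ge\dots>1$, of $(\widehat S^\tau_{ee}+\widehat S^{\tau'}_{ee})\tilde\psi_{h,i}^e=\alpha_i^e(\widetilde S^\tau_{ee}+\widetilde S^{\tau'}_{ee})\tilde\psi_{h,i}^e$, with eigenfunctions forming a basis of $\widetilde\Lambda_h^e$ orthonormal with respect to $(\cdot,(\widehat S^\tau_{ee}+\widehat S^{\tau'}_{ee})\cdot)_e$.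 For a given $\alpha_{\rm stab}>1$: $\widetilde\Lambda_h^{e,\triangle}={\rm span}\{\tilde\psi_{h,i}^e:\alpha_i^e<\alpha_{\rm stab}\}$, $\widetilde\Lambda_h^{e,\Pi}={\rm span}\{\tilde\psi_{h,i}^e:\alpha_i^e\ge\alpha_{\rm stab}\}$. $\widetilde\Lambda_h^\triangle=\{\tilde\mu_h\in\widetilde\Lambda_h:\tilde\mu_h|_e\in\widetilde\Lambda_h^{e,\triangle}\text{ for all edges }e\text{ of }\partial\mathcal T_H\}$, and similarly $\widetilde\Lambda_h^\Pi$ with $\widetilde\Lambda_h^{e,\Pi}$. $\Lambda_h^0$ is the set of functions in $\Lambda_h$ vanishing at all nodes of $\mathcal N_h\setminus\mathcal N_H$; $\Lambda_h^\Pi=\Lambda_h^0\oplus\widetilde\Lambda_h^\Pi$, so $\Lambda_h=\Lambda_h^\Pi\oplus\widetilde\Lambda_h^\triangle$. Multiscale space. For $\tau\in\mathcal T_H$ and $\mu_h\in\Lambda_h$, $P^{\tau,\triangle}\mu_h\in\widetilde\Lambda_h^\triangle$ is defined by $s(\tilde\nu_h,P^{\tau,\triangle}\mu_h)=s_\tau(\tilde\nu_h,\mu_h)$ for all $\tilde\nu_h\in\widetilde\Lambda_h^\triangle$; $P^\triangle=\sum_{\tau\in\mathcal T_H}P^{\tau,\triangle}$; $\Lambda_h^{{\rm ms},\Pi}=(I-P^\triangle)\Lambda_h^\Pi$. *)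

(* Defs.v *)
From HB Require Import structures.
From mathcomp Require Import all_boot all_order all_algebra finmap.
From mathcomp Require Import all_classical all_reals all_analysis.

Set Implicit Arguments.
Unset Strict Implicit.
Unset Printing Implicit Defensive.

Import Order.TTheory GRing.Theory Num.Theory numFieldNormedType.Exports.

Local Open Scope classical_set_scope.
Local Open Scope ring_scope.

(* Conventions.
   - The plane is R * R with the product topology and the product Lebesgue
     measure.
   - A triangle is the finite set of its three vertices, an edge the finite set
     of its two end points; hull maps them to closed subsets of the plane.
   - Functions on a subset D of the plane (elements of V_h on closure Omega,
     traces on the skeleton, on the boundary of an element, on an edge) are
     total functions that are 0 outside D.  Restriction to D is the library
     operation f \_ D, so that equality of traces is Leibniz equality.
   - Integrals over an element tau are taken over its interior. *)

Notation leb2 R := ((@lebesgue_measure R) \x (@lebesgue_measure R))%E.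

Section Mesh.
Context {R : realType}.
Implicit Types (s t e tau : {fset R * R}) (T : {fset {fset R * R}})
  (Om : set (R * R)).

Definition hull s : set (R * R) :=
  [set x | exists w : R * R -> R,
    [/\ forall p, p \in s -> 0 <= w p,
        \sum_(p <- s) w p = 1 &
        x = \sum_(p <- s) w p *: p] ].

Definition boundary Om : set (R * R) := closure Om `\` Om°.

Definition nondegenerate t : Prop :=
  exists p q r : R * R, t = [fset p; q; r]%fset /\
    (q.1 - p.1) * (r.2 - p.2) - (q.2 - p.2) * (r.1 - p.1) != 0.

Definition edges_of t : set {fset R * R} :=
  [set e | (e `<=` t)%fset /\ #|` e| = 2].

Definition edges T : set {fset R * R} := \bigcup_(t in [set` T]) edges_of t.

Definition bdry t : set (R * R) := \bigcup_(e in edges_of t) hull e.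

Definition skeleton T : set (R * R) := \bigcup_(t in [set` T]) bdry t.

Definition vertices T : set (R * R) := \bigcup_(t in [set` T]) [set` t].

Definition polygonal_domain Om : Prop :=
  [/\ open Om, connected Om, Om !=set0, bounded_set Om &
      exists S : {fset {fset R * R}},
        (forall e, e \in S -> #|` e| = 2) /\
        boundary Om = \bigcup_(e in [set` S]) hull e].

(* Conforming partition of Om into triangles: two closed triangles meet in the
   convex hull of their common vertices (nothing, a vertex or an edge), and the
   boundary of Om is resolved by the edges. *)
Definition triangulation Om T : Prop :=
  [/\ forall t, t \in T -> nondegenerate t,
      forall t t', t \in T -> t' \in T ->
        hull t `&` hull t' = hull (t `&` t')%fset,
      closure Om = \bigcup_(t in [set` T]) hull t,
      forall t, t \in T -> (hull t)° `<=` Om &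
      boundary Om =
        \bigcup_(e in edges T `&` [set e | hull e `<=` boundary Om]) hull e].

(* the largest element diameter, a diameter being the longest edge length *)
Definition meshsize T : R :=
  \big[Num.max/0]_(t <- T) \big[Num.max/0]_(p <- t) \big[Num.max/0]_(q <- t)
    Num.sqrt ((p.1 - q.1) ^+ 2 + (p.2 - q.2) ^+ 2).

Definition refinement T T' : Prop :=
  (forall t, t \in T -> exists2 tau, tau \in T' & hull t `<=` hull tau) /\
  (forall e, edges T' e ->
     hull e = \bigcup_(e' in edges T `&` [set e' | hull e' `<=` hull e])
                hull e').

End Mesh.

(* dom = Omega, coef = A, dens = rho, mH = T_H, mh = T_h; target is the
   user-chosen precision (calligraphic H), unrelated to the mesh size. *)
Record fem_data (R : realType) := Data {
  dom : set (R * R);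
  coef : R * R -> 'M[R]_2;
  dens : R * R -> R;
  mH : {fset {fset R * R}};
  mh : {fset {fset R * R}};
  target : R }.

Record eigensystem (R : realType) := Eigensystem {
  neig : nat;
  eigval : 'I_neig -> R;
  eigfun : 'I_neig -> R * R -> R }.

Arguments neig {R} _.
Arguments eigval {R} _ _.
Arguments eigfun {R} _ _.

Section Notions.
Context {R : realType}.
Implicit Types (P : fem_data R) (f g v w mu nu eta zeta : R * R -> R)
  (e t tau : {fset R * R}) (D : set (R * R)).

Definition dotp (a b : 'cV[R]_2) : R := (a^T *m b) ord0 ord0.

Definition Linfty D f : Prop :=
  measurable_fun D f /\
  exists C : R, {ae leb2 R, forall x, D x -> `|f x| <= C}.

Definition L2 D f : Prop :=
  measurable_fun D f /\
  (leb2 R).-integrable D (fun x => (f x ^+ 2)%:E).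

Definition elliptic D (A : R * R -> 'M[R]_2) (amin amax : R) : Prop :=
  {ae leb2 R, forall x, D x -> forall b : 'cV[R]_2,
     amin * dotp b b <= dotp (A x *m b) b <= amax * dotp b b}.

(* The weak gradient of a continuous piecewise linear function: the classical
   gradient on the open triangles of T_h, and 0 on the remaining null set. *)
Definition grad P v (x : R * R) : 'cV[R]_2 :=
  if x \in \bigcup_(t in [set` mh P]) (hull t)°
  then \col_(i < 2) 'D_((if i == 0 then (1, 0) else (0, 1)) : R * R) v x
  else 0.

Definition energy P D v w : R :=
  \int[leb2 R]_(x in D) dotp (coef P x *m grad P v x) (grad P w x).

Definition aform P v w : R := energy P (dom P) v w.

(* |A^{1/2} b|^2 = A b . b, since A^{1/2} is symmetric *)
Definition H1A P v : R := Num.sqrt (energy P (dom P) v v).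

Definition L2rho P g : R :=
  Num.sqrt (\int[leb2 R]_(x in dom P) (Num.sqrt (dens P x) * g x) ^+ 2).

Definition load P g v : R := \int[leb2 R]_(x in dom P) (dens P x * g x * v x).

Definition Vh P : set (R * R -> R) :=
  [set v | [/\ continuous v,
     forall x, ~ dom P x -> v x = 0 &
     forall t, t \in mh P -> exists c0 c1 c2 : R,
       forall x, hull t x -> v x = c0 + c1 * x.1 + c2 * x.2] ].

Definition VhB P : set (R * R -> R) :=
  [set v | Vh P v /\
     forall tau, tau \in mH P -> forall x, bdry tau x -> v x = 0].

Definition VhH P : set (R * R -> R) :=
  [set u | Vh P u /\ forall v, VhB P v -> aform P u v = 0].

Definition Lam P : set (R * R -> R) :=
  [set v \_ (skeleton (mH P)) | v in VhH P].

Definition nodesH P : set (R * R) :=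
  vertices (mH P) `&` (skeleton (mH P) `\` boundary (dom P)).

Definition nodesh P : set (R * R) :=
  vertices (mh P) `&` (skeleton (mH P) `\` boundary (dom P)).

Definition tLam P : set (R * R -> R) :=
  [set mu | Lam P mu /\ forall x, nodesH P x -> mu x = 0].

(* Discrete harmonic extension; the set below is a singleton for mu in Lam P. *)
Definition Tharm P mu : R * R -> R :=
  xget 0 [set v | [/\ Vh P v, v \_ (skeleton (mH P)) = mu &
                      forall w, VhB P w -> aform P v w = 0] ].

(* The same on one element, for a trace on bdry tau: T acts elementwise. *)
Definition Tel P tau mu : R * R -> R :=
  xget 0 [set v | [/\ exists2 u, Vh P u & v = u \_ (hull tau),
                      v \_ (bdry tau) = mu &
                      forall w, VhB P w -> energy P (hull tau)° v w = 0] ].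

Definition s_el P tau mu nu : R := energy P (hull tau)° (Tharm P mu) (Tharm P nu).

Definition sform P mu nu : R := \sum_(tau <- mH P) s_el P tau mu nu.

(* Below, an operator X into a dual space is given by its form (mu, X nu). *)

Definition interior_edge P e : Prop :=
  edges (mH P) e /\ ~ (hull e `<=` boundary (dom P)).

Definition tLam_edge P e : set (R * R -> R) := [set mu \_ (hull e) | mu in tLam P].

Definition tLam_el P tau : set (R * R -> R) := [set mu \_ (bdry tau) | mu in tLam P].

(* R_{e,tau}^T: extension by zero from e to bdry tau *)
Definition ext e mu : R * R -> R := mu \_ (hull e).

(* the elements of tLam_el whose degrees of freedom on e vanish, i.e., those
   carried by the degrees of freedom in e^c *)
Definition tLam_co P tau e : set (R * R -> R) :=
  [set eta | tLam_el P tau eta /\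
     forall x, (nodesh P `\` nodesH P) x -> hull e x -> eta x = 0].

Definition Sop P tau mu nu : R :=
  energy P (hull tau)° (Tel P tau mu) (Tel P tau nu).

(* The blocks of S^tau: mu, nu in tLam_edge P e; eta, zeta in tLam_co P tau e. *)
Definition S_ee P tau e mu nu : R := Sop P tau (ext e mu) (ext e nu).
Definition S_eco P tau e mu eta : R := Sop P tau (ext e mu) eta.
Definition S_coe P tau e zeta nu : R := Sop P tau zeta (ext e nu).
Definition S_coco P tau zeta eta : R := Sop P tau zeta eta.

(* (S_{e^c e^c})^{-1} l: the eta with (zeta, S_{e^c e^c} eta) = l zeta. *)
Definition S_coco_inv P tau e (l : (R * R -> R) -> R) : R * R -> R :=
  xget 0 [set eta | tLam_co P tau e eta /\
     forall zeta, tLam_co P tau e zeta -> S_coco P tau zeta eta = l zeta].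

Definition M_ee P tau e mu nu : R :=
  \int[leb2 R]_(x in (hull tau)°)
    (dens P x * Tel P tau (ext e mu) x * Tel P tau (ext e nu) x).

Definition hatS P tau e mu nu : R :=
  target P ^- 2 * M_ee P tau e mu nu + S_ee P tau e mu nu.

Definition tildeS P tau e mu nu : R :=
  S_ee P tau e mu nu -
  S_eco P tau e mu (S_coco_inv P tau e (fun zeta => S_coe P tau e zeta nu)).

(* Linear independence of the eigenfunctions is implied by orthonormality. *)
Definition is_eigensystem P tau tau' e (E : eigensystem R) : Prop :=
  [/\ forall i, tLam_edge P e (eigfun E i),
      forall i mu, tLam_edge P e mu ->
        hatS P tau e mu (eigfun E i) + hatS P tau' e mu (eigfun E i) =
        eigval E i *
          (tildeS P tau e mu (eigfun E i) + tildeS P tau' e mu (eigfun E i)),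
      (forall i j : 'I_(neig E), (i <= j)%N -> eigval E j <= eigval E i) /\
      (forall i, 1 < eigval E i),
      forall i j,
        hatS P tau e (eigfun E i) (eigfun E j) +
        hatS P tau' e (eigfun E i) (eigfun E j) = (i == j)%:R &
      forall mu, tLam_edge P e mu ->
        exists c : 'I_(neig E) -> R, mu = \sum_i c i *: eigfun E i].

Definition eigspan (E : eigensystem R) (sel : pred R) : set (R * R -> R) :=
  [set mu | exists c : 'I_(neig E) -> R,
     mu = \sum_(i | sel (eigval E i)) c i *: eigfun E i].

(* On edges contained in the boundary of dom all traces vanish. *)
Definition tLam_sel P (E : {fset R * R} -> eigensystem R) (sel : pred R) :
    set (R * R -> R) :=
  [set mu | tLam P mu /\
     forall e, interior_edge P e -> eigspan (E e) sel (mu \_ (hull e))].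

Definition tLam_tri P E (astab : R) := tLam_sel P E (fun al => al < astab).
Definition tLam_Pi P E (astab : R) := tLam_sel P E (fun al => astab <= al).

Definition Lam0 P : set (R * R -> R) :=
  [set mu | Lam P mu /\
     forall x, (nodesh P `\` nodesH P) x -> mu x = 0].

Definition Lam_Pi P E (astab : R) : set (R * R -> R) :=
  [set mu | exists mu0 mu1,
     [/\ Lam0 P mu0, tLam_Pi P E astab mu1 & mu = mu0 + mu1] ].

Definition Proj_el P E (astab : R) tau mu : R * R -> R :=
  xget 0 [set eta | tLam_tri P E astab eta /\
     forall nu, tLam_tri P E astab nu -> sform P nu eta = s_el P tau nu mu].

Definition Proj P E (astab : R) mu : R * R -> R :=
  \sum_(tau <- mH P) Proj_el P E astab tau mu.

Definition Lam_ms P E (astab : R) : set (R * R -> R) :=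
  [set mu - Proj P E astab mu | mu in Lam_Pi P E astab].

End Notions.

(* Main.v *)
Require Import Defs.
From HB Require Import structures.
From mathcomp Require Import all_boot all_order all_algebra finmap.
From mathcomp Require Import all_classical all_reals all_analysis.
From mathcomp Require Import measurable_realfun ring lra.

Set Implicit Arguments.
Unset Strict Implicit.
Unset Printing Implicit Defensive.

Import Order.TTheory GRing.Theory Num.Theory numFieldNormedType.Exports.

Local Open Scope classical_set_scope.
Local Open Scope ring_scope.

(* Write [a] for the energy form, [s] for its trace version and [d] for the
   difference of the two traces.  The space of all traces is the s-orthogonal
   sum of the multiscale space and of the triangle space, and the multiscale
   solution is the Galerkin projection of the trace of u_h on the former; hence
   [d] lies in the latter and [s(d, d) = (rho g, T d)].

   On an element, [T d] is the sum of the extensions of the three edge pieces of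
   [d], because [d] vanishes at the coarse vertices.  So its squared weighted L2
   norm is at most three times the sum of the edge mass terms, each bounded by
   target^2 times the edge form hatS.  On the triangle space, hatS summed over
   the elements around an edge is at most astab times the sum of the Schur
   complements tildeS, and a Schur complement minimises the element energy;
   since every element has three edges,
     [int rho (T d)^2 <= 9 astab target^2 s(d, d)].
   Expanding [0 <= int rho (K g - T d)^2] with [K = 9 astab target^2] concludes. *)

(** The spaces are sets of total functions without basis or dimension, and the harmonic extension,
    the Schur inverse and the projections are picked by [xget], so that each pick is meaningful only
    after an existence proof. All of these proofs rest on one representation lemma, [psd_represent],
    where finite dimension enters as a finite list of functionals, namely evaluations at the fine
    vertices. It allows degenerate forms, since element energies are degenerate; a picked Schur
    inverse is then used through its defining equations alone.

    A second obstacle is that the energy bounds are local to an element while the spectral bound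
    couples the elements around an edge. The double sum over elements and their edges is therefore
    reordered by edges for the spectral bound and by elements for the energy bound.

    Definiteness of the energy on [Vh] uses neither a Poincare inequality nor chains of adjacent
    triangles: zero energy leaves a continuous function with finitely many values, one of them 0. *)

(** * Positive semidefinite forms *)

(* At most one term is negative, and any other term compensates it. *)
Lemma sum_pairwise_ge0 {R : realDomainType} (I : eqType) (l : seq I) (d : I -> R) :
  uniq l -> (exists x y, [/\ x \in l, y \in l & x != y]) ->
  (forall x y, x \in l -> y \in l -> x != y -> 0 <= d x + d y) ->
  0 <= \sum_(x <- l) d x.
Proof.
move=> ul [x [y [xl yl xy]]] h.
have [all0|] := pselect (forall z, z \in l -> 0 <= d z).
  by rewrite big_seq; apply: sumr_ge0.
move=> /existsNP[z /not_implyP[zl /negP]]; rewrite -ltNge => dz.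
have [w wl wz] : exists2 w, w \in l & w != z.
  by have [xz|] := eqVneq x z; [exists y => //; rewrite -xz eq_sym|exists x].
have d0 i : i \in l -> i != z -> 0 <= d i.
  by move=> il iz; have := h i z il zl iz; lra.
rewrite (bigD1_seq z)//= -big_filter (bigD1_seq w) ?filter_uniq ?mem_filter ?wz//=.
rewrite addrA addr_ge0//; first by apply: h; rewrite // eq_sym.
rewrite big_seq_cond; apply: sumr_ge0 => i /andP[+ _].
by rewrite mem_filter => /andP[iz il]; exact: d0.
Qed.

Section PsdForms.
Context {R : realType} {V : lmodType R}.
Implicit Types (W : set V) (B : V -> V -> R) (l : V -> R).

Definition subspace_of W :=
  W 0 /\ forall a u v, W u -> W v -> W (a *: u + v).

Definition linear_on W l :=
  forall a u v, W u -> W v -> l (a *: u + v) = a * l u + l v.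

(** Relative to [W] because integral forms are additive only where the integrands are integrable.
    Linearity in the second argument follows by symmetry, see [psd_linr]. *)
Definition psd_on W B :=
  [/\ forall z, W z -> linear_on W (B^~ z),
      forall u v, W u -> W v -> B u v = B v u &
      forall u, W u -> 0 <= B u u].

Lemma subspaceD W u v : subspace_of W -> W u -> W v -> W (u + v).
Proof. by move=> [_ h] Wu Wv; rewrite -(scale1r u); exact: h. Qed.

Lemma subspaceZ W a u : subspace_of W -> W u -> W (a *: u).
Proof. by move=> [W0 h] Wu; rewrite -[_ *: _]addr0; exact: h. Qed.

Lemma subspaceB W u v : subspace_of W -> W u -> W v -> W (u - v).
Proof.
by move=> sW Wu Wv; rewrite -scaleN1r; apply: subspaceD => //; exact: subspaceZ.
Qed.

Lemma subspace_sum W (I : Type) (r : seq I) (p : pred I) (F : I -> V) :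
  subspace_of W -> (forall i, p i -> W (F i)) -> W (\sum_(i <- r | p i) F i).
Proof.
move=> sW h; apply: (big_ind (fun x => W x)) => //; first by case: sW.
by move=> x y; exact: subspaceD.
Qed.

Lemma linear_on0 W l : subspace_of W -> linear_on W l -> l 0 = 0.
Proof.
by move=> [W0 _] /(_ 1 0 0 W0 W0); rewrite scaler0 addr0 mul1r => h; lra.
Qed.

Lemma linear_onD W l u v : linear_on W l -> W u -> W v -> l (u + v) = l u + l v.
Proof. by move=> h Wu Wv; rewrite -[X in l (X + _)]scale1r h// mul1r. Qed.

Lemma linear_onZ W l a u :
  subspace_of W -> linear_on W l -> W u -> l (a *: u) = a * l u.
Proof.
move=> sW h Wu; rewrite -[_ *: _]addr0 h// ?(linear_on0 sW h) ?addr0//.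
by case: sW.
Qed.

Lemma linear_onB W l u v :
  subspace_of W -> linear_on W l -> W u -> W v -> l (u - v) = l u - l v.
Proof. by move=> sW h Wu Wv; rewrite addrC -scaleN1r h// mulN1r addrC. Qed.

Lemma linear_on_sum W l (I : Type) (r : seq I) (p : pred I) (F : I -> V) :
  subspace_of W -> linear_on W l -> (forall i, p i -> W (F i)) ->
  l (\sum_(i <- r | p i) F i) = \sum_(i <- r | p i) l (F i).
Proof.
move=> sW hl h.
suff [] : W (\sum_(i <- r | p i) F i) /\
   l (\sum_(i <- r | p i) F i) = \sum_(i <- r | p i) l (F i) by [].
apply: (big_ind2 (fun x y => W x /\ l x = y)).
- by split; [case: sW|exact: linear_on0 hl].
- move=> x1 x2 y1 y2 [Wx <-] [Wy <-]; split; first exact: subspaceD.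
  exact: linear_onD hl _ _.
- by move=> i /h.
Qed.

Lemma psd_linr W B u : psd_on W B -> W u -> subspace_of W -> linear_on W (B u).
Proof.
move=> [hl hs _] Wu [_ hW] a v w Wv Ww.
by rewrite hs ?hl// ?(hs v) ?(hs w)//; exact: hW.
Qed.

Lemma psd_sub W W' B : W' `<=` W -> psd_on W B -> psd_on W' B.
Proof.
move=> sub [hl hs hp]; split.
- by move=> z /sub Wz a u v /sub Wu /sub Wv; exact: hl.
- by move=> u v /sub Wu /sub Wv; exact: hs.
- by move=> u /sub; exact: hp.
Qed.

Lemma linear_on_add W l l' : linear_on W l -> linear_on W l' ->
  linear_on W (fun u => l u + l' u).
Proof. by move=> hl hl' a u v Wu Wv; rewrite hl// hl'//; ring. Qed.

Lemma psd_ext W B B' : subspace_of W -> (forall u v, W u -> W v -> B u v = B' u v) ->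
  psd_on W B -> psd_on W B'.
Proof.
move=> [_ cW] BB [hl hs hp]; split.
- by move=> z Wz a u v Wu Wv; rewrite -!BB//; [exact: hl|exact: cW].
- by move=> u v Wu Wv; rewrite -!BB//; exact: hs.
- by move=> u Wu; rewrite -BB//; exact: hp.
Qed.

Lemma psd_add W B B' (k : R) : 0 <= k -> psd_on W B -> psd_on W B' ->
  psd_on W (fun u v => k * B u v + B' u v).
Proof.
move=> k0 [hl hs hp] [hl' hs' hp']; split.
- by move=> z Wz a u v Wu Wv; rewrite hl// hl'//; ring.
- by move=> u v Wu Wv; rewrite hs// hs'.
- by move=> u Wu; rewrite addr_ge0 ?mulr_ge0 ?hp ?hp'.
Qed.

Lemma psd_expand W B a u v : subspace_of W -> psd_on W B -> W u -> W v ->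
  B (a *: u + v) (a *: u + v) = a ^+ 2 * B u u + 2 * a * B u v + B v v.
Proof.
move=> sW hB Wu Wv; have [hl hs _] := hB; have [_ cW] := sW.
rewrite hl//; last exact: cW.
rewrite (psd_linr hB Wu)// (psd_linr hB Wv)// (hs v u)//; ring.
Qed.

(** If [B z z = 0], the energy of [t z + u] is affine in [t], and an affine function bounded below
    is constant. *)
Lemma psd_null W B u z : subspace_of W -> psd_on W B -> W u -> W z ->
  B z z = 0 -> B u z = 0.
Proof.
move=> sW hB Wu Wz Bz; have [_ cW] := sW; have [_ _ hp] := hB.
apply/eqP; apply: contraT => nz.
(* The scalar is chosen so that the affine expression takes the value [-1]. *)
have := hp (- (B u u + 1) / (2 * B u z) *: z + u) (cW _ _ _ Wz Wu).
have [_ hs _] := hB.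
rewrite (psd_expand _ sW hB Wz Wu) Bz (hs z u)//.
have -> : 2 * (- (B u u + 1) / (2 * B u z)) * B u z = - (B u u + 1) by field.
rewrite mulr0 add0r; lra.
Qed.

(** Riesz representation for a possibly degenerate form. The list [L] separates [W] modulo the null
    vectors of [B]. The induction on [L] restricts to the kernel of one functional and then adds
    back at most one direction, orthogonal to that kernel. *)
Lemma psd_represent (I : eqType) (L : seq I) (phi : I -> V -> R) W B l :
  subspace_of W -> (forall i, i \in L -> linear_on W (phi i)) ->
  psd_on W B -> linear_on W l ->
  (forall z, W z -> B z z = 0 -> l z = 0) ->
  (forall z, W z -> (forall i, i \in L -> phi i z = 0) -> B z z = 0) ->
  exists2 w, W w & forall z, W z -> B w z = l z.
Proof.
elim: L W l => [|p0 L IH] W l sW hL hB hl lnull sep.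
  exists 0; first by case: sW.
  move=> z Wz; have Bz : B z z = 0 by apply: sep => // i.
  by rewrite lnull// (psd_null sW hB _ Wz Bz)//; case: sW.
have [lp hL'] : linear_on W (phi p0) /\ forall i, i \in L -> linear_on W (phi i).
  by split=> [|i iL]; apply: hL; rewrite inE ?eqxx ?iL ?orbT.
set p := phi p0 in lp.
pose W' := [set w | W w /\ p w = 0].
have W'W : W' `<=` W by move=> w [].
have [W0 cW] := sW.
have sW' : subspace_of W'.
  split; first by split=> //; exact: linear_on0 lp.
  move=> a u v [Wu pu] [Wv pv]; split; first exact: cW.
  by rewrite lp// pu pv mulr0 addr0.
have hB' := psd_sub W'W hB.
have sep' z : W' z -> (forall i, i \in L -> phi i z = 0) -> B z z = 0.
  by move=> [Wz pz] h; apply: sep => // i; rewrite inE => /orP[/eqP->|/h].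
have IH' l' : linear_on W l' -> (forall z, W z -> B z z = 0 -> l' z = 0) ->
    exists2 w, W' w & forall z, W' z -> B w z = l' z.
  move=> hl' l'0; apply: IH => //.
  - by move=> i iL a u v /W'W Wu /W'W Wv; exact: hL'.
  - by move=> a u v /W'W Wu /W'W Wv; exact: hl'.
  - by move=> z /W'W Wz; exact: l'0.
have [w' W'w' hw'] := IH' l hl lnull.
have Ww' := W'W _ W'w'.
have [allp|] := pselect (forall w, W w -> p w = 0).
  by exists w' => // z Wz; apply: hw'; split=> //; exact: allp.
move=> /existsNP[w0 /not_implyP[Ww0 /eqP pw0]].
(* [pr] is the [B]-projection of [w0] onto the kernel of [p], given by the induction hypothesis for
   the functional [B w0]; [w0 - pr] is then orthogonal to that kernel. *)
have [pr W'pr hpr] : exists2 w, W' w & forall z, W' z -> B w z = B w0 z.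
  apply: IH'; first exact: psd_linr.
  by move=> z Wz Bz; exact: psd_null hB _ _ _.
pose d := w0 - pr.
have [hBl hBs hBp] := hB.
have Wd : W d by apply: subspaceB => //; exact: W'W.
have pd : p d = p w0.
  by rewrite (linear_onB sW lp)//; [case: W'pr => _ ->; rewrite subr0|exact: W'W].
have Bd z : W' z -> B d z = 0.
  move=> W'z; rewrite (linear_onB sW (hBl _ (W'W _ W'z)))//; last exact: W'W.
  by rewrite hpr// subrr.
have dec z : W z -> exists2 z', W' z' & exists c, z = c *: d + z'.
  move=> Wz; exists (- (p z / p d) *: d + z).
    split; first exact: cW.
    by rewrite lp// pd mulNr divfK// addNr.
  by exists (p z / p d); rewrite addrA -scalerDl subrr scale0r add0r.
(* If [d] is a null vector, then [l d = 0] and the representative on the kernel already works. *)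
have [Bdd|Bdd] := eqVneq (B d d) 0.
  exists w' => // _ /dec[z' W'z' [c ->]]; have Wz' := W'W _ W'z'.
  rewrite (psd_linr hB)// hl// (psd_null sW hB _ Wd Bdd)//.
  by rewrite (lnull d)// hw'.
exists ((l d / B d d) *: d + w'); first exact: cW.
move=> _ /dec[z' W'z' [c ->]]; have Wz' := W'W _ W'z'.
have Wc := cW (l d / B d d) _ _ Wd Ww'.
rewrite (psd_linr hB)// hl// !hBl// (Bd z')// (hw' z')// (hBs w' d)// (Bd w')//.
by rewrite mulr0 add0r addr0 divfK.
Qed.

(** * Schur complements and their minimising property *)

Section SchurComplement.
Variables (W W' W0 : set V) (B : V -> V -> R) (eta : V -> V).
Hypotheses (sW : subspace_of W) (sW' : subspace_of W') (sW0 : subspace_of W0)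
  (sub : W' `<=` W) (sub0 : W0 `<=` W)
  (hB : psd_on W B) (W'eta : forall v, W0 v -> W' (eta v))
  (Beta : forall v z, W0 v -> W' z -> B z (eta v) = B z v).

(** Both [B u (eta v)] and [B (eta u) v] equal [B (eta u) (eta v)]. The right-hand side is linear in
    [v] without any linearity of [eta], which will be a mere choice. *)
Lemma schur_left u v : W0 u -> W0 v -> B u v - B u (eta v) = B (u - eta u) v.
Proof.
move=> W0u W0v; have [hl hs _] := hB; have Wu := sub0 W0u; have Wv := sub0 W0v.
have Weu := sub (W'eta W0u); have Wev := sub (W'eta W0v).
rewrite (linear_onB sW (hl v Wv))//; congr (_ - _).
by rewrite hs// -(Beta W0u (W'eta W0v)) hs// (Beta W0v (W'eta W0u)).
Qed.

Lemma schur_linear u : W0 u -> linear_on W0 (fun v => B u v - B u (eta v)).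
Proof.
move=> W0u a v w W0v W0w; have [_ cW] := sW0.
have Wd : W (u - eta u) by apply: (subspaceB sW); [exact: sub0|exact/sub/W'eta].
have W0avw := cW a v w W0v W0w.
rewrite !schur_left// (psd_linr hB Wd sW)//; exact: sub0.
Qed.

(** [u + z] is the sum of [u - eta u], which is orthogonal to [W'], and of an element of [W']; the
    energy of the first summand is the Schur complement. *)
Lemma schur_min u z : W0 u -> W' z -> B u u - B u (eta u) <= B (u + z) (u + z).
Proof.
move=> W0u W'z; have [hl hs hp] := hB; have Wz := sub W'z; have Wu := sub0 W0u.
have Weu := sub (W'eta W0u).
have Wd : W (u - eta u) by exact: subspaceB.
have W'k : W' (eta u + z) by apply: subspaceD => //; exact: W'eta.
have Wk := sub W'k.
have Bd0 y : W' y -> B (u - eta u) y = 0.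
  move=> W'y; have Wy := sub W'y.
  by rewrite (hs _ _ Wd Wy) (linear_onB sW (psd_linr hB Wy sW))// Beta// subrr.
have -> : u + z = 1 *: (u - eta u) + (eta u + z).
  by rewrite scale1r addrA subrK.
rewrite (psd_expand _ sW hB Wd Wk) (Bd0 _ W'k) schur_left//.
have -> : B (u - eta u) u = B (u - eta u) (u - eta u).
  by rewrite (linear_onB sW (psd_linr hB Wd sW))// (Bd0 _ (W'eta W0u)) subr0.
by rewrite mulr0 addr0 expr1n mul1r lerDl hp.
Qed.

End SchurComplement.

(** With [u] the sum, orthonormality gives [h u (psi i) = c i], hence [s u (psi i) = c i / al i].
    The two sides become sums of [c i ^+ 2] and of [c i ^+ 2 * (A / al i)], and [A / al i] exceeds 1
    on the selected indices. *)
Lemma eigen_bound n (psi : 'I_n -> V) (al : 'I_n -> R) W (h s : V -> V -> R)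
    (A : R) (c : 'I_n -> R) :
  subspace_of W -> (forall i, W (psi i)) ->
  (forall u, W u -> linear_on W (h u)) -> (forall u, W u -> linear_on W (h^~ u)) ->
  (forall u, W u -> linear_on W (s u)) ->
  (forall i u, W u -> h u (psi i) = al i * s u (psi i)) ->
  (forall i, 1 < al i) -> (forall i j, h (psi i) (psi j) = (i == j)%:R) ->
  h (\sum_(i | al i < A) c i *: psi i) (\sum_(i | al i < A) c i *: psi i) <=
  A * s (\sum_(i | al i < A) c i *: psi i) (\sum_(i | al i < A) c i *: psi i).
Proof.
move=> sW Wpsi hr hl sr eig al1 orth; set u := \sum_(i | _) _.
have Wc i : W (c i *: psi i) by exact: subspaceZ.
have Wu : W u by exact: subspace_sum.
have expand (l : V -> R) : linear_on W l ->
    l u = \sum_(i | al i < A) c i * l (psi i).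
  move=> ll; rewrite (linear_on_sum _ sW ll)//.
  by apply: eq_bigr => i _; rewrite (linear_onZ _ sW ll).
have hpsi i : al i < A -> h u (psi i) = c i.
  move=> ali; rewrite (expand _ (hl _ (Wpsi i))) (bigD1 i)//= orth eqxx mulr1.
  by rewrite big1 ?addr0// => j /andP[_ /negbTE ji]; rewrite orth ji mulr0.
rewrite (expand _ (hr _ Wu)) (expand _ (sr _ Wu)) mulr_sumr.
apply: ler_sum => i ali; have := hpsi i ali; rewrite eig// => hc.
have al0 : 0 < al i by exact: lt_trans (al1 i).
have -> : c i * (al i * s u (psi i)) = c i ^+ 2 by rewrite hc.
have -> : s u (psi i) = c i / al i by rewrite -hc mulrAC divff ?gt_eqF// mul1r.
have -> : A * (c i * (c i / al i)) = c i ^+ 2 * (A / al i) by field; rewrite gt_eqF.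
by rewrite ler_peMr ?sqr_ge0// ler_pdivlMr// mul1r ltW.
Qed.

End PsdForms.

(** * Barycentric coordinates and triangulations *)

Section Barycentric.
Context {R : realType}.
Implicit Types (t s e : {fset R * R}) (T : {fset {fset R * R}})
  (a p q r x y : R * R) (F : R * R -> R).

Definition affine F :=
  exists c0 c1 c2 : R, forall x, F x = c0 + c1 * x.1 + c2 * x.2.

Lemma sum_fst (I : Type) (r : seq I) (P : pred I) (F : I -> R * R) :
  (\sum_(i <- r | P i) F i).1 = \sum_(i <- r | P i) (F i).1.
Proof. exact: (big_morph (@fst R R)). Qed.

Lemma sum_snd (I : Type) (r : seq I) (P : pred I) (F : I -> R * R) :
  (\sum_(i <- r | P i) F i).2 = \sum_(i <- r | P i) (F i).2.
Proof. exact: (big_morph (@snd R R)). Qed.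

Lemma affine_sum F (I : Type) (r : seq I) (P : pred I) (w : I -> R)
    (p : I -> R * R) : affine F -> \sum_(i <- r | P i) w i = 1 ->
  F (\sum_(i <- r | P i) w i *: p i) = \sum_(i <- r | P i) w i * F (p i).
Proof.
move=> [c0 [c1 [c2 hF]]] w1; rewrite hF sum_fst sum_snd.
under [RHS]eq_bigr => i _ do rewrite hF 2!mulrDr.
rewrite !big_split/= -mulr_suml w1 mul1r !mulr_sumr; congr (_ + _ + _).
  by apply: eq_bigr => i _; rewrite mulrCA.
by apply: eq_bigr => i _; rewrite mulrCA.
Qed.

Lemma affine_continuous F : affine F -> continuous F.
Proof.
move=> [c0 [c1 [c2 hF]]].
have -> : F = (fun x => c0 + c1 * x.1 + c2 * x.2) by apply/funext.
move=> x; apply: cvgD; [apply: cvgD|].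
- exact: cvg_cst.
- by apply: cvgM; [exact: cvg_cst|exact: cvg_fst].
- by apply: cvgM; [exact: cvg_cst|exact: cvg_snd].
Qed.

Definition is_bary t (b : R * R -> R * R -> R) :=
  [/\ forall a, affine (b a),
      forall a c, a \in t -> c \in t -> b a c = (a == c)%:R,
      forall x, \sum_(a <- t) b a x = 1 &
      forall x, \sum_(a <- t) b a x *: a = x].

(** Chosen rather than computed because a vertex set carries no order. *)
Definition bary t := xget (fun _ _ => 0) (is_bary t).

Lemma affine_det p q c (D : R) :
  affine (fun x => c * ((p.1 - x.1) * (q.2 - x.2) - (p.2 - x.2) * (q.1 - x.1)) / D).
Proof.
exists (c * (p.1 * q.2 - p.2 * q.1) / D), (c * (p.2 - q.2) / D),
  (c * (q.1 - p.1) / D) => x; ring.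
Qed.

Lemma nondegenerate_perm t : Defs.nondegenerate t ->
  exists p q r, [/\ [/\ p != q, p != r & q != r], t = [fset p; q; r]%fset,
    perm_eq t [:: p; q; r] &
    (q.1 - p.1) * (r.2 - p.2) - (q.2 - p.2) * (r.1 - p.1) != 0].
Proof.
move=> [p [q [r [te D0]]]].
have pq : p != q by apply: contraNneq D0 => ->; apply/eqP; ring.
have pr : p != r by apply: contraNneq D0 => ->; apply/eqP; ring.
have qr : q != r by apply: contraNneq D0 => ->; apply/eqP; ring.
exists p, q, r; split => //.
apply: uniq_perm; rewrite ?fset_uniq//=; first by rewrite !inE negb_or pq pr qr.
by move=> x; rewrite te !inE orbA.
Qed.

Lemma bary_exists t : Defs.nondegenerate t -> exists b, is_bary t b.
Proof.
move=> /nondegenerate_perm[p [q [r [[pq pr qr] te tperm D0]]]].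
set D := (X in X != 0) in D0.
(* [d u v x] is the signed area of the triangle [x u v] relative to that of [p q r]. *)
pose d (u v : R * R) x := 1 * ((u.1 - x.1) * (v.2 - x.2) - (u.2 - x.2) * (v.1 - x.1)) / D.
have Daff u v : affine (d u v) by exact: affine_det.
pose b a := if a == p then d q r else if a == q then d r p else d p q.
have bp : b p = d q r by rewrite /b eqxx.
have bq : b q = d r p by rewrite /b eqxx eq_sym (negbTE pq).
have br : b r = d p q by rewrite /b eq_sym (negbTE pr) eq_sym (negbTE qr).
have D0' := D0; rewrite /D in D0'.
exists b; split.
- by move=> a; rewrite /b; case: ifP => _; [|case: ifP => _].
- have D1 u v x : d u v x * D = ((u.1 - x.1) * (v.2 - x.2) - (u.2 - x.2) * (v.1 - x.1)).
    by rewrite /d mul1r divfK.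
  move=> a c; rewrite te !inE => /orP[/orP[]|] /eqP-> /orP[/orP[]|] /eqP->;
  rewrite ?bp ?bq ?br ?eqxx ?(negbTE pq) ?(negbTE pr) ?(negbTE qr)
    1?eq_sym ?(negbTE pq) ?(negbTE pr) ?(negbTE qr); apply: (can_inj (mulfK D0));
  rewrite /= D1 /D /=; ring.
- move=> x; rewrite (perm_big _ tperm)/= !big_cons big_nil bp bq br /d /D.
  by field.
- move=> x; rewrite (perm_big _ tperm)/= !big_cons big_nil bp bq br /d /D.
  by rewrite [RHS]surjective_pairing; congr pair => /=; rewrite /GRing.scale/=; field.
Qed.

Lemma baryP t : Defs.nondegenerate t -> is_bary t (bary t).
Proof. by move=> /bary_exists; exact: (xgetPex (fun _ _ => 0)). Qed.

End Barycentric.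

Section Hulls.
Context {R : realType}.
Implicit Types (t s e : {fset R * R}) (T : {fset {fset R * R}})
  (a p q r x y : R * R) (F : R * R -> R).

Lemma bary_affine t a : Defs.nondegenerate t -> affine (bary t a).
Proof. by move=> /baryP[]. Qed.

Lemma bary_continuous t a : Defs.nondegenerate t -> continuous (bary t a).
Proof. by move=> nt; exact/affine_continuous/bary_affine. Qed.

Lemma bary_vertex t a c : Defs.nondegenerate t -> a \in t -> c \in t ->
  bary t a c = (a == c)%:R.
Proof. by move=> /baryP[_ + _ _]; apply. Qed.

Lemma sum_bary t x : Defs.nondegenerate t -> \sum_(a <- t) bary t a x = 1.
Proof. by move=> /baryP[_ _ + _]; apply. Qed.

Lemma bary_comb t x : Defs.nondegenerate t -> \sum_(a <- t) bary t a x *: a = x.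
Proof. by move=> /baryP[_ _ _ +]; apply. Qed.

Lemma affineE t F x : Defs.nondegenerate t -> affine F ->
  F x = \sum_(a <- t) bary t a x * F a.
Proof.
by move=> nt aF; rewrite -{1}(bary_comb x nt) affine_sum// sum_bary.
Qed.

Lemma bary_face t s (w : R * R -> R) a : Defs.nondegenerate t ->
  (s `<=` t)%fset -> \sum_(p <- s) w p = 1 -> a \in t ->
  bary t a (\sum_(p <- s) w p *: p) = if a \in s then w a else 0.
Proof.
move=> nt st w1 at_; rewrite affine_sum//; last exact: bary_affine.
rewrite (eq_big_seq (fun p => if p == a then w p else 0)); last first.
  move=> p ps; rewrite bary_vertex//; last exact: (fsubsetP st).
  by rewrite eq_sym; case: eqP => _; rewrite ?mulr1 ?mulr0.
rewrite -big_mkcond/=; case: ifPn => [|] as_; last first.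
  rewrite big_seq_cond big1// => p /andP[ps /eqP pa].
  by rewrite -pa ps in as_.
rewrite big_mkcond (bigD1_seq a) ?fset_uniq//= eqxx big1 ?addr0//.
by move=> i /negbTE->.
Qed.

(** On a face the weights of a convex combination are the barycentric coordinates. Incidence
    questions about faces of [t] thus become signs and zeros of the functions [bary t a]. *)
Lemma hull_faceP t s x : Defs.nondegenerate t -> (s `<=` t)%fset ->
  hull s x <-> (forall a, a \in t -> 0 <= bary t a x) /\
               (forall a, a \in t -> a \notin s -> bary t a x = 0).
Proof.
move=> nt st; split=> [[w [w0 w1 ->]]|[h0 hz]].
  split=> a at_; first by rewrite bary_face//; case: ifPn => // /w0.
  by move=> /negbTE as_; rewrite bary_face// as_.
exists (fun a => bary t a x); split.
- by move=> p /(fsubsetP st); exact: h0.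
- by rewrite -(sum_bary x nt); apply: big_fset_incl.
- rewrite -{1}(bary_comb x nt); apply/esym; apply: big_fset_incl => // a aT as_.
  by rewrite hz// scale0r.
Qed.

Lemma hullP t x : Defs.nondegenerate t ->
  hull t x <-> (forall a, a \in t -> 0 <= bary t a x).
Proof.
move=> nt; split; first by move=> /(hull_faceP _ nt (fsubset_refl t))[].
move=> h; apply/(hull_faceP _ nt (fsubset_refl t)); split=> // a at_.
by rewrite at_.
Qed.

Lemma hull_sub s s' : (s `<=` s')%fset -> hull s `<=` hull s'.
Proof.
move=> ss x [w [w0 w1 ->]]; exists (fun p => if p \in s then w p else 0); split.
- by move=> p _; case: ifPn => // /w0.
- rewrite -w1 -(big_fset_incl _ ss)/=.
    by apply: eq_big_seq => p ->.
  by move=> p _ /negbTE ->.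
- rewrite -(big_fset_incl _ ss)/=; last first.
    by move=> p _ /negbTE ->; rewrite scale0r.
  by apply: eq_big_seq => p ->.
Qed.

Lemma hull_vertex s p : p \in s -> hull s p.
Proof.
move=> ps; have /hull_sub : ([fset p] `<=` s)%fset by rewrite fsub1set.
apply; exists (fun _ => 1); split => //; first by rewrite big_seq_fset1.
by rewrite big_seq_fset1 scale1r.
Qed.

Lemma hull0 : hull (fset0 : {fset R * R}) = set0.
Proof.
apply/seteqP; split => // x [w [_]].
by rewrite big_seq_fset0 => /eqP; rewrite eq_sym oner_eq0.
Qed.

Lemma hull1 p : hull [fset p]%fset = [set p].
Proof.
apply/seteqP; split => [x [w [_]]|x ->]; last by apply: hull_vertex; rewrite inE.
by rewrite !big_seq_fset1 => -> ->; rewrite scale1r.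
Qed.

Lemma hull_interP t s u x : Defs.nondegenerate t -> (s `<=` t)%fset ->
  (u `<=` t)%fset -> hull s x -> hull u x -> hull (s `&` u)%fset x.
Proof.
move=> nt st ut /(hull_faceP _ nt st)[h0 hs] /(hull_faceP _ nt ut)[_ hu].
apply/(hull_faceP _ nt); first exact: fsubset_trans (fsubsetIl _ _) st.
split=> // a at_; rewrite in_fsetI negb_and => /orP[]; [exact: hs|exact: hu].
Qed.

Lemma bary_common t t' s a x : Defs.nondegenerate t -> Defs.nondegenerate t' ->
  (s `<=` t)%fset -> (s `<=` t')%fset -> hull s x -> a \in s ->
  bary t a x = bary t' a x.
Proof.
move=> nt nt' st st' [w [_ w1 ->]] as_.
by rewrite !bary_face ?as_//; [exact: (fsubsetP st')|exact: (fsubsetP st)].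
Qed.

Lemma hull_closed t : Defs.nondegenerate t -> closed (hull t).
Proof.
move=> nt.
have -> : hull t = \bigcap_(a in [set` t]) (bary t a @^-1` [set y | 0 <= y]).
  by apply/seteqP; split => [x /(hullP _ nt)//|x h]; apply/(hullP _ nt).
apply: closed_bigI => a _; apply: preimage_closed; last exact: closed_ge.
by move=> x _; exact: bary_continuous.
Qed.

Lemma cvg_line x y : (fun e : R => x + e *: y) @ (0 : R) --> x.
Proof.
have {2}-> : x = x + 0 *: y by rewrite scale0r addr0.
by apply: cvgD; [exact: cvg_cst|apply: cvgZl; exact: cvg_id].
Qed.

Lemma affine_line F x y (c : R) : affine F ->
  F (x + c *: (x - y)) = F x + c * (F x - F y).
Proof. by move=> [c0 [c1 [c2 h]]]; rewrite !h /=; rewrite /GRing.scale/=; ring. Qed.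

(** Moves beyond [x], away from [y]. If [y] is a vertex, its own coordinate turns negative when it
    vanishes at [x]. *)
Lemma near_line (A : set (R * R)) x y : nbhs x A ->
  exists2 c : R, 0 < c & A (x + c *: (x - y)).
Proof.
move=> xA.
have h : \forall c \near (0 : R), A (x + c *: (x - y)) by exact: (@cvg_line x (x - y) A xA).
have h2 : \forall c \near (0 : R)^'+, A (x + c *: (x - y)).
  by apply: cvg_within; exact: h.
have h3 : \forall c \near (0 : R)^'+, 0 < c by exact: nbhs_right_gt.
have [c [? ?]] := filter_ex (filterI h2 h3).
by exists c.
Qed.

Lemma interior_hullP t x : Defs.nondegenerate t ->
  (hull t)° x <-> (forall a, a \in t -> 0 < bary t a x).
Proof.
move=> nt; split=> [xt a at_|h].
  rewrite lt_neqAle; apply/andP; split; last first.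
    by move/interior_subset : xt => /(hullP _ nt); exact.
  apply/eqP => b0; have [c c0] := near_line a xt.
  move=> /(hullP _ nt) /(_ a at_); rewrite affine_line; last exact: bary_affine.
  by rewrite -b0 (bary_vertex nt)// eqxx add0r sub0r mulrN1; lra.
have : nbhs x (\bigcap_(a in [set` t]) (bary t a @^-1` [set y | 0 < y])).
  apply: filter_bigI => a at_; apply: bary_continuous => //.
  by apply: open_nbhs_nbhs; split; [exact: open_gt|exact: h].
by apply: filterS => y hy; apply/(hullP _ nt) => a at_; apply/ltW/hy.
Qed.

Lemma fproper_ex s t : (s `<` t)%fset ->
  (s `<=` t)%fset /\ exists2 a, a \in t & a \notin s.
Proof. by rewrite fproperE => /andP[-> /fsubsetPn]. Qed.

Lemma interior_face t s x : Defs.nondegenerate t -> (s `<` t)%fset ->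
  (hull t)° x -> hull s x -> False.
Proof.
move=> nt /fproper_ex[st [a at_ as_]] /(interior_hullP _ nt) /(_ a at_).
by move=> b0 /(hull_faceP _ nt st)[_ /(_ a at_ as_) h]; rewrite h ltxx in b0.
Qed.

Lemma card_nondegenerate t : Defs.nondegenerate t -> #|` t| = 3.
Proof.
move=> /nondegenerate_perm[p [q [r [[pq pr qr] te tp _]]]].
by rewrite cardfE; rewrite -cardfE (perm_size tp).
Qed.

(** Indexing an edge by the opposite vertex lets sums over the edges of an element run over its
    three vertices. *)
Lemma edges_ofP t e : Defs.nondegenerate t ->
  edges_of t e <-> exists2 a, a \in t & e = (t `\ a)%fset.
Proof.
move=> nt; have c3 := card_nondegenerate nt; split.
  move=> [et e2].
  have : (e `<` t)%fset.
    by rewrite fproperEneq et andbT; apply/eqP => ee; rewrite ee c3 in e2.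
  move=> /fproper_ex[_ [a at_ ae]]; exists a => //.
  apply/eqP; rewrite eqEfcard fsubsetD1 et ae/=.
  by have := cardfsD1 a t; rewrite at_ c3 e2 add1n => -[<-].
move=> [a at_ ->]; split; first exact: fsubD1set.
by have := cardfsD1 a t; rewrite at_ c3 add1n => -[<-].
Qed.

Lemma hull_dec t x : Defs.nondegenerate t -> hull t x -> (hull t)° x \/ bdry t x.
Proof.
move=> nt xt; have [|xi] := pselect ((hull t)° x); first by left.
right; apply: contrapT => nb; apply: xi; apply/(interior_hullP _ nt) => a at_.
rewrite lt_neqAle; apply/andP; split; last by move/(hullP _ nt) : xt; exact.
apply/eqP => b0; apply: nb; exists (t `\ a)%fset; first by apply/edges_ofP=> //; exists a.
apply/(hull_faceP _ nt); first exact: fsubD1set.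
split; first exact/(hullP _ nt).
by move=> c ct; rewrite in_fsetD1 ct andbT negbK => /eqP->.
Qed.

Lemma bdryP t x : Defs.nondegenerate t -> bdry t x -> hull t x.
Proof. by move=> nt [e [et _]]; exact: hull_sub. Qed.

Lemma interior_hull_neq0 t : Defs.nondegenerate t -> (hull t)° !=set0.
Proof.
move=> nt; exists (\sum_(p <- t) (fun=> 3^-1 : R) p *: p).
apply/(interior_hullP _ nt) => a at_; rewrite bary_face// ?at_ ?invr_gt0//.
rewrite big_const_seq count_predT (card_nondegenerate nt) /= addr0; lra.
Qed.

End Hulls.

(** * Conforming triangulations and nodal interpolation *)

Section Triangulations.
Context {R : realType}.
Implicit Types (t s e tau : {fset R * R}) (T : {fset {fset R * R}})
  (a p q r x y : R * R) (F c : R * R -> R) (Om : set (R * R)).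

Lemma triangulation_nondegenerate Om T t :
  triangulation Om T -> t \in T -> Defs.nondegenerate t.
Proof. by move=> [+ _ _ _ _]; apply. Qed.

(** Conformity concerns whole triangles: it puts [x] on the common face, which is then intersected
    with [s] inside [t] and with [s'] inside [t']. *)
Lemma face_inter Om T t t' s s' x : triangulation Om T ->
  t \in T -> t' \in T -> (s `<=` t)%fset -> (s' `<=` t')%fset ->
  hull s x -> hull s' x -> hull (s `&` s')%fset x.
Proof.
move=> HT tT tT' st st' sx sx'; have [nd conf _ _ _] := HT.
have : hull (t `&` t')%fset x.
  by rewrite -conf//; split; [exact: hull_sub sx|exact: hull_sub sx'].
move=> /(hull_interP (nd _ tT) st (fsubsetIl _ _) sx) sux.
have := hull_interP (nd _ tT') _ st' sux sx'; rewrite -fsetIA => h.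
apply: hull_sub (h _); last first.
  by apply: fsubset_trans (fsubsetIr _ _) _; apply: fsubsetIr.
by apply: fsetIS; apply: fsubsetIr.
Qed.

Lemma interior_disjoint Om T t t' x : triangulation Om T ->
  t \in T -> t' \in T -> t != t' -> (hull t)° x -> hull t' x -> False.
Proof.
move=> HT tT tT' tt' xi xt'; have nd := triangulation_nondegenerate HT.
have := face_inter HT tT tT' (fsubset_refl _) (fsubset_refl _) (interior_subset xi) xt'.
apply: interior_face (nd _ tT) _ xi; rewrite fproperEcard fsubsetIl/=.
rewrite ltnNge; apply/negP => le_tI.
have /eqP tI : (t `&` t')%fset == t by rewrite eqEfcard fsubsetIl.
case/eqP : tt'; apply/eqP; rewrite eqEfcard !(card_nondegenerate (nd _ _))// leqnn andbT.
by rewrite -tI fsubsetIr.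
Qed.

Lemma hull_inter_bdry Om T t t' x : triangulation Om T ->
  t \in T -> t' \in T -> t != t' -> hull t x -> hull t' x -> bdry t x.
Proof.
move=> HT tT tT' tt' xt xt'; have nd := triangulation_nondegenerate HT.
by have [xi|//] := hull_dec (nd _ tT) xt; case: (interior_disjoint HT tT tT' tt' xi xt').
Qed.

Lemma triangulation_cover Om T x : triangulation Om T -> closure Om x ->
  exists2 t, t \in T & hull t x.
Proof. by move=> [_ _ -> _ _] [t]; exists t. Qed.

Lemma hull_closure Om T t x : triangulation Om T -> t \in T -> hull t x -> closure Om x.
Proof. by move=> [_ _ -> _ _] tT tx; exists t. Qed.

Lemma edge_pair_vertex Om T e e' x : triangulation Om T ->
  edges T e -> edges T e' -> e != e' -> hull e x -> hull e' x -> vertices T x.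
Proof.
move=> HT [t tT [et e2]] [t' tT' [et' e2']] ee' ex ex'.
have := face_inter HT tT tT' et et' ex ex'.
have : (#|` (e `&` e')%fset| < 2)%N.
  rewrite ltnNge; apply/negP => le2; case/eqP : ee'.
  have /eqP <- : (e `&` e')%fset == e by rewrite eqEfcard fsubsetIl e2.
  by apply/eqP; rewrite eqEfcard fsubsetIr e2'.
case cE : #|` (e `&` e')%fset| => [|[|//]] _.
  by move/cardfs0_eq : cE => ->; rewrite hull0.
move/eqP/cardfs1P : cE => [p pE]; rewrite pE hull1 => ->.
exists t => //; apply: (fsubsetP et).
by have : p \in [fset p]%fset by [rewrite inE]; rewrite -pE in_fsetI => /andP[].
Qed.

(** The coordinate [bary t p] is at most 1 on [hull t], with equality only at [p]. A convex
    combination of points of [s] at which it equals 1 must involve such a point. *)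
Lemma extreme_vertex t s p : Defs.nondegenerate t -> p \in t ->
  hull s `<=` hull t -> hull s p -> p \in s.
Proof.
move=> nt pt st [w [w0 w1 pE]].
have bt q a : q \in s -> a \in t -> 0 <= bary t a q.
  by move=> /hull_vertex/st/(hullP _ nt); exact.
have b1 q : q \in s -> 0 <= 1 - bary t p q.
  move=> qs; rewrite -(sum_bary q nt) (bigD1_seq p) ?fset_uniq//= addrAC subrr add0r.
  by rewrite big_seq_cond; apply: sumr_ge0 => a /andP[at_ _]; exact: bt.
have : \sum_(q <- s) w q * (1 - bary t p q) = 0.
  under eq_bigr do rewrite mulrBr mulr1.
  rewrite sumrB w1 -affine_sum//; last exact: bary_affine.
  by rewrite -pE bary_vertex// eqxx subrr.
move/eqP; rewrite big_seq psumr_eq0; last first.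
  by move=> q qs; apply: mulr_ge0; [exact: w0|exact: b1].
move=> /allP h.
have [q qs wq] : exists2 q, q \in s & w q != 0.
  apply: contrapT => nex; have := oner_neq0 R; rewrite -w1 big_seq big1 ?eqxx//.
  by move=> q qs; apply/eqP; apply: contrapT => /negP wq; apply: nex; exists q.
have := h q qs; rewrite qs/= mulf_eq0 (negbTE wq)/= => /eqP bq.
have bq1 : bary t p q = 1 by lra.
suff -> : p = q by [].
have h0 a : a \in t -> a != p -> bary t a q = 0.
  move=> at_ ap; have := sum_bary q nt; rewrite (bigD1_seq p) ?fset_uniq//= bq1.
  move=> /(canRL (addKr _)); rewrite addNr => /eqP.
  rewrite big_seq_cond psumr_eq0; last by move=> ? /andP[? _]; exact: bt.
  by move=> /allP/(_ a at_); rewrite at_ ap => /eqP.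
rewrite -[RHS](bary_comb q nt) (bigD1_seq p) ?fset_uniq//= bq1 scale1r.
rewrite big_seq_cond big1 ?addr0// => a /andP[at_ ap].
by rewrite h0// scale0r.
Qed.

Lemma near_fset (X : topologicalType) (I : choiceType) (D : {fset I}) (x : X)
    (Q : I -> X -> Prop) :
  (forall i, i \in D -> \forall y \near x, Q i y) ->
  \forall y \near x, forall i, i \in D -> Q i y.
Proof. by move=> h; exact: (@filter_bigI X I D Q (nbhs x) _ h). Qed.

(** Away from the closed set the claim is vacuous, so a local property on finitely many closed
    pieces can be checked at the points of each piece. *)
Lemma near_closed (X : topologicalType) (C : set X) (x : X) (Q : X -> Prop) :
  closed C -> (C x -> \forall y \near x, C y -> Q y) -> \forall y \near x, C y -> Q y.
Proof.
move=> cC h; have [Cx|nCx] := pselect (C x); first exact: h.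
have : \forall y \near x, (~` C) y.
  by apply: open_nbhs_nbhs; split => //; rewrite openC.
by apply: filterS => y nCy /nCy.
Qed.

Lemma glue_continuous Om T (f : R * R -> R) : open Om -> triangulation Om T ->
  (forall x, ~ Om x -> f x = 0) ->
  (forall t, t \in T -> exists2 G, continuous G & forall x, hull t x -> f x = G x) ->
  continuous f.
Proof.
move=> oOm HT f0 fT x; apply/cvgrPdist_lt => eps eps0.
have hOm : \forall y \near x, (~` Om) y -> `|f x - f y| < eps.
  apply: near_closed; first by rewrite closedC.
  by move=> /f0 ->; apply: filterE => y /f0 ->; rewrite subrr normr0.
have hT : \forall y \near x, forall t, t \in T -> hull t y -> `|f x - f y| < eps.
  apply: near_fset => t tT; apply: near_closed.
    by apply: hull_closed; exact: (triangulation_nondegenerate HT tT).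
  move=> tx; have [G cG fG] := fT t tT.
  have /cvgrPdist_lt/(_ eps eps0) := cG x.
  by apply: filterS => y; rewrite -fG// => ? ty; rewrite (fG y).
near=> y.
have [Omy|nOmy] := pselect (Om y); last exact: (near hOm).
have [t tT ty] := triangulation_cover HT (subset_closure Omy).
by apply: (near hT) ty.
Unshelve. all: by end_near.
Qed.

(** By [interp_face] the choice among several triangles is immaterial. The default [fset0] makes
    [interp] an empty sum, hence 0, off the closed domain. *)
Definition locate T x : {fset R * R} := xget fset0 [set t | t \in T /\ hull t x].

Definition interp T c x : R := \sum_(a <- locate T x) bary (locate T x) a x * c a.

(** With [u] the located triangle, [x] lies on the face spanned by the common vertices of [s] and
    [u]. Coordinates of vertices off that face vanish, and the others agree in both triangles. *)
Lemma interp_face Om T c t s x : triangulation Om T -> t \in T -> (s `<=` t)%fset ->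
  hull s x -> interp T c x = \sum_(a <- s) bary t a x * c a.
Proof.
move=> HT tT st sx; have nd := triangulation_nondegenerate HT.
have : [set t | t \in T /\ hull t x] (locate T x).
  by apply: xgetPex; exists t; split=> //; exact: hull_sub sx.
rewrite /interp; move: (locate T x) => u [uT ux].
have ssu := face_inter HT tT uT st (fsubset_refl _) sx ux.
have ist : (s `&` u `<=` t)%fset by apply: fsubset_trans (fsubsetIl _ _) st.
rewrite -(big_fset_incl _ (fsubsetIr s u)); last first.
  move=> a au asu; have [_ ->//] := (hull_faceP x (nd _ uT) (fsubsetIr s u)).1 ssu.
  by rewrite mul0r.
rewrite -(big_fset_incl _ (fsubsetIl s u)); last first.
  move=> a /(fsubsetP st) au asu.
  by have [_ ->//] := (hull_faceP x (nd _ tT) ist).1 ssu; rewrite mul0r.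
apply: eq_big_seq => a asu; congr (_ * _).
by rewrite (bary_common (nd _ uT) (nd _ tT) (fsubsetIr s u) ist ssu).
Qed.

Lemma interp_vertex Om T c p : triangulation Om T -> vertices T p -> interp T c p = c p.
Proof.
move=> HT [t tT pt]; have nt := triangulation_nondegenerate HT tT.
have st : ([fset p] `<=` t)%fset by rewrite fsub1set.
rewrite (interp_face c HT tT st) ?hull1// big_seq_fset1 bary_vertex//.
by rewrite eqxx mul1r.
Qed.

Lemma boundaryE Om : open Om -> boundary Om = closure Om `\` Om.
Proof. by move=> oOm; rewrite /boundary ((interior_id Om).1 oOm). Qed.

Lemma interp_outside Om T c x : open Om -> triangulation Om T ->
  (forall p, vertices T p -> boundary Om p -> c p = 0) -> ~ Om x -> interp T c x = 0.
Proof.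
move=> oOm HT c0 nx; have [clx|ncl] := pselect (closure Om x); last first.
  rewrite /interp /locate; case: xgetP => [t tE [tT tx]|_].
    by exfalso; apply: ncl; exact: (hull_closure HT tT tx).
  by rewrite big_seq_fset0.
have bx : boundary Om x by rewrite boundaryE.
(* A boundary point lies on an edge contained in the boundary, whose end points are then boundary
   vertices. *)
have [_ _ _ _ bE] := HT; move: (bx); rewrite bE => -[e [[t tT [et _]] /= eb] ex].
rewrite (interp_face c HT tT et ex) big_seq big1// => a ae.
rewrite c0 ?mulr0//; first by exists t => //; exact: (fsubsetP et).
by apply: eb; exact: hull_vertex.
Qed.

Lemma interp_affine Om T c t : triangulation Om T -> t \in T ->
  exists2 G, affine G & forall x, hull t x -> interp T c x = G x.
Proof.
move=> HT tT; exists (fun x => \sum_(a <- t) bary t a x * c a); last first.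
  by move=> x; apply: (interp_face c HT tT (fsubset_refl t)).
have nt := triangulation_nondegenerate HT tT.
elim: (enum_fset t) => [|a l [d0 [d1 [d2 IH]]]].
  by exists 0, 0, 0 => x; rewrite big_nil; ring.
have [b0 [b1 [b2 hb]]] := bary_affine a nt.
exists (b0 * c a + d0), (b1 * c a + d1), (b2 * c a + d2) => x.
by rewrite big_cons IH hb; ring.
Qed.

(* Points of [Om] slightly beyond an inner point of the edge [e] lie outside [t],
   hence in another triangle. *)
Lemma edge_shared Om T e t : open Om -> triangulation Om T ->
  t \in T -> edges_of t e -> ~ (hull e `<=` boundary Om) ->
  exists2 t', t' \in T & t' != t /\ (e `<=` t')%fset.
Proof.
move=> oOm HT tT et nb; have nt := triangulation_nondegenerate HT tT.
have [a at_ eE] := (edges_ofP e nt).1 et; have [sub e2] := et.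
apply: contrapT => nex; apply: nb => x ex.
rewrite boundaryE//; split; first exact: (hull_closure HT tT (hull_sub sub ex)).
move=> Omx.
(* [x] may be an end point of [e]. Moving it slightly towards the midpoint [m] stays inside [Om] and
   makes both coordinates of the edge positive. *)
pose m := \sum_(p <- e) (fun=> 2^-1 : R) p *: p.
have me p : p \in t -> bary t p m = if p \in e then 2^-1 else 0.
  move=> pt; rewrite bary_face//.
  rewrite big_const_seq count_predT e2 /= addr0; lra.
have be p y : hull e y -> p \in t -> 0 <= bary t p y.
  by move=> /(hull_faceP y nt sub)[+ _]; exact.
have bea y : hull e y -> bary t a y = 0.
  by move=> /(hull_faceP y nt sub)[_]; apply=> //; rewrite eE in_fsetD1 eqxx.
pose seg (d : R) := x + d *: (m - x).
have hseg (d : R) p : bary t p (seg d) = bary t p x + d * (bary t p m - bary t p x).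
  have -> : seg d = x + (- d) *: (x - m) by rewrite /seg -[x - m]opprB scalerN scaleNr opprK.
  by rewrite affine_line; [ring|exact: bary_affine].
have [d [d0 d1 Omd]] : exists d : R, [/\ 0 < d, d < 1 & Om (seg d)].
  have h : \forall d \near (0 : R), Om (seg d).
    by apply: (@cvg_line _ x (m - x) Om); exact: open_nbhs_nbhs.
  have h2 : \forall d \near (0 : R)^'+, Om (seg d) by apply: cvg_within; exact: h.
  have h3 : \forall d \near (0 : R)^'+, 0 < d by exact: nbhs_right_gt.
  have h4 : \forall d \near (0 : R)^'+, d < 1 by exact: nbhs_right_lt.
  near (0 : R)^'+ => d; exists d; split.
  - by near: d.
  - by near: d.
  - by near: d.
set y := seg d in hseg Omd.
have ypos p : p \in e -> 0 < bary t p y.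
  move=> pe; have pt := fsubsetP sub _ pe.
  rewrite /y hseg me// pe; have := be p x ex pt; nra.
have ya : bary t a y = 0.
  by rewrite /y hseg me// eE in_fsetD1 eqxx/= bea//; ring.
have yt : hull t y.
  apply/(hullP _ nt) => p pt; have [->|pa] := eqVneq p a; first by rewrite ya.
  by apply/ltW/ypos; rewrite eE in_fsetD1 pa.
have nty t' : t' \in T -> t' != t -> ~ hull t' y.
  move=> tT' tt' t'y; apply: nex; exists t' => //; split=> //.
  have := face_inter HT tT tT' (fsubset_refl t) (fsubset_refl t') yt t'y.
  move=> /(hull_faceP y nt (fsubsetIl t t'))[_ hz].
  apply/fsubsetP => p pe; have pt := fsubsetP sub _ pe.
  apply: contrapT => /negP pt'; have := ypos p pe.
  by rewrite hz ?ltxx// in_fsetI pt.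
have : \forall z \near y, forall t', t' \in T -> hull t' z -> t' = t.
  apply: near_fset => t' tT'; apply: near_closed.
    by apply: hull_closed; exact: (triangulation_nondegenerate HT tT').
  move=> t'y; apply: filterE => z _.
  by apply/eqP; apply: contrapT => /negP /(nty t' tT'); exact.
have : \forall z \near y, Om z by apply: open_nbhs_nbhs.
move=> Omy hy; have [c c0 [Omz hz]] := near_line a (filterI Omy hy).
have [t' tT' t'z] := triangulation_cover HT (subset_closure Omz).
move: (t'z); rewrite (hz t' tT' t'z) => /(hullP _ nt)/(_ a at_).
rewrite affine_line; last exact: bary_affine.
by rewrite ya bary_vertex// eqxx add0r sub0r mulrN1; lra.
Unshelve. all: by end_near.
Qed.

End Triangulations.

(** * Integrals modulo a null set *)

Section AlmostEverywhereBounded.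
Context {d : measure_display} {T : measurableType d} {R : realType}.
Variable mu : {measure set T -> \bar R}.
Implicit Types (D N : set T) (f g : T -> R).

Definition integrableR D f := mu.-integrable D (EFin \o f).

(** [N] is an explicit exceptional set, later the same for all data, so that almost everywhere
    hypotheses can be combined pointwise. *)
Definition bounded_off D N f :=
  measurable_fun D f /\ exists C, forall x, D x -> ~ N x -> `|f x| <= C.

Lemma bounded_off_cst D N (c : R) : bounded_off D N (fun=> c).
Proof. by split; [exact: measurable_cst|exists `|c|]. Qed.

Lemma bounded_offD D N f g : bounded_off D N f -> bounded_off D N g ->
  bounded_off D N (fun x => f x + g x).
Proof.
move=> [mf [C hC]] [mg [C' hC']]; split; first exact: measurable_funD.
exists (C + C') => x Dx Nx; apply: le_trans (ler_normD _ _) _.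
by apply: lerD; [exact: hC|exact: hC'].
Qed.

Lemma bounded_offM D N f g : bounded_off D N f -> bounded_off D N g ->
  bounded_off D N (fun x => f x * g x).
Proof.
move=> [mf [C hC]] [mg [C' hC']]; split; first exact: measurable_funM.
exists (C * C') => x Dx Nx; rewrite normrM.
by apply: ler_pM => //; [exact: hC|exact: hC'].
Qed.

Lemma bounded_off_sum D N (I : eqType) (r : seq I) (F : I -> T -> R) :
  (forall i, i \in r -> bounded_off D N (F i)) ->
  bounded_off D N (fun x => \sum_(i <- r) F i x).
Proof.
elim: r => [_|i r IH h].
  under eq_fun do rewrite big_nil; exact: bounded_off_cst.
under eq_fun do rewrite big_cons; apply: bounded_offD.
  by apply: h; rewrite inE eqxx.
by apply: IH => j jr; apply: h; rewrite inE jr orbT.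
Qed.

Lemma bigcup_cons (I : eqType) (F : I -> set T) i (l : seq I) :
  \bigcup_(j in [set` i :: l]) F j = F i `|` \bigcup_(j in [set` l]) F j.
Proof.
apply/seteqP; split => [x [j /=]|x [Fx|[j jl Fx]]].
- by rewrite inE => /orP[/eqP->|jl Fx]; [left|right; exists j].
- by exists i => //=; rewrite inE eqxx.
- by exists j => //=; rewrite inE jl orbT.
Qed.

Lemma null_bigcup (I : eqType) (l : seq I) (F : I -> set T) :
  (forall i, i \in l -> measurable (F i) /\ mu (F i) = 0%E) ->
  measurable (\bigcup_(i in [set` l]) F i) /\ mu (\bigcup_(i in [set` l]) F i) = 0%E.
Proof.
elim: l => [_|i l IH h]; first by rewrite set_nil bigcup_set0 measure0.
have [mi i0] := h i (mem_head _ _).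
have [ml l0] : measurable (\bigcup_(i in [set` l]) F i) /\
    mu (\bigcup_(i in [set` l]) F i) = 0%E.
  by apply: IH => j jl; apply: h; rewrite inE jl orbT.
by rewrite bigcup_cons; split; [exact: measurableU|rewrite measureU0].
Qed.

Lemma bounded_off_integrable D N f : measurable D -> measurable N -> mu N = 0%E ->
  (mu D < +oo)%E -> bounded_off D N f -> integrableR D f.
Proof.
move=> mD mN N0 Doo [mf [C hC]].
apply/(@negligible_integrable _ _ _ mu D N) => //; first exact/measurable_EFinP.
apply: measurable_bounded_integrable; first exact: measurableD.
- apply: le_lt_trans Doo; apply: le_measure; rewrite ?inE//; first exact: measurableD.
- by apply: measurable_funS mf => //; exact: subDsetl.
- exists C; split; first exact: num_real.
  by move=> M CM x [Dx Nx] /=; apply: le_trans (hC x Dx Nx) (ltW CM).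
Qed.

Lemma Rintegral_off D N f : measurable D -> measurable N -> mu N = 0%E ->
  integrableR D f -> \int[mu]_(x in D) f x = \int[mu]_(x in D `\` N) f x.
Proof. by move=> mD mN N0 intf; rewrite /Rintegral (negligible_integral mN mD). Qed.

Lemma eq_Rintegral_off D N f g : measurable D -> measurable N -> mu N = 0%E ->
  integrableR D f -> integrableR D g -> (forall x, D x -> ~ N x -> f x = g x) ->
  \int[mu]_(x in D) f x = \int[mu]_(x in D) g x.
Proof.
move=> mD mN N0 intf intg fg; rewrite !(@Rintegral_off D N)//.
by apply: eq_Rintegral => x; rewrite inE => -[]; exact: fg.
Qed.

Lemma integrableRS D D' f : measurable D -> measurable D' -> D' `<=` D ->
  integrableR D f -> integrableR D' f.
Proof. by move=> mD mD' sub; exact: integrableS. Qed.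

Lemma le_Rintegral_off D N f g : measurable D -> measurable N -> mu N = 0%E ->
  integrableR D f -> integrableR D g -> (forall x, D x -> ~ N x -> f x <= g x) ->
  \int[mu]_(x in D) f x <= \int[mu]_(x in D) g x.
Proof.
move=> mD mN N0 intf intg fg; rewrite !(@Rintegral_off D N)//.
have mDN := measurableD mD mN.
apply: le_Rintegral => //; first by apply: integrableRS intf => //; exact: subDsetl.
  by apply: integrableRS intg => //; exact: subDsetl.
by move=> x []; exact: fg.
Qed.

Lemma Rintegral_lin D f g (a : R) : measurable D ->
  integrableR D f -> integrableR D g ->
  \int[mu]_(x in D) (a * f x + g x) =
  a * \int[mu]_(x in D) f x + \int[mu]_(x in D) g x.
Proof.
move=> mD intf intg; rewrite RintegralD//; first by rewrite RintegralZl.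
exact: (integrableZl mD a intf).
Qed.

Lemma integrableRD D f g : measurable D -> integrableR D f -> integrableR D g ->
  integrableR D (fun x => f x + g x).
Proof. by move=> mD intf intg; exact: (integrableD mD intf intg). Qed.

Lemma integrableRZ D f (a : R) : measurable D -> integrableR D f ->
  integrableR D (fun x => a * f x).
Proof. by move=> mD intf; exact: (integrableZl mD a intf). Qed.

Lemma le_integrableR D N f g : measurable D -> measurable N -> mu N = 0%E ->
  measurable_fun D f -> integrableR D g ->
  (forall x, D x -> ~ N x -> `|f x| <= g x) -> integrableR D f.
Proof.
move=> mD mN N0 mf intg fg; have mDN := measurableD mD mN.
apply/(@negligible_integrable _ _ _ mu D N) => //; first exact/measurable_EFinP.
apply: (@le_integrable _ _ _ mu _ mDN _ (EFin \o g)).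
- by apply/measurable_EFinP; apply: measurable_funS mf => //; exact: subDsetl.
- move=> x [Dx Nx] /=; rewrite lee_fin.
  by apply: le_trans (fg x Dx Nx) (ler_norm _).
- by apply: integrableRS intg => //; exact: subDsetl.
Qed.

Lemma Rintegral_bigsetU D N (I : choiceType) (s : {fset I}) (F : I -> set T) f :
  measurable D -> measurable N -> mu N = 0%E -> integrableR D f ->
  (forall i, i \in s -> measurable (F i)) ->
  (forall i, i \in s -> F i `<=` D) ->
  (forall i j x, i \in s -> j \in s -> F i x -> F j x -> i = j) ->
  (forall x, D x -> ~ N x -> exists2 i, i \in s & F i x) ->
  \int[mu]_(x in D) f x = \sum_(i <- s) \int[mu]_(x in F i) f x.
Proof.
move=> mD mN N0 intf mF FD Fd cov.
pose U (l : seq I) := \bigcup_(i in [set` l]) F i.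
have mU l : {subset l <= s} -> measurable (U l).
  move=> ls; apply: fin_bigcup_measurable => //.
  by move=> i il; apply: mF; exact: ls.
have UD l : {subset l <= s} -> U l `<=` D.
  by move=> ls x [i il Fx]; apply: FD Fx; exact: ls.
have sumU l : uniq l -> {subset l <= s} ->
    \int[mu]_(x in U l) f x = \sum_(i <- l) \int[mu]_(x in F i) f x.
  elim: l => [_ _|i l IH /= /andP[il ul] ls].
    by rewrite big_nil /U set_nil bigcup_set0 Rintegral_set0.
  have ls' : {subset l <= s} by move=> j jl; apply: ls; rewrite inE jl orbT.
  have is_ : i \in s by apply: ls; rewrite inE eqxx.
  have UE : U (i :: l) = F i `|` U l by exact: bigcup_cons.
  rewrite UE big_cons -IH// Rintegral_setU//; [exact: mF|exact: mU| |].
  - rewrite -UE; apply: integrableRS intf => //; [exact: mU|exact: UD].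
  - apply/disj_setPS => x [Fx [j jl Fjx]].
    by move: il; rewrite (Fd i j x is_ (ls' _ jl) Fx Fjx) jl.
rewrite -sumU ?fset_uniq//; have mUs : measurable (U s) by apply: mU.
rewrite (@Rintegral_off D N)// (@Rintegral_off (U s) N)//; last first.
  by apply: integrableRS intf => //; exact: UD.
congr (Rintegral _ _ _); apply/seteqP; split => x [Dx Nx]; split=> //.
  by have [i is_ Fx] := cov x Dx Nx; exists i.
exact: UD Dx.
Qed.

End AlmostEverywhereBounded.

(** * Lebesgue measure and triangles *)

(* The canonical measurable structure of [R * R] and the one underlying [leb2 R]
   carry different displays; the notations below fix the latter. *)
Notation plane R := (measurableTypeR R * measurableTypeR R)%type.
Notation pmeasurable R := (@measurable _ (plane R)).
Notation pmeasurable_fun R := (@measurable_fun _ _ (plane R) R).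

Section PlaneMeasure.
Context {R : realType}.
Implicit Types (t s e tau : {fset R * R}) (T : {fset {fset R * R}})
  (x y : R * R) (F : R * R -> R) (Om : set (R * R)).

Lemma affine_measurable F (D : set (R * R)) : affine F -> pmeasurable_fun R D F.
Proof.
move=> [c0 [c1 [c2 hF]]].
have -> : F = (fun x => c0 + c1 * x.1 + c2 * x.2) by apply/funext.
apply: (@measurable_funS _ _ (plane R) R setT) => //.
apply: measurable_funD; first apply: measurable_funD => //.
  by apply: measurable_funM => //; exact: measurable_fst.
by apply: measurable_funM => //; exact: measurable_snd.
Qed.

Lemma affine_preimage_measurable F (A : set R) : affine F -> measurable A ->
  pmeasurable R (F @^-1` A).
Proof.
move=> aF mA; rewrite -[_ @^-1` _]setTI.
exact: (affine_measurable (D := setT) aF).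
Qed.

(** The zero set is a line. If [c2 != 0], each vertical section is one point; otherwise the line is
    vertical, a product with a null factor. *)
Lemma affine_line_null F x y : affine F -> F x != F y ->
  leb2 R (F @^-1` [set 0]) = 0%E.
Proof.
move=> [c0 [c1 [c2 hF]]] Fxy.
have [c20|c20] := eqVneq c2 0; last first.
  rewrite /product_measure1; under eq_integral => z _.
    have -> : (lebesgue_measure \o xsection (F @^-1` [set 0])) z = 0%E.
      rewrite /= (_ : xsection _ _ = [set (- (c0 + c1 * z)) / c2]).
        exact: lebesgue_measure_set1.
      apply/seteqP; split => w /=; rewrite /xsection/= inE/= hF/= => h.
        by apply: (mulIf c20); rewrite divfK//; lra.
      by rewrite h; field.
    over.
  exact: integral0.
have c10 : c1 != 0.
  by apply: contra Fxy => /eqP c10; rewrite !hF c10 c20; apply/eqP; ring.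
have -> : F @^-1` [set 0] = [set - c0 / c1] `*` [set: R].
  apply/seteqP; split => [[u v]|[u v]] /=; rewrite hF c20/=.
    by move=> h; split=> //; apply: (mulIf c10); rewrite divfK//; lra.
  by move=> [-> _]; field.
have mS : measurable [set - c0 / c1] by exact: measurable_set1.
rewrite product_measure1E//.
by rewrite [X in (X * _)%E]lebesgue_measure_set1 mul0e.
Qed.

Lemma bary_line_null t a : Defs.nondegenerate t -> a \in t ->
  leb2 R (bary t a @^-1` [set 0]) = 0%E.
Proof.
move=> nt at_.
have [b bt ba] : exists2 b, b \in t & b != a.
  have : (0 < #|` t `\ a|%fset)%N.
    by have := cardfsD1 a t; rewrite at_ (card_nondegenerate nt) add1n => -[<-].
  by rewrite cardfs_gt0 => /fset0Pn[b]; rewrite in_fsetD1 => /andP[? ?]; exists b.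
apply: (affine_line_null (bary_affine a nt) (x := a) (y := b)).
by rewrite !bary_vertex// eqxx (eq_sym a) (negbTE ba) oner_neq0.
Qed.

Lemma interior_hull_measurable t : Defs.nondegenerate t ->
  pmeasurable R ((hull t)°).
Proof.
move=> nt.
have -> : (hull t)° = \bigcap_(a in [set` t]) (bary t a @^-1` [set` `]0, +oo[ ]).
  apply/seteqP; split => x.
    by move=> /(interior_hullP _ nt) h a at_ /=; rewrite in_itv/= h.
  move=> h; apply/(interior_hullP _ nt) => a at_.
  by have := h a at_; rewrite /= in_itv/= andbT.
apply: fin_bigcap_measurable; first exact: finite_fset.
by move=> a _; apply: affine_preimage_measurable => //; exact: bary_affine.
Qed.

Lemma hull_face_measurable t s : Defs.nondegenerate t -> (s `<=` t)%fset ->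
  pmeasurable R (hull s).
Proof.
move=> nt st.
have -> : hull s = \bigcap_(a in [set` t])
    (bary t a @^-1` (if a \in s then [set` `[0, +oo[ ] else [set 0])).
  apply/seteqP; split => x.
    move=> /(hull_faceP _ nt st)[h0 hz] a at_ /=.
    by case: ifPn => as_ /=; [rewrite in_itv/= h0|exact: hz].
  move=> h; apply/(hull_faceP _ nt st); split => a at_.
    have := h a at_ => /=; case: ifPn => as_ /=.
      by rewrite in_itv/= andbT.
    by move=> ->.
  by move=> /negbTE as_; have := h a at_ => /=; rewrite as_.
apply: fin_bigcap_measurable; first exact: finite_fset.
move=> a _; apply: affine_preimage_measurable; first exact: bary_affine.
by case: ifPn => _; [exact: measurable_itv|exact: measurable_set1].
Qed.

Lemma interior_hull_pos t : Defs.nondegenerate t -> (0 < leb2 R (hull t)°)%E.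
Proof.
move=> nt; have [x xt] := interior_hull_neq0 nt.
have : nbhs x (hull t) by exact: xt.
move=> /nbhs_interior /nbhs_ballP[r r0 sub].
(* A ball of the product is a box, whose measure is a product of two lengths. *)
have sub' : ball x.1 r `*` ball x.2 r `<=` (hull t)°.
  by move=> y [y1 y2]; apply: sub; split.
have r0' : (0 : R) <= r by exact: ltW.
apply: (@lt_le_trans _ _ (leb2 R (ball x.1 r `*` ball x.2 r))).
  rewrite product_measure1E; [|exact: measurable_ball..].
  rewrite [X in (X * _)%E]lebesgue_measure_ball//.
  rewrite [X in (_ * X)%E]lebesgue_measure_ball//.
  by rewrite -EFinM lte_fin mulr_gt0// mulrn_wgt0.
apply: le_measure => //; rewrite inE; last exact: interior_hull_measurable.
by apply: measurableX; exact: measurable_ball.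
Qed.

Lemma finite_edges T : finite_set (edges T).
Proof.
apply: bigcup_finite; first exact: finite_fset.
move=> t _; apply: (sub_finite_set _ (finite_fset (fpowerset t))) => e [et _] /=.
by rewrite fpowersetE.
Qed.

Lemma domain_measurable Om T : open Om -> triangulation Om T -> pmeasurable R Om.
Proof.
move=> oOm HT; have [nd _ clE _ bE] := HT.
(* Closed triangles and edges are cut out by finitely many affine equalities and inequalities, and
   [Om] is a difference of finite unions of them. *)
have -> : Om = closure Om `\` boundary Om.
  rewrite boundaryE// setDD; apply/seteqP; split => [x Omx|x []//].
  by split=> //; exact: subset_closure.
apply: measurableD.
  rewrite clE; apply: fin_bigcup_measurable; first exact: finite_fset.
  by move=> t tT; apply: hull_face_measurable (fsubset_refl t); exact: nd.
rewrite bE; apply: fin_bigcup_measurable.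
  by apply: finite_setIl; exact: finite_edges.
by move=> e [[t tT [et _]] _]; apply: hull_face_measurable et; exact: nd.
Qed.

Lemma bounded_domain_finite Om : pmeasurable R Om -> bounded_set Om ->
  (leb2 R Om < +oo)%E.
Proof.
move=> mOm [M [_ hM]].
have M1 : M < `|M| + 1 by rewrite ltr_pwDr// ler_norm.
pose I : set R := [set` `[- (`|M| + 1), `|M| + 1] ].
have sub : Om `<=` I `*` I.
  move=> x Omx; have /= := hM _ M1 x Omx.
  rewrite prod_normE ge_max => /andP[]; rewrite !ler_norml => x1 x2.
  by split; rewrite /I/= in_itv/=.
have mI : measurable I by exact: measurable_itv.
apply: (@le_lt_trans _ _ (leb2 R (I `*` I))).
  by apply: le_measure => //; rewrite inE//; exact: measurableX.
rewrite product_measure1E//.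
have : (lebesgue_measure I < +oo)%E.
  by rewrite /I lebesgue_measure_itv/=; case: ifP => _; rewrite ?ltry// -EFinB ltry.
by move=> h; rewrite lte_mul_pinfty// ge0_fin_numE.
Qed.

End PlaneMeasure.

(** * Finite element functions *)

Lemma lincombE {R : realType} {X : Type} (a : R) (u v : X -> R) x :
  (a *: u + v) x = a * u x + v x.
Proof. by []. Qed.

Section DiscreteSpaces.
Context {R : realType}.
Variable P : fem_data R.
Hypotheses (domo : open (dom P)) (trH : triangulation (dom P) (mH P))
  (trh : triangulation (dom P) (mh P)) (refP : refinement (mh P) (mH P)).
Implicit Types (t s e tau : {fset R * R}) (x y : R * R) (u v w c : R * R -> R).

Let ndH tau : tau \in mH P -> Defs.nondegenerate tau.
Proof. exact: triangulation_nondegenerate trH. Qed.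

Let ndh t : t \in mh P -> Defs.nondegenerate t.
Proof. exact: triangulation_nondegenerate trh. Qed.

Lemma Vh_subspace : subspace_of (Vh P).
Proof.
split; first by split=> // [x|t _]; [exact: cvg_cst|exists 0, 0, 0 => x _; rewrite !mul0r !addr0].
move=> a u v [cu u0 au] [cv v0 av]; split.
- by move=> x; apply: cvgD; [apply: cvgZr; exact: cu|exact: cv].
- by move=> x nx; rewrite lincombE u0// v0//; ring.
- move=> t th; have [c0 [c1 [c2 uE]]] := au t th.
  have [d0 [d1 [d2 vE]]] := av t th.
  exists (a * c0 + d0), (a * c1 + d1), (a * c2 + d2) => x tx.
  by rewrite lincombE uE// vE//; ring.
Qed.

Lemma Vh_affine v t : Vh P v -> t \in mh P ->
  exists2 F, affine F & forall x, hull t x -> v x = F x.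
Proof.
move=> [_ _ h] /h[c0 [c1 [c2 vE]]].
by exists (fun x => c0 + c1 * x.1 + c2 * x.2) => //; exists c0, c1, c2.
Qed.

Lemma Vh_face v t s x : Vh P v -> t \in mh P -> (s `<=` t)%fset -> hull s x ->
  v x = \sum_(a <- s) bary t a x * v a.
Proof.
move=> Vv th st sx; have [F aF vF] := Vh_affine Vv th.
have nt := ndh th.
rewrite vF; last exact: hull_sub sx.
rewrite (affineE x nt aF) -(big_fset_incl _ st); last first.
  by move=> a at_ as_; have [_ ->//] := (hull_faceP x nt st).1 sx; rewrite mul0r.
apply: eq_big_seq => a as_; rewrite vF//.
by apply: hull_vertex; exact: (fsubsetP st).
Qed.

Lemma Vh_outside v x : Vh P v -> ~ dom P x -> v x = 0.
Proof. by move=> [_ + _]; apply. Qed.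

Lemma Vh_boundary v x : Vh P v -> boundary (dom P) x -> v x = 0.
Proof. by move=> Vv; rewrite boundaryE// => -[_]; exact: Vh_outside. Qed.

Lemma Vh_vertices v : Vh P v -> (forall p, vertices (mh P) p -> v p = 0) -> v = 0.
Proof.
move=> Vv v0; apply/funext => x; have [Dx|] := pselect (dom P x); last exact: Vh_outside.
have [t th tx] := triangulation_cover trh (subset_closure Dx).
rewrite (Vh_face Vv th (fsubset_refl t) tx) big_seq big1// => a at_.
by rewrite v0 ?mulr0//; exists t.
Qed.

(** Evaluations at this list of vertices form the separating family passed to [psd_represent]. *)
Lemma Vh_vertices_seq v :
  Vh P v -> (forall p, p \in flatten [seq enum_fset t | t <- mh P] -> v p = 0) -> v = 0.
Proof.
move=> Vv h; apply: Vh_vertices => // p [t th pt]; apply: h.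
by apply/flatten_mapP; exists t.
Qed.

Lemma interp_Vh c : (forall p, vertices (mh P) p -> boundary (dom P) p -> c p = 0) ->
  Vh P (interp (mh P) c).
Proof.
move=> c0; have out x : ~ dom P x -> interp (mh P) c x = 0 by exact: interp_outside c0.
split => //.
  apply: (glue_continuous domo trh) => // t th.
  have [G aG iG] := interp_affine c trh th; exists G => //.
  exact: affine_continuous.
move=> t th; have [G [c1 [c2 [c3 GE]]] iG] := interp_affine c trh th.
by exists c1, c2, c3 => x tx; rewrite iG.
Qed.

Lemma fine_in_coarse t : t \in mh P -> exists2 tau, tau \in mH P & hull t `<=` hull tau.
Proof. by move: t; case: refP. Qed.

Lemma interior_in_coarse t tau x : t \in mh P -> tau \in mH P ->
  (hull t)° x -> hull tau x -> hull t `<=` hull tau.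
Proof.
move=> th tH xt xtau; have [tau' tH' sub] := fine_in_coarse th.
have [<-//|neq] := eqVneq tau' tau.
by case: (interior_disjoint trH tH' tH neq (interiorS sub xt) xtau).
Qed.

Lemma hull_split t tau : t \in mh P -> tau \in mH P ->
  hull t `<=` hull tau \/ (forall x, hull t x -> hull tau x -> bdry tau x).
Proof.
move=> th tH; have [tau' tH' sub] := fine_in_coarse th.
have [<-|neq] := eqVneq tau' tau; [by left|right] => x tx taux.
by apply: (hull_inter_bdry trH tH tH') => //; [rewrite eq_sym|exact: sub].
Qed.

(** By [hull_split], on each fine triangle the cut function is [u] itself or 0; vanishing on
    [bdry tau] settles the triangles that only touch [tau]. *)
Lemma restrict_Vh tau u : tau \in mH P -> Vh P u -> (forall x, bdry tau x -> u x = 0) ->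
  Vh P (u \_ (hull tau)).
Proof.
move=> tH Vu u0; have [cu uo au] := Vu.
have out x : ~ dom P x -> (u \_ (hull tau)) x = 0.
  by move=> nx; rewrite patchE; case: ifP => // _; exact: uo.
have E t : t \in mh P -> (forall x, hull t x -> (u \_ (hull tau)) x = u x) \/
    (forall x, hull t x -> (u \_ (hull tau)) x = 0).
  move=> th; have [sub|h] := hull_split th tH; [left|right] => x tx.
    by rewrite patchE mem_set//; exact: sub.
  by rewrite patchE; case: ifP => //; rewrite inE => /(h x tx); exact: u0.
split=> //.
  apply: (glue_continuous domo trh) => // t th.
  by have [h|h] := E t th; [exists u|exists (fun=> 0) => // x; exact: cvg_cst].
move=> t th; have [h|h] := E t th.
  by have [c0 [c1 [c2 uE]]] := au t th; exists c0, c1, c2 => x tx; rewrite h ?uE.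
by exists 0, 0, 0 => x tx; rewrite h//; ring.
Qed.

Lemma grad_affine v t x (c0 c1 c2 : R) : t \in mh P -> (hull t)° x ->
  (forall y, hull t y -> v y = c0 + c1 * y.1 + c2 * y.2) ->
  grad P v x = \col_(i < 2) (if i == 0 then c1 else c2).
Proof.
move=> th xt vE; rewrite /grad mem_set; last by exists t.
have der (d : R * R) : 'D_d v x = c1 * d.1 + c2 * d.2.
  (* The difference quotient is constant near 0, as the points [x + h *: d] stay in the triangle. *)
  rewrite /derive; apply: cvg_lim => //; apply: cvg_near_cst.
  have hx : \forall h \near (0 : R), hull t (x + h *: d) by exact: (@cvg_line _ x d (hull t)).
  near=> h; rewrite /= vE; last by rewrite addrC; near: h; exact: nbhs_dnbhs.
  rewrite vE; last exact: interior_subset.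
  have h0 : h != 0 by near: h; exact: nbhs_dnbhs_neq.
  by rewrite /= /GRing.scale/=; field.
apply/matrixP => i j; rewrite !mxE; case: ifP => _; rewrite der/=; ring.
Unshelve. all: by end_near.
Qed.

Lemma grad_outside v x : ~ (exists2 t, t \in mh P & (hull t)° x) -> grad P v x = 0.
Proof. by move=> nx; rewrite /grad memNset// => -[t th tx]; apply: nx; exists t. Qed.

Lemma grad_linear a u v x : Vh P u -> Vh P v ->
  grad P (a *: u + v) x = a *: grad P u x + grad P v x.
Proof.
move=> [_ _ au] [_ _ av].
have [[t th tx]|nx] := pselect (exists2 t, t \in mh P & (hull t)° x); last first.
  by rewrite !grad_outside// scaler0 addr0.
have [c0 [c1 [c2 uE]]] := au t th; have [d0 [d1 [d2 vE]]] := av t th.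
rewrite (grad_affine th tx uE) (grad_affine th tx vE).
rewrite (@grad_affine _ _ _ (a * c0 + d0) (a * c1 + d1) (a * c2 + d2) th tx).
  by apply/matrixP => i j; rewrite !mxE; case: ifP.
by move=> y ty; rewrite lincombE uE// vE//; ring.
Qed.

(** Since [grad] sees only the germ at [x], cutting a function to [hull tau] keeps its gradient
    inside [tau] and gives 0 outside, even if the cut function jumps on the boundary. *)
Lemma grad_local v w x : (\forall y \near x, v y = w y) -> grad P v x = grad P w x.
Proof.
move=> vw; rewrite /grad; case: ifP => // _; apply/matrixP => i j; rewrite !mxE.
exact: near_eq_derive.
Qed.

Lemma grad0 x : grad P 0 x = 0.
Proof.
have [[t th tx]|nx] := pselect (exists2 t, t \in mh P & (hull t)° x); last first.
  by rewrite grad_outside.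
rewrite (@grad_affine _ _ _ 0 0 0 th tx); last by move=> y _; rewrite !mul0r !addr0.
by apply/matrixP => i j; rewrite !mxE; case: ifP.
Qed.

Lemma grad_restrict_in v tau x : (hull tau)° x -> grad P (v \_ (hull tau)) x = grad P v x.
Proof.
move=> xt; apply: grad_local.
by apply: filterS xt => y ty; rewrite patchE mem_set.
Qed.

Lemma grad_restrict_out v tau x : tau \in mH P -> ~ hull tau x ->
  grad P (v \_ (hull tau)) x = 0.
Proof.
move=> tH nx; rewrite -(grad0 x); apply: grad_local.
have : \forall y \near x, (~` hull tau) y.
  by apply: open_nbhs_nbhs; split => //; rewrite openC; exact/hull_closed/ndH.
by apply: filterS => y ny; rewrite patchE memNset.
Qed.

End DiscreteSpaces.

(** * The energy form *)

Notation pbounded_off R := (@bounded_off _ (plane R) R).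
Notation pintegrable R := (integrableR (leb2 R)).

(** If [v x] were not 0, the intermediate value theorem on the segment from [x] to [y0] would
    produce a whole interval of values, which is not finite. *)
Lemma finite_range_vanishes {R : realType} (v : R * R -> R) (A : set R) y0 :
  continuous v -> finite_set A -> (forall x, A (v x)) -> v y0 = 0 -> v = 0.
Proof.
move=> cv fA vA vy0; apply/funext => x; apply/eqP; apply: contraT => vx.
pose phi (s : R) := v (x + s *: (y0 - x)).
have cphi : continuous phi.
  move=> s; apply: continuous_comp; last exact: cv.
  by apply: cvgD; [exact: cvg_cst|apply: cvgZl; exact: cvg_id].
have phi0 : phi 0 = v x by rewrite /phi scale0r addr0.
have phi1 : phi 1 = 0 by rewrite /phi scale1r addrC subrK.
have iA : [set` `]Num.min (v x) 0, Num.max (v x) 0[ ] `<=` A.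
  move=> r /=; rewrite in_itv/= => /andP[r1 r2].
  have [s _ <-] : exists2 s, s \in `[0, 1] & phi s = r.
    apply: IVT => //; first by move=> s; exact: continuous_subspaceT.
    by rewrite phi0 phi1 (ltW r1) (ltW r2).
  exact: vA.
have := countable_lebesgue_measure0 (finite_set_countable (sub_finite_set iA fA)).
rewrite lebesgue_measure_itv/= lte_fin; case: ifPn => [lt_mM|].
  by rewrite -EFinB => -[] h; move: lt_mM; lra.
rewrite -leNgt => h _; exfalso; move/negP: vx; apply.
by move: h; rewrite ge_max !le_min => /andP[/andP[_ h1] /andP[h2 _]]; rewrite eq_le h1 h2.
Qed.

Section Energy.
Context {R : realType}.
Variable P : fem_data R.
Hypotheses (domo : open (dom P)) (domb : bounded_set (dom P))
  (trH : triangulation (dom P) (mH P))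
  (trh : triangulation (dom P) (mh P)) (refP : refinement (mh P) (mH P)).
Variables (N : set (R * R)) (amin : R).
Hypotheses (mN : pmeasurable R N) (N0 : leb2 R N = 0%E) (amin0 : 0 < amin)
  (hA : forall i j, pbounded_off R (dom P) N (fun x => coef P x i j))
  (symA : forall x, dom P x -> ~ N x -> (coef P x)^T = coef P x)
  (ellA : forall x b, dom P x -> ~ N x ->
     amin * dotp b b <= dotp (coef P x *m b) b).
Implicit Types (t s e tau : {fset R * R}) (x y : R * R) (u v w c : R * R -> R)
  (D : set (R * R)).

Let ndh t : t \in mh P -> Defs.nondegenerate t.
Proof. exact: triangulation_nondegenerate trh. Qed.

Lemma dom_measurable : pmeasurable R (dom P).
Proof. exact: domain_measurable trH. Qed.

Lemma dom_finite : (leb2 R (dom P) < +oo)%E.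
Proof. by apply: bounded_domain_finite => //; exact: dom_measurable. Qed.

Lemma dom_bounded_integrable D f : pmeasurable R D -> D `<=` dom P ->
  pbounded_off R (dom P) N f -> pintegrable R D f.
Proof.
move=> mD sub hf; apply: (integrableRS dom_measurable) => //.
apply: (bounded_off_integrable dom_measurable mN N0) => //; exact: dom_finite.
Qed.

Lemma interior_sub_dom T tau : triangulation (dom P) T -> tau \in T ->
  (hull tau)° `<=` dom P.
Proof. by move=> [_ _ _ + _]; exact. Qed.

Lemma interior_measurable T tau : triangulation (dom P) T -> tau \in T ->
  pmeasurable R ((hull tau)°).
Proof.
move=> HT tT; apply: interior_hull_measurable.
exact: triangulation_nondegenerate HT tT.
Qed.

Lemma Rintegral_elements T f : triangulation (dom P) T ->
  pintegrable R (dom P) f ->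
  \int[leb2 R]_(x in dom P) f x =
  \sum_(tau <- T) \int[leb2 R]_(x in (hull tau)°) f x.
Proof.
move=> HT intf; have nd := triangulation_nondegenerate HT.
(* Points missed by the open elements lie on the lines where a barycentric coordinate vanishes. *)
pose Z t := \bigcup_(a in [set` t]) (bary t a @^-1` [set 0]).
have hZ t : t \in T -> pmeasurable R (Z t) /\ leb2 R (Z t) = 0%E.
  move=> tT; apply: null_bigcup => a at_; split; last by apply: bary_line_null => //; exact: nd.
  by apply: affine_preimage_measurable; [exact/bary_affine/nd|exact: measurable_set1].
have [mZ Z0] := null_bigcup hZ.
apply: (Rintegral_bigsetU dom_measurable mZ Z0) => //.
- by move=> t; exact: interior_measurable.
- by move=> t; exact: interior_sub_dom.
- move=> t t' x tT tT' xt xt'; apply/eqP; apply: contraT => neq.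
  by case: (interior_disjoint HT tT tT' neq xt (interior_subset xt')).
- move=> x Dx nZ; have [t tT tx] := triangulation_cover HT (subset_closure Dx).
  exists t => //; apply/(interior_hullP _ (nd _ tT)) => a at_.
  rewrite lt_neqAle; apply/andP; split; last by move/(hullP _ (nd _ tT)) : tx; exact.
  by apply/eqP => b0; apply: nZ; exists t => //; exists a.
Qed.

Lemma Vh_bounded v : Vh P v -> pbounded_off R (dom P) N v.
Proof.
move=> Vv; have [_ _ clE _ _] := trh; split.
  have -> : dom P = closure (dom P) `&` dom P.
    by apply/esym/setIidr; exact: subset_closure.
  have mU (l : seq {fset R * R}) : {subset l <= mh P} ->
      pmeasurable R (\bigcup_(t in [set` l]) hull t) /\
      pmeasurable_fun R (\bigcup_(t in [set` l]) hull t) v.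
    elim: l => [_|t l IH ls].
      by rewrite set_nil bigcup_set0; split; [exact: measurable0|exact: measurable_fun_set0].
    have [ml mfl] : pmeasurable R (\bigcup_(t in [set` l]) hull t) /\
      pmeasurable_fun R (\bigcup_(t in [set` l]) hull t) v.
      by apply: IH => t' tl; apply: ls; rewrite inE tl orbT.
    have th : t \in mh P by apply: ls; rewrite inE eqxx.
    have mt : pmeasurable R (hull t) by exact: hull_face_measurable (ndh th) (fsubset_refl t).
    rewrite bigcup_cons; split; first exact: measurableU.
    apply/measurable_funU => //; split => //.
    have [F aF vF] := Vh_affine Vv th.
    apply: (eq_measurable_fun F); last exact: affine_measurable.
    by move=> x; rewrite inE => /vF.
  have [mc mf] := mU (mh P) (fun=> id).
  by apply: measurable_funS mf => //; rewrite -clE; exact: subIsetl.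
exists (\sum_(t <- mh P) \sum_(a <- t) `|v a|) => x Dx _.
have [t th tx] := triangulation_cover trh (subset_closure Dx).
rewrite (Vh_face trh Vv th (fsubset_refl t) tx).
apply: le_trans (ler_norm_sum _ _ _) _.
rewrite (bigD1_seq t) ?fset_uniq//=; apply: ler_wpDr.
  by apply: sumr_ge0 => *; apply: sumr_ge0.
rewrite big_seq [leRHS]big_seq; apply: ler_sum => a at_.
rewrite normrM ler_piMl//.
have h0 b : b \in t -> 0 <= bary t b x by move/(hullP _ (ndh th)) : tx; exact.
rewrite ger0_norm ?h0// -(sum_bary x (ndh th)) (bigD1_seq a) ?fset_uniq//=.
by rewrite lerDl big_seq_cond sumr_ge0// => b /andP[bt _]; exact: h0.
Qed.

Lemma grad_constant v t x y : Vh P v -> t \in mh P ->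
  (hull t)° x -> (hull t)° y -> grad P v x = grad P v y.
Proof.
move=> [_ _ h] th tx ty; have [c0 [c1 [c2 vE]]] := h t th.
by rewrite (grad_affine th tx vE) (grad_affine th ty vE).
Qed.

Definition inner_point t : R * R := xget 0 ((hull t)°).

Lemma grad_bounded v i : Vh P v -> pbounded_off R (dom P) N (fun x => grad P v x i ord0).
Proof.
(* The gradient is constant on each open fine triangle and 0 elsewhere, hence a finite combination
   of indicators. *)
move=> Vv; have -> : (fun x => grad P v x i ord0) =
    (fun x => \sum_(t <- mh P) \1_((hull t)°) x * grad P v (inner_point t) i ord0).
  apply/funext => x.
  have [[t th tx]|nx] := pselect (exists2 t, t \in mh P & (hull t)° x); last first.
    rewrite grad_outside// mxE big_seq big1// => t th.
    rewrite indicE memNset ?mul0r// => tx; apply: nx; exists t => //.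
  rewrite (bigD1_seq t) ?fset_uniq//= big_seq_cond big1 ?addr0; last first.
    move=> t' /andP[th' neq]; rewrite indicE memNset ?mul0r// => tx'.
    by case: (interior_disjoint trh th' th neq tx' (interior_subset tx)).
  rewrite indicE mem_set// mul1r (@grad_constant v t x (inner_point t) Vv th tx)//.
  by apply: xgetPex; exists x.
apply: bounded_off_sum => t th; apply: bounded_offM; last exact: bounded_off_cst.
split; first by apply: measurable_indic; exact: interior_measurable trh th.
by exists 1 => x _ _; rewrite indicE; case: (_ \in _); rewrite ?normr0 ?normr1.
Qed.

Lemma dotpE (a b : 'cV[R]_2) : dotp a b = \sum_i a i ord0 * b i ord0.
Proof. by rewrite /dotp mxE; apply: eq_bigr => i _; rewrite mxE. Qed.

Definition density v w x := dotp (coef P x *m grad P v x) (grad P w x).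

Lemma density_bounded v w : Vh P v -> Vh P w -> pbounded_off R (dom P) N (density v w).
Proof.
move=> Vv Vw.
have -> : density v w = (fun x => \sum_(i <- index_enum 'I_2)
   (\sum_(j <- index_enum 'I_2) coef P x i j * grad P v x j ord0) * grad P w x i ord0).
  by apply/funext => x; rewrite /density dotpE; apply: eq_bigr => i _; rewrite mxE.
apply: bounded_off_sum => i _; apply: bounded_offM; last exact: grad_bounded.
by apply: bounded_off_sum => j _; apply: bounded_offM => //; exact: grad_bounded.
Qed.

Lemma density_integrable D v w : pmeasurable R D -> D `<=` dom P -> Vh P v -> Vh P w ->
  pintegrable R D (density v w).
Proof. by move=> mD sub Vv Vw; apply: dom_bounded_integrable => //; exact: density_bounded. Qed.

Lemma dotp_sym (a b : 'cV[R]_2) : dotp a b = dotp b a.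
Proof. by rewrite !dotpE; apply: eq_bigr => i _; rewrite mulrC. Qed.

Lemma dotp_ge0 (b : 'cV[R]_2) : 0 <= dotp b b.
Proof. by rewrite dotpE; apply: sumr_ge0 => i _; rewrite -expr2 sqr_ge0. Qed.

Lemma dotp_eq0 (b : 'cV[R]_2) : dotp b b = 0 -> b = 0.
Proof.
rewrite dotpE => /eqP; rewrite psumr_eq0; last by move=> i _; rewrite -expr2 sqr_ge0.
move=> /allP h; apply/matrixP => i j; rewrite mxE ord1.
by have := h i (mem_index_enum i); rewrite /= -expr2 sqrf_eq0 => /eqP.
Qed.

Lemma density_ge0 v x : dom P x -> ~ N x -> 0 <= density v v x.
Proof.
move=> Dx Nx; apply: le_trans (ellA _ Dx Nx).
by apply: mulr_ge0; [exact: ltW|exact: dotp_ge0].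
Qed.

Lemma energy_psd D : pmeasurable R D -> D `<=` dom P -> psd_on (Vh P) (energy P D).
Proof.
move=> mD sub; have di u v Vu Vv := @density_integrable D u v mD sub Vu Vv.
have sV := Vh_subspace P; have [_ cV] := sV.
split.
- move=> z Vz a u v Vu Vv; rewrite /energy -Rintegral_lin//; [|exact: di..].
  apply: eq_Rintegral => x _.
  rewrite grad_linear// mulmxDr -scalemxAr !dotpE mulr_sumr -big_split/=.
  by apply: eq_bigr => i _; rewrite !mxE; ring.
- move=> u v Vu Vv; rewrite /energy.
  apply: (@eq_Rintegral_off _ (plane R) R (leb2 R) D N _ _ mD mN N0 (di _ _ Vu Vv) (di _ _ Vv Vu)).
  move=> x /sub Dx Nx; by rewrite /density [RHS]dotp_sym /dotp trmx_mul symA// mulmxA.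
- move=> u Vu; have -> : (0 : R) = \int[leb2 R]_(x in D) (fun=> 0) x.
    by rewrite /Rintegral integral0.
  apply: (@le_Rintegral_off _ (plane R) R (leb2 R) D N _ _ mD mN N0 _ (di _ _ Vu Vu)).
    by apply: dom_bounded_integrable => //; exact: bounded_off_cst.
  by move=> x /sub Dx Nx; exact: density_ge0.
Qed.

Lemma aform_psd : psd_on (Vh P) (aform P).
Proof. by apply: energy_psd => //; exact: dom_measurable. Qed.

Lemma energy_elements T v w : triangulation (dom P) T -> Vh P v -> Vh P w ->
  aform P v w = \sum_(tau <- T) energy P ((hull tau)°) v w.
Proof.
move=> HT Vv Vw; apply: Rintegral_elements => //.
by apply: density_integrable => //; exact: dom_measurable.
Qed.

Lemma exists_outside : exists y, ~ dom P y.
Proof.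
have [M [_ hM]] := domb; exists ((`|M| + 2) : R, 0 : R) => Dy.
have M1 : M < `|M| + 1 by rewrite ltr_pwDr// ler_norm.
have /= := hM _ M1 _ Dy; rewrite prod_normE/= ge_max => /andP[+ _].
by rewrite ger0_norm ?addr_ge0// lerD2l => h; lra.
Qed.

(** Zero energy forces a zero gradient on every fine triangle, by ellipticity and the positive
    measure of the triangle. Then [v] is constant on each of them, and it vanishes outside the
    bounded domain, so [finite_range_vanishes] applies. *)
Lemma aform_definite v : Vh P v -> aform P v v = 0 -> v = 0.
Proof.
move=> Vv av0; have [cv v0 aff] := Vv.
have en0 t : t \in mh P -> 0 <= energy P (hull t)° v v.
  move=> th; have [_ _] := energy_psd (interior_measurable trh th) (interior_sub_dom trh th).
  exact.
have et0 t : t \in mh P -> energy P (hull t)° v v = 0.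
  move=> th; move/eqP : av0; rewrite (energy_elements trh)// big_seq psumr_eq0//.
  by move=> /allP/(_ t th); rewrite th => /eqP.
have g0 t x : t \in mh P -> (hull t)° x -> grad P v x = 0.
  move=> th tx; apply: dotp_eq0; apply/eqP; rewrite eq_le dotp_ge0 andbT leNgt.
  apply/negP => pos; have mt := interior_measurable trh th.
  have st := interior_sub_dom trh th.
  have : \int[leb2 R]_(x' in (hull t)°) (amin * dotp (grad P v x) (grad P v x))
      <= energy P (hull t)° v v.
    apply: (@le_Rintegral_off _ (plane R) R (leb2 R) _ N) => //.
    - by apply: dom_bounded_integrable => //; exact: bounded_off_cst.
    - exact: density_integrable.
    - move=> x' tx' Nx'; rewrite (grad_constant Vv th tx tx').
      by apply: ellA => //; exact: st.
  rewrite et0// Rintegral_cst// leNgt => /negP; apply.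
  have mu_fin : (leb2 R (hull t)° < +oo)%E.
    apply: le_lt_trans dom_finite; apply: le_measure; rewrite ?inE//.
    exact: dom_measurable.
  have mu_pos : 0 < fine (leb2 R (hull t)°) 
    by apply: fine_gt0; rewrite mu_fin andbT; apply: interior_hull_pos; exact: ndh.
  by rewrite !mulr_gt0.
have vz t x : t \in mh P -> hull t x -> v x = v (inner_point t).
  move=> th tx; have [c0 [c1 [c2 vE]]] := aff t th.
  have zt : (hull t)° (inner_point t) by apply: xgetPex; exact/interior_hull_neq0/ndh.
  have /matrixP gz := g0 _ _ th zt; rewrite (grad_affine th zt vE) in gz.
  have := gz ord0 ord0; have := gz ord_max ord0; rewrite !mxE/= => c20 c10.
  by rewrite !vE ?c10 ?c20; [ring|exact: interior_subset|].
have [y0 Dy0] := exists_outside.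
pose values := [set v (inner_point t) | t in [set` mh P]] `|` [set 0].
apply: (@finite_range_vanishes _ v values y0) => //.
- rewrite finite_setU; split; last exact: finite_set1.
  by apply: finite_image; exact: finite_fset.
- move=> x; have [Dx|/v0 ->] := pselect (dom P x); last by right.
  have [t th tx] := triangulation_cover trh (subset_closure Dx).
  by left; exists t => //; rewrite (vz t x).
- exact: v0.
Qed.

End Energy.

(** * The weighted mass form *)

Section Mass.
Context {R : realType}.
Variable P : fem_data R.
Hypotheses (domo : open (dom P)) (domb : bounded_set (dom P))
  (trH : triangulation (dom P) (mH P)) (trh : triangulation (dom P) (mh P)).
Variables (N : set (R * R)) (rhomin : R).
Hypotheses (mN : pmeasurable R N) (N0 : leb2 R N = 0%E) (rhomin0 : 0 < rhomin)
  (hrho : pbounded_off R (dom P) N (dens P))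
  (rho_ge : forall x, dom P x -> ~ N x -> rhomin <= dens P x).
Implicit Types (t s e tau : {fset R * R}) (x y : R * R) (f g u v w : R * R -> R)
  (D : set (R * R)).

Let dom_m : pmeasurable R (dom P) := dom_measurable domo trH.

Let integ D f : pmeasurable R D -> D `<=` dom P ->
  pbounded_off R (dom P) N f -> pintegrable R D f.
Proof. exact: dom_bounded_integrable. Qed.

Definition mass D v w : R := \int[leb2 R]_(x in D) (dens P x * v x * w x).

Let mass_bounded v w : Vh P v -> Vh P w ->
  pbounded_off R (dom P) N (fun x => dens P x * v x * w x).
Proof.
move=> Vv Vw; apply: bounded_offM; last exact: Vh_bounded Vw.
by apply: bounded_offM => //; exact: Vh_bounded Vv.
Qed.

Lemma mass_psd D : pmeasurable R D -> D `<=` dom P -> psd_on (Vh P) (mass D).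
Proof.
move=> mD sub; have di v w Vv Vw := integ mD sub (@mass_bounded v w Vv Vw).
split.
- move=> z Vz a u v Vu Vv; rewrite /mass -Rintegral_lin//; [|exact: di..].
  by apply: eq_Rintegral => x _; rewrite lincombE; ring.
- by move=> u v Vu Vv; apply: eq_Rintegral => x _; ring.
- move=> u Vu; have -> : (0 : R) = \int[leb2 R]_(x in D) (fun=> 0) x.
    by rewrite /Rintegral integral0.
  apply: (@le_Rintegral_off _ (plane R) R (leb2 R) D N _ _ mD mN N0 _ (di _ _ Vu Vu)).
    by apply: integ => //; exact: bounded_off_cst.
  move=> x /sub Dx Nx; rewrite -mulrA mulr_ge0 -?expr2 ?sqr_ge0//.
  by apply: le_trans (rho_ge Dx Nx); exact: ltW.
Qed.

Lemma mass_elements v : Vh P v ->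
  mass (dom P) v v = \sum_(tau <- mH P) mass (hull tau)° v v.
Proof.
move=> Vv; apply: (Rintegral_elements domo trH trH).
by apply: integ => //; exact: mass_bounded.
Qed.

Lemma mass_three tau v (F : R * R -> R * R -> R) : tau \in mH P -> Vh P v ->
  (forall a, a \in tau -> Vh P (F a)) ->
  (forall x, hull tau x -> v x = \sum_(a <- tau) F a x) ->
  mass (hull tau)° v v <= 3 * \sum_(a <- tau) mass (hull tau)° (F a) (F a).
Proof.
move=> tH Vv VF vE.
have [p [q [r [_ tE tp _]]]] := nondegenerate_perm (triangulation_nondegenerate trH tH).
have [pt qt rt] : [/\ p \in tau, q \in tau & r \in tau].
  by rewrite tE !inE !eqxx !orbT.
have mt := interior_measurable trH tH; have st := interior_sub_dom trH tH.
have di u w Vu Vw := integ mt st (@mass_bounded u w Vu Vw).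
rewrite (perm_big _ tp)/= !big_cons big_nil addr0 /mass.
have dF a : a \in tau -> pintegrable R (hull tau)° (fun x => dens P x * F a x * F a x).
  by move=> /VF VFa; exact: di.
have i2 := integrableRD mt (dF _ qt) (dF _ rt).
have i3 := integrableRD mt (dF _ pt) i2.
rewrite -(RintegralD mt (dF _ qt) (dF _ rt)) -(RintegralD mt (dF _ pt) i2).
rewrite -(RintegralZl 3 mt i3).
apply: (@le_Rintegral_off _ (plane R) R (leb2 R) _ N _ _ mt mN N0 (di _ _ Vv Vv)).
  exact: integrableRZ.
move=> x tx Nx; rewrite vE; last exact: interior_subset.
rewrite (perm_big _ tp)/= !big_cons big_nil addr0.
have d0 : 0 <= dens P x by apply: le_trans (rho_ge (st _ tx) Nx); exact: ltW.
set a := F p x; set b := F q x; set c := F r x.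
have -> : 3 * (dens P x * a * a + (dens P x * b * b + dens P x * c * c)) =
   dens P x * (a + (b + c)) * (a + (b + c)) +
   dens P x * ((a - b) ^+ 2 + (a - c) ^+ 2 + (b - c) ^+ 2) by ring.
by rewrite lerDl mulr_ge0// !addr_ge0// sqr_ge0.
Qed.

Variables (f g : R * R -> R).
Hypotheses (fL2 : pintegrable R (dom P) (fun x => f x ^+ 2))
  (mg : pmeasurable_fun R (dom P) g)
  (fE : forall x, dom P x -> ~ N x -> f x = dens P x * g x).

Let mrho : pmeasurable_fun R (dom P) (dens P) := hrho.1.

(** Square integrability is given for [f]; off [N] it transfers through
    [rho g^2 = f^2 / rho <= f^2 / rhomin]. *)
Let weighted_integrable : pintegrable R (dom P) (fun x => dens P x * g x ^+ 2).
Proof.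
have i2 : pintegrable R (dom P) (fun x => rhomin^-1 * f x ^+ 2) by exact: integrableRZ.
apply: (@le_integrableR _ (plane R) R (leb2 R) _ N _ _ dom_m mN N0 _ i2).
  by apply: measurable_funM => //; exact: measurable_funX.
move=> x Dx Nx; have h := rho_ge Dx Nx; have d0 : 0 < dens P x by exact: lt_le_trans h.
rewrite ger0_norm; last by rewrite mulr_ge0 ?sqr_ge0// ltW.
rewrite fE// exprMn.
have -> : rhomin^-1 * (dens P x ^+ 2 * g x ^+ 2) =
    (dens P x / rhomin) * (dens P x * g x ^+ 2).
  by ring.
apply: ler_peMl; last by rewrite ler_pdivlMr// mul1r.
by apply: mulr_ge0; [exact: ltW|exact: sqr_ge0].
Qed.

(** Off [N] the integrand is [f v], dominated by [f^2 + v^2]. *)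
Let load_integrable v : Vh P v ->
  pintegrable R (dom P) (fun x => dens P x * g x * v x).
Proof.
move=> Vv; have bv : pbounded_off R (dom P) N v by exact: Vh_bounded Vv.
have iv : pintegrable R (dom P) (fun x => v x * v x).
  by apply: integ => //; exact: bounded_offM.
have i2 : pintegrable R (dom P) (fun x => f x ^+ 2 + v x * v x) by exact: integrableRD.
apply: (@le_integrableR _ (plane R) R (leb2 R) _ N _ _ dom_m mN N0 _ i2).
  by apply: measurable_funM; [exact: measurable_funM|exact: bv.1].
move=> x Dx Nx; rewrite -fE// ler_norml; apply/andP; split; nra.
Qed.

Lemma L2rho_sqr : L2rho P g ^+ 2 = \int[leb2 R]_(x in dom P) (dens P x * g x ^+ 2).
Proof.
have E x : dom P x -> ~ N x -> (Num.sqrt (dens P x) * g x) ^+ 2 = dens P x * g x ^+ 2.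
  move=> Dx Nx; rewrite exprMn sqr_sqrtr//.
  by apply: le_trans (rho_ge Dx Nx); exact: ltW.
rewrite /L2rho sqr_sqrtr; last by apply: Rintegral_ge0 => x _; exact: sqr_ge0.
apply: (@eq_Rintegral_off _ (plane R) R (leb2 R) _ N) => //.
apply: (@le_integrableR _ (plane R) R (leb2 R) _ N _ _ dom_m mN N0 _ weighted_integrable).
  apply: measurable_funX; apply: measurable_funM => //.
  have ms : measurable_fun [set: R] (fun y : R => Num.sqrt y).
    by apply: continuous_measurable_fun; exact: sqrt_continuous.
  exact: (measurableT_comp ms mrho).
by move=> x Dx Nx; rewrite E// ger0_norm// -E// sqr_ge0.
Qed.

(* Expand [0 <= \int rho (k g - v)^2]. *)
Lemma load_bound v (k : R) : Vh P v ->
  2 * k * load P g v <= k ^+ 2 * L2rho P g ^+ 2 + mass (dom P) v v.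
Proof.
move=> Vv; rewrite L2rho_sqr /load /mass.
have im : pintegrable R (dom P) (fun x => dens P x * v x * v x).
  by apply: integ => //; exact: mass_bounded.
rewrite -Rintegral_lin// -RintegralZl//; last exact: load_integrable.
apply: (@le_Rintegral_off _ (plane R) R (leb2 R) _ N) => //.
- by apply: integrableRZ => //; exact: load_integrable.
- by apply: integrableRD => //; exact: integrableRZ.
- move=> x Dx Nx; rewrite -subr_ge0.
  have -> : k ^+ 2 * (dens P x * g x ^+ 2) + dens P x * v x * v x -
    2 * k * (dens P x * g x * v x) = dens P x * (k * g x - v x) ^+ 2 by ring.
  by rewrite mulr_ge0 ?sqr_ge0//; apply: le_trans (rho_ge Dx Nx); exact: ltW.
Qed.

End Mass.

(** * Harmonic extension, edge traces and the multiscale space *)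

Lemma patch_in {R : realType} {X : Type} (D : set X) (u : X -> R) x :
  D x -> (u \_ D) x = u x.
Proof. by move=> Dx; rewrite patchE mem_set. Qed.

Lemma patch_out {R : realType} {X : Type} (D : set X) (u : X -> R) x :
  ~ D x -> (u \_ D) x = 0.
Proof. by move=> Dx; rewrite patchE memNset. Qed.

Lemma patch_lin {R : realType} {X : Type} (D : set X) (a : R) (u v : X -> R) :
  (a *: u + v) \_ D = a *: (u \_ D) + v \_ D.
Proof.
apply/funext => x; have [Dx|Dx] := pselect (D x); rewrite lincombE.
  by rewrite !patch_in.
by rewrite !patch_out// mulr0 addr0.
Qed.

Lemma patchB {R : realType} {X : Type} (D : set X) (u v : X -> R) :
  (u - v) \_ D = u \_ D - v \_ D.
Proof.
by rewrite addrC -scaleN1r patch_lin scaleN1r addrC.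
Qed.

Section Harmonic.
Context {R : realType}.
Variable P : fem_data R.
Hypotheses (domo : open (dom P)) (trH : triangulation (dom P) (mH P))
  (trh : triangulation (dom P) (mh P)) (refP : refinement (mh P) (mH P))
  (aform_psd : psd_on (Vh P) (aform P))
  (aform_definite : forall v, Vh P v -> aform P v v = 0 -> v = 0)
  (energy_psd : forall tau, tau \in mH P -> psd_on (Vh P) (energy P (hull tau)°))
  (energy_elements : forall v w, Vh P v -> Vh P w ->
     aform P v w = \sum_(tau <- mH P) energy P ((hull tau)°) v w).
Implicit Types (t s e tau : {fset R * R}) (x y : R * R)
  (u v w mu nu : R * R -> R) (D : set (R * R)).

Local Notation skel := (skeleton (mH P)).
Local Notation T := (Tharm P).

Let ndH tau : tau \in mH P -> Defs.nondegenerate tau.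
Proof. exact: triangulation_nondegenerate trH. Qed.

Let sVh : subspace_of (Vh P) := Vh_subspace P.

Lemma VhB_sub : VhB P `<=` Vh P. Proof. by move=> v []. Qed.

Lemma VhB_subspace : subspace_of (VhB P).
Proof.
have [V0 cV] := sVh; split; first by split.
move=> a u v [Vu u0] [Vv v0]; split; first exact: cV.
by move=> tau tH x tx; rewrite lincombE (u0 tau)// (v0 tau)// mulr0 addr0.
Qed.

Lemma VhB_trace v : Vh P v -> VhB P v <-> v \_ skel = 0.
Proof.
move=> Vv; split=> [[_ v0]|v0].
  apply/funext => x; have [[tau tH tx]|nx] := pselect (skel x); last exact: patch_out.
  by rewrite patch_in; [exact: v0 tx|exists tau].
split=> // tau tH x tx; have : skel x by exists tau.
by move=> sx; rewrite -(patch_in v sx) v0.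
Qed.

Lemma VhH_subspace : subspace_of (VhH P).
Proof.
have [V0 cV] := sVh; have [al _ _] := aform_psd; split.
  split=> // z /VhB_sub Vz; exact: linear_on0 sVh (al z Vz).
move=> a u v [Vu u0] [Vv v0]; split; first exact: cV.
by move=> z Bz; rewrite al ?u0 ?v0 ?mulr0 ?addr0//; exact: VhB_sub.
Qed.

Lemma VhH_VhB v : VhH P v -> VhB P v -> v = 0.
Proof. by move=> [Vv vH] vB; apply: aform_definite => //; exact: vH. Qed.

(** [w] is the energy projection of [u] onto the bubbles [VhB]. Consequently every finite element
    function has the trace of a harmonic one. *)
Lemma harmonic_split u : Vh P u -> exists2 w, VhB P w & VhH P (u - w).
Proof.
move=> Vu; have [al _ _] := aform_psd.
have [w Bw hw] : exists2 w, VhB P w & forall z, VhB P z -> aform P w z = aform P u z.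
  apply: (psd_represent (L := flatten [seq enum_fset t | t <- mh P])
           (phi := fun p v => v p) VhB_subspace).
  - by move=> p _ a z z'.
  - exact: psd_sub VhB_sub aform_psd.
  - by move=> a z z' /VhB_sub Vz /VhB_sub Vz'; exact: (psd_linr aform_psd Vu sVh).
  - by move=> z /VhB_sub Vz; exact: (psd_null sVh aform_psd Vu Vz).
  - move=> z /VhB_sub Vz /(Vh_vertices_seq trh Vz) ->.
    exact: (linear_on0 sVh (al 0 sVh.1)).
exists w => //; split; first by apply: (subspaceB sVh) => //; exact: VhB_sub.
move=> z Bz; rewrite (linear_onB sVh (al z (VhB_sub Bz)))//; last exact: VhB_sub.
by rewrite hw// subrr.
Qed.

Lemma Lam_trace u : Vh P u -> Lam P (u \_ skel).
Proof.
move=> Vu; have [w Bw Hw] := harmonic_split Vu; exists (u - w) => //.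
by rewrite patchB (VhB_trace (VhB_sub Bw)).1// subr0.
Qed.

Lemma TharmP mu : Lam P mu -> VhH P (T mu) /\ (T mu) \_ skel = mu.
Proof.
move=> [v [Vv vH] vmu].
have : [set v | [/\ Vh P v, v \_ skel = mu &
    forall w, VhB P w -> aform P v w = 0] ] (T mu).
  by apply: (xgetPex (0 : R * R -> R)); exists v.
by case.
Qed.

Lemma Tharm_unique v : VhH P v -> T (v \_ skel) = v.
Proof.
move=> Hv; have [Vv _] := Hv; have [HT tT] := TharmP (Lam_trace Vv).
have [VT _] := HT.
apply/eqP; rewrite -subr_eq0; apply/eqP; apply: VhH_VhB.
  exact: subspaceB VhH_subspace HT Hv.
apply/VhB_trace; first exact: subspaceB sVh VT Vv.
by rewrite patchB tT subrr.
Qed.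

Lemma Tharm_Vh mu : Lam P mu -> Vh P (T mu).
Proof. by move=> /TharmP[[]]. Qed.

Lemma Tharm_trace mu : Lam P mu -> (T mu) \_ skel = mu.
Proof. by move=> /TharmP[]. Qed.

Lemma Tharm_orth mu w : Lam P mu -> VhB P w -> aform P (T mu) w = 0.
Proof. by move=> /TharmP[[_ +] _]; apply. Qed.

Lemma Lam_subspace : subspace_of (Lam P).
Proof.
have [H0 cH] := VhH_subspace; split.
  by exists 0 => //; apply/funext => x; rewrite patchE; case: ifP.
move=> a _ _ [u Hu <-] [v Hv <-]; exists (a *: u + v); first exact: cH.
by rewrite patch_lin.
Qed.

Lemma Tharm_linear a mu nu : Lam P mu -> Lam P nu ->
  T (a *: mu + nu) = a *: T mu + T nu.
Proof.
move=> /TharmP[Hm tm] /TharmP[Hn tn]; have [_ cH] := VhH_subspace.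
have -> : a *: mu + nu = (a *: T mu + T nu) \_ skel by rewrite patch_lin tm tn.
by apply: Tharm_unique; exact: cH.
Qed.

Lemma Lam_outside mu x : Lam P mu -> ~ skel x -> mu x = 0.
Proof. by move=> [v _ <-]; exact: patch_out. Qed.

Lemma Tharm_eval p : linear_on (Lam P) (fun mu => T mu p).
Proof. by move=> a u v Lu Lv; rewrite Tharm_linear. Qed.

Lemma Tharm_vertices mu : Lam P mu ->
  (forall p, p \in flatten [seq enum_fset t | t <- mh P] -> T mu p = 0) -> T mu = 0.
Proof. by move=> Lm; apply: Vh_vertices_seq => //; exact: Tharm_Vh. Qed.

Lemma Tharm_psd B : psd_on (Vh P) B -> psd_on (Lam P) (fun mu nu => B (T mu) (T nu)).
Proof.
move=> [hl hs hp]; split.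
- move=> z /Tharm_Vh Vz a u v Lu Lv; rewrite Tharm_linear//.
  by apply: hl => //; exact: Tharm_Vh.
- by move=> u v /Tharm_Vh Vu /Tharm_Vh Vv; exact: hs.
- by move=> u /Tharm_Vh; exact: hp.
Qed.

Lemma s_el_psd tau : tau \in mH P -> psd_on (Lam P) (s_el P tau).
Proof. by move=> tH; exact: Tharm_psd (energy_psd tH). Qed.

Lemma sformE mu nu : Lam P mu -> Lam P nu -> sform P mu nu = aform P (T mu) (T nu).
Proof. by move=> /Tharm_Vh Vm /Tharm_Vh Vn; rewrite energy_elements. Qed.

Lemma sform_psd : psd_on (Lam P) (sform P).
Proof.
have [hl hs hp] := Tharm_psd aform_psd; have [_ cL] := Lam_subspace; split.
- move=> z Lz a u v Lu Lv; rewrite (sformE Lu Lz) (sformE Lv Lz) sformE; [|exact: cL|by []].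
  exact: (hl z Lz a u v Lu Lv).
- by move=> u v Lu Lv; rewrite (sformE Lu Lv) (sformE Lv Lu); exact: (hs u v Lu Lv).
- by move=> u Lu; rewrite (sformE Lu Lu); exact: (hp u Lu).
Qed.

Lemma sform_definite mu : Lam P mu -> sform P mu mu = 0 -> mu = 0.
Proof.
move=> Lm; rewrite sformE// => /(aform_definite (Tharm_Vh Lm)) T0.
rewrite -(Tharm_trace Lm) T0; apply/funext => x.
by rewrite patchE; case: ifP.
Qed.

(** * Locality: the global harmonic extension against the elementwise one *)

Lemma bdry_skel tau x : tau \in mH P -> bdry tau x -> skel x.
Proof. by move=> tH tx; exists tau. Qed.

Lemma eq_energy D v v' w w' :
  (forall x, D x -> grad P v x = grad P v' x) ->
  (forall x, D x -> grad P w x = grad P w' x) ->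
  energy P D v w = energy P D v' w'.
Proof.
by move=> hv hw; apply: eq_Rintegral => x; rewrite inE => Dx; rewrite hv ?hw.
Qed.

Lemma energy_grad0 D v w : (forall x, D x -> grad P w x = 0) -> energy P D v w = 0.
Proof.
move=> w0; transitivity (\int[leb2 R]_(x in D) (fun=> 0 : R) x).
  by apply: eq_Rintegral => x; rewrite inE => Dx; rewrite w0// /dotp mulmx0 mxE.
by rewrite /Rintegral integral0.
Qed.

Lemma restrict_VhB tau u : tau \in mH P -> Vh P u -> (forall x, bdry tau x -> u x = 0) ->
  VhB P (u \_ (hull tau)).
Proof.
move=> tH Vu u0; split; first exact: restrict_Vh.
move=> tau' tH' x tx'; have [taux|nx] := pselect (hull tau x); last exact: patch_out.
rewrite patch_in// u0//; have [->//|neq] := eqVneq tau tau'.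
by apply: (hull_inter_bdry trH tH tH') => //; apply: bdryP tx'; exact: ndH.
Qed.

Lemma aform_restrict tau u w : tau \in mH P -> Vh P u -> Vh P w ->
  (forall x, bdry tau x -> w x = 0) ->
  aform P u (w \_ (hull tau)) = energy P (hull tau)° u w.
Proof.
move=> tH Vu Vw w0; have Vw' := restrict_Vh domo trH trh refP tH Vw w0.
rewrite energy_elements// (bigD1_seq tau) ?fset_uniq//= big_seq_cond big1 ?addr0.
  by apply: eq_energy => // x tx; exact: grad_restrict_in.
move=> tau' /andP[tH' neq]; apply: energy_grad0 => x tx.
apply: (grad_restrict_out trH _ tH) => xt.
exact: (interior_disjoint trH tH' tH neq tx xt).
Qed.

(** A bubble cut to [tau] is a test function of the global problem, so the restriction of [T mu]
    solves the local one. For uniqueness, the difference of two local solutions is a bubble of zero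
    global energy. *)
Lemma Tel_trace tau mu : tau \in mH P -> Lam P mu ->
  Tel P tau (mu \_ (bdry tau)) = (T mu) \_ (hull tau).
Proof.
move=> tH Lm; have VT := Tharm_Vh Lm; have nt := ndH tH.
have TB x : bdry tau x -> T mu x = mu x.
  by move=> bx; rewrite -[in RHS](Tharm_trace Lm) patch_in//; exact: bdry_skel bx.
have eT w : VhB P w -> energy P (hull tau)° (T mu) w = 0.
  move=> [Vw w0]; rewrite -(aform_restrict tH)//; last exact: w0.
  apply: Tharm_orth => //; apply: restrict_VhB => //; exact: w0.
apply: xget_unique.
  split; first by exists (T mu).
    apply/funext => x; have [bx|nx] := pselect (bdry tau x); last by rewrite !patch_out.
    by rewrite !patch_in ?TB//; exact: bdryP.
  by move=> w Bw; rewrite -(eT w Bw); apply: eq_energy => // x; exact: grad_restrict_in.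
move=> _ [[u Vu ->] ub eu].
have Vd : Vh P (u - T mu) by exact: subspaceB.
have d0 x : bdry tau x -> (u - T mu) x = 0.
  move=> bx; have /(congr1 (fun h => h x)) := ub.
  rewrite (patch_in _ bx) (patch_in _ (bdryP nt bx)) (patch_in _ bx) => ux.
  have -> : (u - T mu) x = u x - T mu x by [].
  by rewrite ux TB// subrr.
have Bz := restrict_VhB tH Vd d0.
have [Vz _] := Bz.
have z0 : (u - T mu) \_ (hull tau) = 0.
  apply: aform_definite => //; rewrite aform_restrict//.
  have [hl hs _] := energy_psd tH.
  rewrite hs// (linear_onB sVh (hl _ Vz))// eT// subr0 -(eu _ Bz).
  by apply: eq_energy => // x xt; rewrite grad_restrict_in.
by move: z0; rewrite patchB => /eqP; rewrite subr_eq0 => /eqP.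
Qed.

Lemma Sop_trace tau mu nu : tau \in mH P -> Lam P mu -> Lam P nu ->
  Sop P tau (mu \_ (bdry tau)) (nu \_ (bdry tau)) = s_el P tau mu nu.
Proof.
move=> tH Lm Ln; rewrite /Sop (Tel_trace tH Lm) (Tel_trace tH Ln).
by apply: eq_energy => x; exact: grad_restrict_in.
Qed.

(** * Traces on single edges and the splitting of the trace space *)

Lemma edge_skel e x : edges (mH P) e -> hull e x -> skel x.
Proof. by move=> [tau tH et] ex; exists tau => //; exists e. Qed.

Lemma edges_of_edges tau e : tau \in mH P -> edges_of tau e -> edges (mH P) e.
Proof. by move=> tH et; exists tau. Qed.

Lemma skel_edge x : skel x -> exists2 e, edges (mH P) e & hull e x.
Proof. by move=> [tau tH [e et ex]]; exists e => //; exists tau. Qed.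

Lemma trace_value mu x : Lam P mu -> skel x -> mu x = T mu x.
Proof. by move=> Lm sx; rewrite -{1}(Tharm_trace Lm) patch_in. Qed.

Lemma coarse_vertex_skel p : vertices (mH P) p -> skel p.
Proof.
move=> [tau tH pt]; have nt := ndH tH.
have [a at_ ap] : exists2 a, a \in tau & a != p.
  have : (0 < #|` tau `\ p|%fset)%N.
    by have := cardfsD1 p tau; rewrite pt (card_nondegenerate nt) add1n => -[<-].
  by rewrite cardfs_gt0 => /fset0Pn[a]; rewrite in_fsetD1 => /andP[? ?]; exists a.
apply: (@edge_skel (tau `\ a)%fset); first exists tau => //.
  by apply/edges_ofP => //; exists a.
by apply: hull_vertex; rewrite in_fsetD1 eq_sym ap.
Qed.

(** Some fine triangle contains [p] and lies in a coarse triangle [tau']. Conformity makes [p] a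
    vertex of [tau'], hence an extreme point of it, which can only be a vertex of the fine
    triangle. *)
Lemma coarse_vertex_fine p : vertices (mH P) p -> vertices (mh P) p.
Proof.
move=> [tau tH pt].
have [t th tp] := triangulation_cover trh (hull_closure trH tH (hull_vertex pt)).
have [tau' tH' sub] := fine_in_coarse refP th.
have := face_inter trH tH tH' _ (fsubset_refl _) _ (sub _ tp).
move=> /(_ [fset p]%fset); rewrite fsub1set hull1 => /(_ pt erefl) pI.
have pt' : p \in tau'.
  case: (boolP (p \in tau')) => // np; move: pI.
  have -> : ([fset p] `&` tau' = fset0)%fset.
    by apply/fsetP => q; rewrite !inE; case: eqP => // ->; rewrite (negbTE np).
  by rewrite hull0.
by exists t => //; exact: (extreme_vertex (ndH tH') pt' sub tp).
Qed.

Lemma edge_refined e x : edges (mH P) e -> hull e x ->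
  exists t e', [/\ t \in mh P, (e' `<=` t)%fset, hull e' `<=` hull e & hull e' x].
Proof.
move=> eH ex; have [_ /(_ e eH) E] := refP; move: ex; rewrite {1}E.
by move=> [e' [[t th [et _]] /= ee] ex]; exists t, e'.
Qed.

Lemma tLam_Lam mu : tLam P mu -> Lam P mu. Proof. by case. Qed.

Lemma tLam_subspace : subspace_of (tLam P).
Proof.
have [L0 cL] := Lam_subspace; split; first by split.
move=> a u v [Lu u0] [Lv v0]; split; first exact: cL.
by move=> x nx; rewrite lincombE u0// v0// mulr0 addr0.
Qed.

Lemma Lam_boundary mu x : Lam P mu -> boundary (dom P) x -> mu x = 0.
Proof.
move=> Lm bx; have [sx|] := pselect (skel x); last exact: Lam_outside.
by rewrite trace_value// (Vh_boundary domo (Tharm_Vh Lm)).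
Qed.

(** [nodesH] leaves out the vertices on the boundary of the domain, where traces vanish anyway. The
    zeros at all coarse vertices are what decouples the edges. *)
Lemma tLam_vertex mu p : tLam P mu -> vertices (mH P) p -> mu p = 0.
Proof.
move=> [Lm m0] vp; have [bp|nbp] := pselect (boundary (dom P) p).
  exact: Lam_boundary.
by apply: m0; split => //; split => //; exact: coarse_vertex_skel.
Qed.

Lemma tLam_two_edges mu e e' x : tLam P mu -> edges (mH P) e -> edges (mH P) e' ->
  e != e' -> hull e x -> hull e' x -> mu x = 0.
Proof.
move=> tm eH eH' neq ex ex'; apply: tLam_vertex => //.
exact: edge_pair_vertex trH eH eH' neq ex ex'.
Qed.

(* [hull e] is a union of fine edges, and on each of them both sides are affine. *)
Lemma Vh_nodal_edge v c e x :
  Vh P v -> edges (mH P) e -> hull e x ->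
  (forall p, vertices (mh P) p -> hull e p -> c p = v p) -> interp (mh P) c x = v x.
Proof.
move=> Vv eH ex cv; have [t [e' [th et sub ex']]] := edge_refined eH ex.
rewrite (interp_face c trh th et ex') (Vh_face trh Vv th et ex').
apply: eq_big_seq => a ae; rewrite cv//; last by apply/sub/hull_vertex.
by exists t => //; exact: (fsubsetP et).
Qed.

(** The cut to one edge is still a trace because [mu] is 0 at the end points. It is realised by
    interpolating the cut nodal values: these vanish on every other edge, as two edges meet only in
    a coarse vertex. *)
Lemma restrict_tLam mu e : tLam P mu -> edges (mH P) e -> tLam P (mu \_ (hull e)).
Proof.
move=> tm eH; have [Lm m0] := tm; have VT := Tharm_Vh Lm.
pose c := (T mu) \_ (hull e).
have VI : Vh P (interp (mh P) c).
  apply: interp_Vh => // p _ bp; rewrite /c patchE; case: ifP => // _.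
  exact: Vh_boundary bp.
have E : mu \_ (hull e) = (interp (mh P) c) \_ skel.
  apply/funext => x; have [sx|nsx] := pselect (skel x); last first.
    by rewrite !patch_out// => ex; apply: nsx; exact: edge_skel ex.
  rewrite (patch_in _ sx).
  have [ex|nex] := pselect (hull e x).
    rewrite patch_in// (Vh_nodal_edge VT eH ex); first by rewrite trace_value.
    by move=> p _ ep; rewrite /c patch_in.
  rewrite patch_out//; have [e' eH' ex'] := skel_edge sx.
  have neq : e != e' by apply: contra_not_neq nex => ->.
  rewrite (Vh_nodal_edge (Vh_subspace P).1 eH' ex')// => p _ ep'.
  have [ep|nep] := pselect (hull e p); last by rewrite /c patch_out.
  rewrite /c patch_in// -trace_value//; last exact: edge_skel ep.
  exact: tLam_two_edges tm eH eH' neq ep ep'.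
split; first by rewrite E; exact: Lam_trace.
by move=> x nx; rewrite patchE; case: ifP => // _; exact: m0.
Qed.

(** [mu0] interpolates the values at the coarse vertices, with 0 at all other fine vertices. *)
Lemma coarse_nodal_part lam : Lam P lam -> exists2 mu0, Lam0 P mu0 & tLam P (lam - mu0).
Proof.
move=> Ll; have VT := Tharm_Vh Ll.
pose c := (T lam) \_ (vertices (mH P)).
have VI : Vh P (interp (mh P) c).
  apply: interp_Vh => // p _ bp; rewrite /c patchE; case: ifP => // _.
  exact: Vh_boundary bp.
have L0 := Lam_trace VI.
exists ((interp (mh P) c) \_ skel).
  split=> // x [[vx [sx bx]] nx]; rewrite patch_in// (interp_vertex _ trh)//.
  by rewrite /c patch_out// => vHx; apply: nx.
split; first exact: (subspaceB Lam_subspace).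
move=> x [vx [sx bx]].
have -> : (lam - (interp (mh P) c) \_ skel) x = lam x - ((interp (mh P) c) \_ skel) x by [].
rewrite patch_in// (interp_vertex _ trh); last exact: coarse_vertex_fine.
by rewrite /c patch_in// -trace_value// subrr.
Qed.

Lemma tLam_edge_tLam e nu : edges (mH P) e -> tLam_edge P e nu -> tLam P nu.
Proof. by move=> eH [mu tm <-]; exact: restrict_tLam. Qed.

Lemma patch_id e nu : tLam_edge P e nu -> nu \_ (hull e) = nu.
Proof.
move=> [mu tm <-]; apply/funext => x.
have [ex|nex] := pselect (hull e x); last by rewrite !(patch_out _ nex).
by rewrite !(patch_in _ ex).
Qed.

Lemma tLam_edge_subspace e : subspace_of (tLam_edge P e).
Proof.
have [L0 cL] := tLam_subspace; split.
  by exists 0 => //; apply/funext => x; rewrite patchE; case: ifP.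
move=> a _ _ [u tu <-] [v tv <-]; exists (a *: u + v); first exact: cL.
by rewrite patch_lin.
Qed.

Lemma eigspan_subspace (E : eigensystem R) sel : subspace_of (eigspan E sel).
Proof.
split; first by exists (fun=> 0); rewrite big1// => i _; rewrite scale0r.
move=> a _ _ [c ->] [d ->]; exists (fun i => a * c i + d i).
rewrite scaler_sumr -big_split/=; apply: eq_bigr => i _.
by rewrite scalerDl scalerA.
Qed.

Lemma tLam_sel_subspace E sel : subspace_of (tLam_sel P E sel).
Proof.
have [L0 cL] := tLam_subspace; split.
  split=> // e _; rewrite (_ : 0 \_ (hull e) = 0).
    by case: (eigspan_subspace (E e) sel).
  by apply/funext => x; rewrite patchE; case: ifP.
move=> a u v [tu su] [tv sv]; split; first exact: cL.
move=> e ie; rewrite patch_lin; have [_ c] := eigspan_subspace (E e) sel.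
by apply: c; [exact: su|exact: sv].
Qed.

Lemma patch_sum (I : Type) (r : seq I) (F : I -> R * R -> R) D :
  (\sum_(i <- r) F i) \_ D = \sum_(i <- r) (F i) \_ D.
Proof.
elim: r => [|i r IH].
  by rewrite !big_nil; apply/funext => x; rewrite patchE; case: ifP.
rewrite !big_cons -IH -{1}(scale1r (F i)) patch_lin.
by rewrite scale1r.
Qed.

Lemma patch_other_edge nu e e' : edges (mH P) e -> edges (mH P) e' -> e != e' ->
  tLam_edge P e nu -> nu \_ (hull e') = 0.
Proof.
move=> eH eH' neq te; apply/funext => x.
have [ex'|nex'] := pselect (hull e' x); last by rewrite patch_out.
rewrite patch_in//; have [ex|nex] := pselect (hull e x).
  exact: tLam_two_edges (tLam_edge_tLam eH te) eH eH' neq ex ex'.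
by rewrite -(patch_id te) patch_out.
Qed.

Lemma finite_interior_edges : finite_set (interior_edge P).
Proof.
by apply: sub_finite_set (finite_edges (mH P)) => e [].
Qed.

(** Each edge restriction is split in the eigenbasis at [astab], and the upper parts, extended by 0,
    are added up. Restricting the sum to an edge returns its own part, since the pieces of other
    edges vanish there. *)
Lemma tLam_split E (astab : R) mu :
  (forall e i, interior_edge P e -> tLam_edge P e (eigfun (E e) i)) ->
  (forall e nu, interior_edge P e -> tLam_edge P e nu ->
    exists c : 'I_(neig (E e)) -> R, nu = \sum_i c i *: eigfun (E e) i) ->
  tLam P mu -> exists2 mu1, tLam_Pi P E astab mu1 & tLam_tri P E astab (mu - mu1).
Proof.
move=> hpsi hspan tm.
pose good e nu := eigspan (E e) (fun al => astab <= al) nu /\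
  eigspan (E e) (fun al => al < astab) (mu \_ (hull e) - nu).
have good_ex e : interior_edge P e -> exists nu, good e nu.
  move=> ie; have [c cE] := hspan e (mu \_ (hull e)) ie (ex_intro2 _ _ mu tm erefl).
  exists (\sum_(i | astab <= eigval (E e) i) c i *: eigfun (E e) i); split.
    by exists c.
  exists c; rewrite cE (bigID (fun i => astab <= eigval (E e) i))/= addrAC subrr add0r.
  by apply: eq_bigl => i; rewrite ltNge.
pose nu e := xget 0 (good e).
have goodnu e : interior_edge P e -> good e (nu e) by move=> /good_ex; exact: xgetPex.
have tnu e : interior_edge P e -> tLam_edge P e (nu e).
  move=> ie; have [[c ->] _] := goodnu e ie.
  apply: (subspace_sum _ (tLam_edge_subspace e)) => i _.
  by apply: (subspaceZ _ (tLam_edge_subspace e)); exact: hpsi.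
pose s := fset_set (interior_edge P).
have sP e : (e \in s) <-> interior_edge P e.
  by rewrite in_fset_set; [rewrite inE|exact: finite_interior_edges].
pose mu1 := \sum_(e <- s) nu e.
have tm1 : tLam P mu1.
  rewrite /mu1 big_seq; apply: (subspace_sum _ tLam_subspace) => e /sP ie.
  by apply: (tLam_edge_tLam ie.1); exact: tnu.
have m1E e : interior_edge P e -> mu1 \_ (hull e) = nu e.
  move=> ie; rewrite patch_sum (bigD1_seq e) ?fset_uniq//=; last exact/sP.
  rewrite (patch_id (tnu e ie)) big_seq_cond big1 ?addr0// => e' /andP[/sP ie' neq].
  exact: (patch_other_edge ie'.1 ie.1 neq (tnu e' ie')).
exists mu1; first by split=> // e ie; rewrite m1E//; case: (goodnu e ie).
split; first exact: (subspaceB tLam_subspace).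
by move=> e ie; rewrite patchB m1E//; case: (goodnu e ie).
Qed.

(** Edges overlap only at vertices, where [mu] is 0, so counting a vertex twice is harmless. *)
Lemma bdry_edge_sum tau mu : tau \in mH P -> tLam P mu ->
  mu \_ (bdry tau) = (\sum_(a <- tau) mu \_ (hull (tau `\ a)%fset)) \_ (bdry tau).
Proof.
move=> tH tm; have nt := ndH tH; apply/funext => x.
have eH a : a \in tau -> edges (mH P) (tau `\ a)%fset.
  by move=> at_; exists tau => //; apply/edges_ofP => //; exists a.
have [bx|nb] := pselect (bdry tau x); last by rewrite !patch_out.
rewrite !patch_in//; have [e /(edges_ofP _ nt)[a at_ ->] ex] := bx.
rewrite fct_sumE (bigD1_seq a) ?fset_uniq//= patch_in//.
rewrite big_seq_cond big1 ?addr0// => b /andP[bt ba].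
have [ebx|] := pselect (hull (tau `\ b)%fset x); last exact: patch_out.
rewrite patch_in//; apply: tLam_two_edges tm (eH _ at_) (eH _ bt) _ ex ebx.
apply: contra ba => /eqP/fsetP/(_ b); rewrite !in_fsetD1 eqxx bt andbT/=.
by move/negbFE.
Qed.

Lemma Tharm0 : T 0 = 0.
Proof.
have L0 := Lam_subspace.1.
have := Tharm_linear 1 L0 L0; rewrite !scale1r addr0 => /esym/eqP.
by rewrite -subr_eq0 addrK => /eqP.
Qed.

Lemma Tharm_sum (I : eqType) (r : seq I) (F : I -> R * R -> R) :
  (forall i, i \in r -> Lam P (F i)) ->
  T (\sum_(i <- r) F i) = \sum_(i <- r) T (F i).
Proof.
elim: r => [_|i r IH h]; first by rewrite !big_nil Tharm0.
have hr j : j \in r -> Lam P (F j) by move=> jr; apply: h; rewrite inE jr orbT.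
rewrite !big_cons -IH// -[F i]scale1r Tharm_linear ?scale1r//.
  by apply: h; rewrite inE eqxx.
by rewrite big_seq; exact: (subspace_sum _ Lam_subspace).
Qed.

(** An identity on [tau] only: both sides have the same trace on [bdry tau], and by [Tel_trace] the
    values on [hull tau] depend on that trace alone. *)
Lemma Tharm_edge_sum tau mu x : tau \in mH P -> tLam P mu -> hull tau x ->
  T mu x = \sum_(a <- tau) T (mu \_ (hull (tau `\ a)%fset)) x.
Proof.
move=> tH tm tx; have nt := ndH tH.
have tL a : a \in tau -> tLam P (mu \_ (hull (tau `\ a)%fset)).
  move=> at_; apply: restrict_tLam => //; exists tau => //.
  by apply/edges_ofP => //; exists a.
have LS : Lam P (\sum_(a <- tau) mu \_ (hull (tau `\ a)%fset)).
  rewrite big_seq; apply: (subspace_sum _ Lam_subspace) => a at_.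
  by case: (tL a at_).
have := Tel_trace tH LS; rewrite -(bdry_edge_sum tH tm) (Tel_trace tH (tLam_Lam tm)).
move=> /(congr1 (fun h => h x)); rewrite !(patch_in _ tx) => ->.
rewrite Tharm_sum ?fct_sumE// => a at_.
by case: (tL a at_).
Qed.

Hypotheses (hmass : forall D, pmeasurable R D -> D `<=` dom P -> psd_on (Vh P) (mass P D))
  (mass_elements : forall v, Vh P v ->
     mass P (dom P) v v = \sum_(tau <- mH P) mass P (hull tau)° v v)
  (mass_three : forall tau v (F : R * R -> R * R -> R), tau \in mH P -> Vh P v ->
     (forall a, a \in tau -> Vh P (F a)) ->
     (forall x, hull tau x -> v x = \sum_(a <- tau) F a x) ->
     mass P (hull tau)° v v <= 3 * \sum_(a <- tau) mass P (hull tau)° (F a) (F a)).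

Lemma edge_bdry tau e nu : edges_of tau e -> tLam_edge P e nu ->
  nu \_ (bdry tau) = nu.
Proof.
move=> et te; apply/funext => x; have [bx|nb] := pselect (bdry tau x).
  by rewrite patch_in.
rewrite patch_out// -(patch_id te) patch_out// => ex.
by apply: nb; exists e.
Qed.

(** * The edge forms of one element *)

Section Element.
Variables (tau e : {fset R * R}).
Hypotheses (tH : tau \in mH P) (et : edges_of tau e).

Let eH : edges (mH P) e := edges_of_edges tH et.
Let te_L nu : tLam_edge P e nu -> Lam P nu.
Proof. by move=> /(tLam_edge_tLam eH)[]. Qed.
Let mtau : pmeasurable R ((hull tau)°) := interior_measurable trH tH.
Let stau : (hull tau)° `<=` dom P := interior_sub_dom trH tH.

Lemma ext_trace nu : tLam_edge P e nu -> ext e nu = nu \_ (bdry tau).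
Proof. by move=> te; rewrite /ext (patch_id te) (edge_bdry et te). Qed.

Lemma S_eeE mu nu : tLam_edge P e mu -> tLam_edge P e nu ->
  S_ee P tau e mu nu = s_el P tau mu nu.
Proof.
move=> tm tn; rewrite /S_ee (ext_trace tm) (ext_trace tn).
exact: (Sop_trace tH (te_L tm) (te_L tn)).
Qed.

Lemma M_eeE mu nu : tLam_edge P e mu -> tLam_edge P e nu ->
  M_ee P tau e mu nu = mass P (hull tau)° (T mu) (T nu).
Proof.
move=> tm tn; rewrite /M_ee (ext_trace tm) (ext_trace tn).
rewrite (Tel_trace tH (te_L tm)) (Tel_trace tH (te_L tn)).
apply: eq_Rintegral => x; rewrite inE => /interior_subset tx.
by rewrite (patch_in _ tx) (patch_in _ tx).
Qed.

Lemma hatS_psd : psd_on (tLam_edge P e) (hatS P tau e).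
Proof.
have k0 : 0 <= target P ^- 2 by rewrite invr_ge0 sqr_ge0.
have h := psd_add k0 (Tharm_psd (hmass mtau stau)) (s_el_psd tH).
apply: (psd_ext (tLam_edge_subspace e) _ (psd_sub te_L h)) => mu nu tm tn.
by rewrite /hatS (S_eeE tm tn) (M_eeE tm tn).
Qed.

Lemma mass_le_hatS mu : 0 < target P -> tLam_edge P e mu ->
  mass P (hull tau)° (T mu) (T mu) <= target P ^+ 2 * hatS P tau e mu mu.
Proof.
move=> t0 tm; rewrite /hatS (S_eeE tm tm) (M_eeE tm tm).
rewrite mulrDr mulrA divff ?mul1r ?lerDl ?expf_eq0 ?gt_eqF//.
by rewrite mulr_ge0 ?sqr_ge0//; case: (s_el_psd tH) => _ _; apply; exact: te_L.
Qed.

(** An ambient space for the Schur complement: it contains the edge traces and the traces carried by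
    the complementary degrees of freedom. *)
Let trW : set (R * R -> R) := [set mu \_ (bdry tau) | mu in Lam P].

Let trW_subspace : subspace_of trW.
Proof.
have [L0 cL] := Lam_subspace; split.
  by exists 0 => //; apply/funext => x; rewrite patchE; case: ifP.
move=> a _ _ [u Lu <-] [v Lv <-]; exists (a *: u + v); first exact: cL.
by rewrite patch_lin.
Qed.

Let Sop_psd : psd_on trW (Sop P tau).
Proof.
have [_ cL] := Lam_subspace; have [hl hs hp] := s_el_psd tH; split.
- move=> _ [z Lz <-] a _ _ [u Lu <-] [v Lv <-].
  rewrite -patch_lin (Sop_trace tH (cL a u v Lu Lv) Lz) (Sop_trace tH Lu Lz).
  by rewrite (Sop_trace tH Lv Lz); exact: hl.
- move=> _ _ [u Lu <-] [v Lv <-].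
  by rewrite (Sop_trace tH Lu Lv) (Sop_trace tH Lv Lu); exact: hs.
- by move=> _ [u Lu <-]; rewrite (Sop_trace tH Lu Lu); exact: hp.
Qed.

Let co_trW : tLam_co P tau e `<=` trW.
Proof. by move=> _ [[mu [Lm _] <-] _]; exists mu. Qed.

Let edge_trW : tLam_edge P e `<=` trW.
Proof. by move=> nu te; exists nu; [exact: te_L|exact: (edge_bdry et te)]. Qed.

Let co_subspace : subspace_of (tLam_co P tau e).
Proof.
have [L0 cL] := tLam_subspace; split.
  split=> //; exists 0 => //; apply/funext => x; rewrite patchE; case: ifP => //.
move=> a _ _ [[u tu <-] u0] [[v tv <-] v0]; split.
  by exists (a *: u + v); [exact: cL|rewrite patch_lin].
by move=> x nx ex; rewrite lincombE u0// v0// mulr0 addr0.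
Qed.

(** Provides the separation condition of [psd_represent] for [Sop]. Fine triangles whose interior
    meets that of [tau] lie in [tau], so vertices in [hull tau] suffice. *)
Lemma energy_vertices v : Vh P v ->
  (forall p, p \in flatten [seq enum_fset t | t <- mh P] -> hull tau p -> v p = 0) ->
  energy P (hull tau)° v v = 0.
Proof.
move=> Vv v0; apply: energy_grad0 => x xt.
have [[t th tx]|nx] := pselect (exists2 t, t \in mh P & (hull t)° x); last first.
  exact: grad_outside nx.
have sub := interior_in_coarse trH refP th tH tx (interior_subset xt).
rewrite (@grad_affine _ P v t x 0 0 0 th tx).
  by apply/matrixP => i j; rewrite !mxE; case: ifP.
move=> y ty; rewrite !mul0r !addr0 (Vh_face trh Vv th (fsubset_refl t) ty).
rewrite big_seq big1// => a at_; rewrite v0 ?mulr0//; last exact/sub/hull_vertex.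
by apply/flatten_mapP; exists t.
Qed.

Let eta nu := S_coco_inv P tau e (fun zeta => S_coe P tau e zeta nu).

(** [S_coco_inv] is a choice, so existence must be shown: [psd_represent] is applied to the
    functional [Sop P tau nu], which vanishes on null vectors by [psd_null]. *)
Let etaP nu : tLam_edge P e nu -> tLam_co P tau e (eta nu) /\
  forall zeta, tLam_co P tau e zeta -> Sop P tau zeta (eta nu) = Sop P tau zeta nu.
Proof.
move=> te; have Wn := edge_trW te; have [_ hs _] := Sop_psd.
have [w co_w hw] : exists2 w, tLam_co P tau e w &
    forall z, tLam_co P tau e z -> Sop P tau w z = Sop P tau nu z.
  apply: (psd_represent (L := flatten [seq enum_fset t | t <- mh P])
     (phi := fun p mu => Tel P tau mu p) co_subspace).
  - move=> p _ a _ _ /co_trW[u Lu <-] /co_trW[v Lv <-].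
    rewrite -patch_lin (Tel_trace tH (Lam_subspace.2 a u v Lu Lv)).
    by rewrite (Tel_trace tH Lu) (Tel_trace tH Lv) (Tharm_linear a Lu Lv) patch_lin.
  - exact: psd_sub co_trW Sop_psd.
  - move=> a u v /co_trW Wu /co_trW Wv.
    exact: (psd_linr Sop_psd Wn trW_subspace).
  - by move=> z /co_trW Wz; exact: (psd_null trW_subspace Sop_psd Wn Wz).
  - move=> _ /co_trW[u Lu <-] h; rewrite (Sop_trace tH Lu Lu).
    apply: energy_vertices; first exact: Tharm_Vh.
    by move=> p pL tp; have := h p pL; rewrite (Tel_trace tH Lu) patch_in.
have : [set eta | tLam_co P tau e eta /\ forall zeta, tLam_co P tau e zeta ->
    S_coco P tau zeta eta = S_coe P tau e zeta nu] (eta nu).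
  apply: (xgetPex (0 : R * R -> R)); exists w; split; first exact: co_w.
  move=> z co_z.
  rewrite /S_coco /S_coe /ext (patch_id te) (hs _ _ (co_trW co_z) (co_trW co_w)) (hw _ co_z).
  exact: (hs _ _ Wn (co_trW co_z)).
move=> [co_eta h]; split; first exact: co_eta.
by move=> z /h; rewrite /S_coco /S_coe /ext (patch_id te).
Qed.

Let tildeSE mu nu : tLam_edge P e mu -> tLam_edge P e nu ->
  tildeS P tau e mu nu = Sop P tau mu nu - Sop P tau mu (eta nu).
Proof. by move=> tm tn; rewrite /tildeS /S_ee /S_eco /ext (patch_id tm) (patch_id tn). Qed.

Lemma tildeS_linear mu : tLam_edge P e mu -> linear_on (tLam_edge P e) (tildeS P tau e mu).
Proof.
move=> tm a u v tu tv; have [_ cE] := tLam_edge_subspace e.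
rewrite (tildeSE tm (cE a u v tu tv)) (tildeSE tm tu) (tildeSE tm tv).
apply: (schur_linear trW_subspace (tLam_edge_subspace e) co_trW edge_trW Sop_psd
  _ _ tm a tu tv).
- by move=> w /etaP[].
- by move=> w z /etaP[_ h] /h.
Qed.

(** On [bdry tau] the trace is its part on [e] plus a part [z] carried by the complementary degrees
    of freedom, so [schur_min] applies. *)
Lemma tildeS_min mu : tLam P mu ->
  tildeS P tau e (mu \_ (hull e)) (mu \_ (hull e)) <= s_el P tau mu mu.
Proof.
move=> tm; have tme : tLam_edge P e (mu \_ (hull e)) by exists mu.
have Lm := tLam_Lam tm.
pose z := (mu - mu \_ (hull e)) \_ (bdry tau).
have co_z : tLam_co P tau e z.
  split.
    exists (mu - mu \_ (hull e)) => //.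
    by apply: (subspaceB tLam_subspace) => //; exact: restrict_tLam.
  move=> x _ ex; rewrite /z patchB; have [bx|nb] := pselect (bdry tau x).
    have -> : (mu \_ (bdry tau) - (mu \_ (hull e)) \_ (bdry tau)) x =
      (mu \_ (bdry tau)) x - ((mu \_ (hull e)) \_ (bdry tau)) x by [].
    by rewrite !(patch_in _ bx) (patch_in _ ex) subrr.
  by exfalso; apply: nb; exists e.
have sE : mu \_ (hull e) + z = mu \_ (bdry tau).
  by rewrite /z patchB (edge_bdry et tme) addrC subrK.
rewrite (tildeSE tme tme) -(Sop_trace tH Lm Lm) -sE.
apply: (schur_min trW_subspace co_subspace co_trW edge_trW Sop_psd _ _ tme co_z).
- by move=> w /etaP[].
- by move=> w z' /etaP[_ h] /h.
Qed.

End Element.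

Lemma edges_seqP tau : tau \in mH P ->
  perm_eq [seq (tau `\ a)%fset | a <- tau]
    [seq e <- fset_set (edges (mH P)) | (e `<=` tau)%fset].
Proof.
move=> tH; have nt := ndH tH; apply: uniq_perm.
- rewrite map_inj_in_uniq ?fset_uniq// => a b at_ bt /fsetP/(_ a).
  by rewrite !in_fsetD1 eqxx at_ andbT/=; case: (eqVneq a b).
- by rewrite filter_uniq ?fset_uniq.
- move=> e; rewrite mem_filter in_fset_set; last exact: finite_edges.
  apply/idP/idP => [/mapP[a at_ ->]|/andP[et]].
    rewrite fsubD1set inE; apply: (edges_of_edges tH).
    by apply/edges_ofP => //; exists a.
  rewrite inE => -[tau' _ [_ e2]]; apply/mapP.
  have [a at_ eE] := (edges_ofP e nt).1 (conj et e2).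
  by exists a.
Qed.

(** Passes between the element order, used for energies, and the edge order, used for the spectral
    bound. *)
Lemma sum_edges_swap (F : {fset R * R} -> {fset R * R} -> R) :
  \sum_(tau <- mH P) \sum_(a <- tau) F tau (tau `\ a)%fset =
  \sum_(e <- fset_set (edges (mH P))) \sum_(tau <- mH P | (e `<=` tau)%fset) F tau e.
Proof.
rewrite [RHS](exchange_big_dep xpredT)//=; apply: eq_big_seq => tau tH.
by rewrite -[RHS]big_filter -(perm_big _ (edges_seqP tH)) big_map.
Qed.

(** * The spectral bound summed over the edges *)

Section Estimate.
Variables (E : {fset R * R} -> eigensystem R) (astab : R).
Hypotheses (hE : forall e tau tau', interior_edge P e ->
     tau \in mH P -> tau' \in mH P -> tau != tau' ->
     (e `<=` tau)%fset -> (e `<=` tau')%fset -> is_eigensystem P tau tau' e (E e))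
  (astab1 : 1 < astab) (target0 : 0 < target P).

Let interior_pair e : interior_edge P e -> exists tau tau',
  [/\ tau \in mH P, tau' \in mH P, tau != tau', (e `<=` tau)%fset & (e `<=` tau')%fset].
Proof.
move=> [[tau tH et] nb].
have [tau' tH' [neq et']] := edge_shared domo trH tH et nb.
by exists tau, tau'; split=> //; [rewrite eq_sym|case: et].
Qed.

Let card_edge e tau : interior_edge P e -> (e `<=` tau)%fset -> edges_of tau e.
Proof. by move=> [[tau' _ [_ e2]] _]. Qed.

Let eigfun_edge e i : interior_edge P e -> tLam_edge P e (eigfun (E e) i).
Proof.
move=> ie; have [tau [tau' [tH tH' neq et et']]] := interior_pair ie.
by have [+ _ _ _ _] := hE ie tH tH' neq et et'; apply.
Qed.

Let eigfun_span e nu : interior_edge P e -> tLam_edge P e nu ->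
  exists c : 'I_(neig (E e)) -> R, nu = \sum_i c i *: eigfun (E e) i.
Proof.
move=> ie; have [tau [tau' [tH tH' neq et et']]] := interior_pair ie.
by have [_ _ _ _] := hE ie tH tH' neq et et'; apply.
Qed.

Lemma pair_estimate e tau tau' mu : interior_edge P e ->
  tau \in mH P -> tau' \in mH P -> tau != tau' ->
  (e `<=` tau)%fset -> (e `<=` tau')%fset ->
  eigspan (E e) (fun al => al < astab) mu ->
  hatS P tau e mu mu + hatS P tau' e mu mu <=
  astab * (tildeS P tau e mu mu + tildeS P tau' e mu mu).
Proof.
move=> ie tH tH' neq et et' [c ->].
have [psiE eig [_ al1] orth _] := hE ie tH tH' neq et et'.
have eo := card_edge ie et; have eo' := card_edge ie et'.
have sW := tLam_edge_subspace e.
have hp := psd_add ler01 (hatS_psd tH eo) (hatS_psd tH' eo').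
apply: (@eigen_bound _ _ _ (eigfun (E e)) (eigval (E e)) (tLam_edge P e)
  (fun u v => hatS P tau e u v + hatS P tau' e u v)
  (fun u v => tildeS P tau e u v + tildeS P tau' e u v) astab c sW psiE).
- move=> u Wu; apply: linear_on_add; first exact: (psd_linr (hatS_psd tH eo) Wu sW).
  exact: (psd_linr (hatS_psd tH' eo') Wu sW).
- move=> u Wu; have [hl _ _] := hatS_psd tH eo; have [hl' _ _] := hatS_psd tH' eo'.
  exact: (linear_on_add (hl u Wu) (hl' u Wu)).
- move=> u Wu; apply: linear_on_add; first exact: (tildeS_linear tH eo Wu).
  exact: (tildeS_linear tH' eo' Wu).
- by move=> i u Wu; exact: eig.
- exact: al1.
- exact: orth.
Qed.

Let pair_arith (a h h' k k' : R) : h + h' <= a * (k + k') -> 0 <= a * k - h + (a * k' - h').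
Proof. by lra. Qed.

(* Comparing pairs of elements suffices however many elements share the edge, so
   that this number need not be known to be two. *)
Lemma edge_estimate e mu : interior_edge P e -> tLam_edge P e mu ->
  eigspan (E e) (fun al => al < astab) mu ->
  \sum_(tau <- mH P | (e `<=` tau)%fset) hatS P tau e mu mu <=
  \sum_(tau <- mH P | (e `<=` tau)%fset) astab * tildeS P tau e mu mu.
Proof.
move=> ie te smu; rewrite -subr_ge0 -sumrB -big_filter.
apply: sum_pairwise_ge0; first by rewrite filter_uniq ?fset_uniq.
  have [tau [tau' [tH tH' neq et et']]] := interior_pair ie.
  by exists tau, tau'; rewrite !mem_filter et et' tH tH'.
move=> tau tau'; rewrite !mem_filter => /andP[et tH] /andP[et' tH'] neq.
exact: (pair_arith (pair_estimate ie tH tH' neq et et' smu)).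
Qed.

Lemma mass_estimate mu : tLam_tri P E astab mu ->
  mass P (dom P) (T mu) (T mu) <= 9 * astab * target P ^+ 2 * sform P mu mu.
Proof.
move=> [tm smu]; have Lm := tLam_Lam tm; have VT := Tharm_Vh Lm.
have eo tau a : tau \in mH P -> a \in tau -> edges_of tau (tau `\ a)%fset.
  by move=> tH at_; apply/edges_ofP; [exact: ndH|exists a].
pose me (e : {fset R * R}) := mu \_ (hull e).
pose F tau e := mass P (hull tau)° (T (me e)) (T (me e)).
(* No eigenvalue problem is posed on an edge inside the boundary of the domain; the trace is 0
   there, so 0 bounds its mass. *)
pose S tau e := if `[< interior_edge P e >]
  then astab * tildeS P tau e (me e) (me e) else 0.
have as0 : 0 < astab by exact: lt_trans astab1.
have s_ge0 tau : tau \in mH P -> 0 <= s_el P tau mu mu.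
  by move=> tH; case: (s_el_psd tH) => _ _; apply.
have S_le tau e : tau \in mH P -> edges_of tau e -> S tau e <= astab * s_el P tau mu mu.
  move=> tH et; rewrite /S; case: asboolP => _; last first.
    by apply: mulr_ge0; [exact: ltW|exact: s_ge0].
  have h := tildeS_min tH et tm; rewrite ler_pM2l; last exact: as0.
  exact: h.
have step1 : mass P (dom P) (T mu) (T mu) <=
    3 * \sum_(tau <- mH P) \sum_(a <- tau) F tau (tau `\ a)%fset.
  rewrite mass_elements// mulr_sumr big_seq [leRHS]big_seq; apply: ler_sum => tau tH.
  apply: (mass_three (F := fun a => T (me (tau `\ a)%fset)) tH VT).
    move=> a at_; apply: Tharm_Vh; apply: tLam_Lam.
    exact: (restrict_tLam tm (edges_of_edges tH (eo _ _ tH at_))).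
  by move=> x tx; exact: Tharm_edge_sum.
have step2 : \sum_(tau <- mH P) \sum_(a <- tau) F tau (tau `\ a)%fset <=
    target P ^+ 2 * \sum_(tau <- mH P) \sum_(a <- tau) S tau (tau `\ a)%fset.
  rewrite !sum_edges_swap mulr_sumr big_seq [leRHS]big_seq; apply: ler_sum => e.
  rewrite in_fset_set; last exact: finite_edges.
  rewrite inE => eH; have te : tLam_edge P e (me e) by exists mu.
  have [ie|nie] := pselect (interior_edge P e); last first.
    have nb : hull e `<=` boundary (dom P) by apply: contrapT => nb; exact: nie.
    have me0 : me e = 0.
      apply/funext => x; have [ex|nex] := pselect (hull e x); last by rewrite /me patch_out.
      by rewrite /me patch_in//; apply: (Lam_boundary Lm); exact: nb.
    rewrite big_seq_cond big1; last first.
      move=> tau /andP[tH _]; rewrite /F me0.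
      have [hl _ _] := hmass (interior_measurable trH tH) (interior_sub_dom trH tH).
      rewrite Tharm0.
      exact: (linear_on0 sVh (hl 0 sVh.1)).
    rewrite mulr_ge0 ?sqr_ge0//; apply: sumr_ge0 => tau _.
    by rewrite /S asboolF.
  apply: (@le_trans _ _ (target P ^+ 2 *
      \sum_(tau <- mH P | (e `<=` tau)%fset) hatS P tau e (me e) (me e))).
    rewrite mulr_sumr big_seq_cond [leRHS]big_seq_cond.
    apply: ler_sum => tau /andP[tH et].
    exact: (mass_le_hatS tH (card_edge ie et) target0 te).
  rewrite ler_pM2l ?exprn_gt0//; apply: le_trans (edge_estimate ie te (smu e ie)) _.
  by apply: ler_sum => tau _; rewrite /S asboolT.
have step3 : \sum_(tau <- mH P) \sum_(a <- tau) S tau (tau `\ a)%fset <=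
    3 * astab * sform P mu mu.
  rewrite /sform mulr_sumr big_seq [leRHS]big_seq; apply: ler_sum => tau tH.
  apply: (@le_trans _ _ (\sum_(a <- tau) astab * s_el P tau mu mu)).
    rewrite big_seq [leRHS]big_seq; apply: ler_sum => a at_.
    exact: (S_le _ _ tH (eo _ _ tH at_)).
  rewrite big_const_seq count_predT (card_nondegenerate (ndH tH)) iter_addr_0.
  by rewrite -mulrA mulr_natl.
apply: le_trans step1 _.
apply: (@le_trans _ _ (3 * (target P ^+ 2 * (3 * astab * sform P mu mu)))).
  rewrite ler_pM2l//; apply: le_trans step2 _.
  by rewrite ler_pM2l ?exprn_gt0.
by rewrite le_eqVlt; apply/orP; left; apply/eqP; ring.
Qed.

(** * The projection and the multiscale space *)

Lemma Proj_elP tau mu : tau \in mH P -> Lam P mu ->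
  tLam_tri P E astab (Proj_el P E astab tau mu) /\
  forall nu, tLam_tri P E astab nu ->
    sform P nu (Proj_el P E astab tau mu) = s_el P tau nu mu.
Proof.
move=> tH Lm; have sub : tLam_tri P E astab `<=` Lam P by move=> nu [[]].
have [hl hs hp] := s_el_psd tH; have [hls hss hps] := sform_psd.
have [w tw hw] : exists2 w, tLam_tri P E astab w &
    forall z, tLam_tri P E astab z -> sform P w z = s_el P tau mu z.
  apply: (psd_represent (L := flatten [seq enum_fset t | t <- mh P])
     (phi := fun p mu => T mu p) (tLam_sel_subspace E _)).
  - by move=> p _ a u v /sub Lu /sub Lv; exact: Tharm_eval.
  - exact: psd_sub sub sform_psd.
  - by move=> a u v /sub Lu /sub Lv; exact: (psd_linr (s_el_psd tH) Lm Lam_subspace).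
  (* A null vector of the sum [sform] is a null vector of each of its nonnegative terms, in
     particular of [s_el P tau]. *)
  - move=> z /sub Lz sz; apply: (psd_null Lam_subspace (s_el_psd tH) Lm Lz).
    move/eqP : sz; rewrite /sform big_seq psumr_eq0; last first.
      by move=> tau' tH'; case: (s_el_psd tH') => _ _; apply.
    by move=> /allP/(_ tau tH); rewrite tH => /eqP.
  - move=> z /sub Lz h; rewrite (sformE Lz Lz) (Tharm_vertices Lz h).
    have [al _ _] := aform_psd; exact: (linear_on0 sVh (al 0 sVh.1)).
have : [set eta | tLam_tri P E astab eta /\ forall nu, tLam_tri P E astab nu ->
    sform P nu eta = s_el P tau nu mu] (Proj_el P E astab tau mu).
  apply: (xgetPex (0 : R * R -> R)); exists w; split; first exact: tw.
  move=> nu tn; rewrite (hss _ _ (sub _ tn) (sub _ tw)) (hw _ tn).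
  exact: (hs _ _ Lm (sub _ tn)).
by move=> [h1 h2]; split; [exact: h1|exact: h2].
Qed.

Lemma ProjP mu : Lam P mu -> tLam_tri P E astab (Proj P E astab mu) /\
  forall nu, tLam_tri P E astab nu -> sform P nu (Proj P E astab mu) = sform P nu mu.
Proof.
move=> Lm; have sub : tLam_tri P E astab `<=` Lam P by move=> nu [[]].
have sS := tLam_sel_subspace E (fun al => al < astab).
have hP tau : tau \in mH P -> tLam_tri P E astab (Proj_el P E astab tau mu).
  by move=> tH; case: (Proj_elP tH Lm).
split; first by rewrite /Proj big_seq; exact: (subspace_sum _ sS).
move=> nu tn; rewrite /Proj big_seq.
have ln := psd_linr sform_psd (sub _ tn) Lam_subspace.
rewrite (linear_on_sum _ Lam_subspace ln); last by move=> tau /hP/sub.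
rewrite [RHS]big_seq; apply: eq_bigr => tau tH.
by case: (Proj_elP tH Lm) => _; apply.
Qed.

Lemma Lam_Pi_Lam : Lam_Pi P E astab `<=` Lam P.
Proof.
by move=> _ [mu0 [mu1 [[L0 _] [[L1 _] _] ->]]]; exact: (subspaceD Lam_subspace).
Qed.

Lemma Lam_ms_Lam : Lam_ms P E astab `<=` Lam P.
Proof.
move=> _ [mu /Lam_Pi_Lam Lm <-]; have [[[LP _] _] _] := ProjP Lm.
exact: (subspaceB Lam_subspace).
Qed.

Lemma Lam_ms_orth nu d : Lam_ms P E astab nu -> tLam_tri P E astab d -> sform P d nu = 0.
Proof.
move=> [mu /Lam_Pi_Lam Lm <-] td; have [[[LP _] _] h] := ProjP Lm.
have Ld : Lam P d by case: td => -[].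
rewrite (linear_onB Lam_subspace (psd_linr sform_psd Ld Lam_subspace))//.
by rewrite (h _ td) subrr.
Qed.

(** Subtracting its projection turns [mu0 + mu1] into a multiscale trace; the subtracted projection
    joins the remainder in the triangle space. *)
Lemma Lam_split lam : Lam P lam ->
  exists2 nu, Lam_ms P E astab nu & tLam_tri P E astab (lam - nu).
Proof.
move=> Ll; have [mu0 L0 tm] := coarse_nodal_part Ll.
have [mu1 tPi ttri] := tLam_split astab (fun e i ie => @eigfun_edge e i ie) eigfun_span tm.
have LPi : Lam_Pi P E astab (mu0 + mu1) by exists mu0, mu1.
have [tP _] := ProjP (Lam_Pi_Lam LPi).
exists (mu0 + mu1 - Proj P E astab (mu0 + mu1)); first by exists (mu0 + mu1).
have -> : lam - (mu0 + mu1 - Proj P E astab (mu0 + mu1)) =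
  (lam - mu0 - mu1) + Proj P E astab (mu0 + mu1).
  by rewrite opprB addrA addrAC opprD addrA.
exact: (subspaceD (tLam_sel_subspace E _)).
Qed.

(** * The Galerkin error *)

Variables (g u lamms : R * R -> R).
Hypotheses (Vu : Vh P u) (hu : forall v, Vh P v -> aform P u v = load P g v)
  (ms_lamms : Lam_ms P E astab lamms)
  (hms : forall nu, Lam_ms P E astab nu -> sform P nu lamms = load P g (T nu))
  (load_bound : forall v k, Vh P v ->
    2 * k * load P g v <= k ^+ 2 * L2rho P g ^+ 2 + mass P (dom P) v v).

Let lam := u \_ skel.
Let Llam : Lam P lam := Lam_trace Vu.
Let Llamms : Lam P lamms := Lam_ms_Lam ms_lamms.

(** [u] and [T lam] have the same trace, so they differ by a bubble, which is orthogonal to the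
    harmonic [T nu]. *)
Lemma sform_lam nu : Lam P nu -> sform P nu lam = load P g (T nu).
Proof.
move=> Ln; have VT := Tharm_Vh Ln; have VTl := Tharm_Vh Llam.
have [al as_ _] := aform_psd.
rewrite (sformE Ln Llam) -(hu VT) (as_ _ _ VT VTl).
apply/eqP; rewrite eq_sym -subr_eq0 -(linear_onB sVh (al _ VT) Vu VTl).
have Vd : Vh P (u - T lam) by exact: (subspaceB sVh).
rewrite (as_ _ _ Vd VT) (Tharm_orth Ln)//; apply/(VhB_trace Vd).
by rewrite patchB (Tharm_trace Llam) subrr.
Qed.

(** The multiscale component [nu] of [lam] solves the same equations as [lamms]. Their difference is
    orthogonal to every multiscale trace, in particular to [nu] and to [lamms], hence to itself, and
    definiteness gives equality. *)
Lemma lam_lamms_tri : tLam_tri P E astab (lam - lamms).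
Proof.
have [nu ms_nu td] := Lam_split Llam; have Ln := Lam_ms_Lam ms_nu.
have Ld : Lam P (lam - nu) by case: td => -[].
have lin k a b : Lam P k -> Lam P a -> Lam P b ->
    sform P k (a - b) = sform P k a - sform P k b.
  by move=> Lk'; exact: (linear_onB Lam_subspace (psd_linr sform_psd Lk' Lam_subspace)).
have [hl hs _] := sform_psd.
suff k0 : nu - lamms = 0 by move/eqP : k0; rewrite subr_eq0 => /eqP <-.
have Lk : Lam P (nu - lamms) by exact: (subspaceB Lam_subspace).
have ort k : Lam_ms P E astab k -> sform P k (nu - lamms) = 0.
  move=> ms_k; have Lk' := Lam_ms_Lam ms_k.
  have e0 : sform P k (lam - nu) = 0 by rewrite (hs _ _ Lk' Ld) (Lam_ms_orth ms_k td).
  move: e0; rewrite (lin k _ _ Lk' Llam Ln) => /eqP; rewrite subr_eq0 => /eqP e0.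
  by rewrite (lin k _ _ Lk' Ln Llamms) (hms ms_k) -(sform_lam Lk') e0 subrr.
apply: (sform_definite Lk); rewrite (linear_onB Lam_subspace (hl _ Lk) Ln Llamms).
by rewrite (ort _ ms_nu) (ort _ ms_lamms) subrr.
Qed.

Theorem ms_energy_estimate :
  H1A P (T lam - T lamms) ^+ 2 <= 9 * astab * target P ^+ 2 * L2rho P g ^+ 2.
Proof.
have td := lam_lamms_tri; have Ld : Lam P (lam - lamms) by case: td => -[].
have TB : T lam - T lamms = T (lam - lamms).
  have -> : lam - lamms = -1 *: lamms + lam by rewrite scaleN1r addrC.
  by rewrite (Tharm_linear _ Llamms Llam) scaleN1r addrC.
have VT := Tharm_Vh Ld; have [_ _ ap] := aform_psd; have [hl hs _] := sform_psd.
have -> : H1A P (T lam - T lamms) ^+ 2 = sform P (lam - lamms) (lam - lamms).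
  by rewrite TB /H1A sqr_sqrtr; [rewrite (sformE Ld Ld)|exact: ap].
have sE : sform P (lam - lamms) (lam - lamms) = load P g (T (lam - lamms)).
  rewrite (linear_onB Lam_subspace (psd_linr sform_psd Ld Lam_subspace) Llam Llamms).
  by rewrite (Lam_ms_orth ms_lamms td) subr0 (sform_lam Ld).
have K0 : 0 < 9 * astab * target P ^+ 2.
  by rewrite !mulr_gt0 ?exprn_gt0//; exact: lt_trans astab1.
have h1 := mass_estimate td.
have h2 := load_bound (9 * astab * target P ^+ 2) VT.
rewrite -sE in h2; move: h1 h2 K0.
set K := 9 * _ * _; set s := sform _ _ _; set m := mass _ _ _ _; set G := L2rho P g ^+ 2.
(* From [2 K s <= K^2 G + m] and [m <= K s] one gets [K s <= K^2 G]. *)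
move=> h1 h2 K0; rewrite -(ler_pM2l K0).
have -> : K * (K * G) = K ^+ 2 * G by ring.
by lra.
Qed.

End Estimate.

End Harmonic.

(** * Collecting the exceptional null sets *)

Lemma ae_null_set {R : realType} (Q : R * R -> Prop) : {ae leb2 R, forall x, Q x} ->
  exists A, [/\ pmeasurable R A, leb2 R A = 0%E & forall x, ~ A x -> Q x].
Proof.
move=> [A [mA A0 sub]]; exists A; split=> // x nA.
by apply: contrapT => nQ; apply/nA/sub.
Qed.

Lemma ae_null_set2 {R : realType} (Q Q' : R * R -> Prop) :
  {ae leb2 R, forall x, Q x} -> {ae leb2 R, forall x, Q' x} ->
  exists A, [/\ pmeasurable R A, leb2 R A = 0%E & forall x, ~ A x -> Q x /\ Q' x].
Proof.
move=> /ae_null_set[A [mA A0 hA]] /ae_null_set[B [mB B0 hB]]; exists (A `|` B).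
split; [exact: measurableU|by rewrite measureU0|].
by move=> x nAB; split; [apply: hA|apply: hB] => h; apply: nAB; [left|right].
Qed.

Lemma Linfty_bounded_off {R : realType} (D : set (R * R)) (f : R * R -> R) : Linfty D f ->
  exists A, [/\ pmeasurable R A, leb2 R A = 0%E & pbounded_off R D A f].
Proof.
move=> [mf [C /ae_null_set[A [mA A0 hA]]]]; exists A; split=> //.
by split; [exact: mf|exists C => x Dx nA; exact: hA].
Qed.

Lemma bounded_off_sub {d : measure_display} {T : measurableType d} {R : realType}
    (D N N' : set T) (f : T -> R) :
  N `<=` N' -> bounded_off D N f -> bounded_off D N' f.
Proof. by move=> sub [mf [C hC]]; split=> //; exists C => x Dx nN; apply: hC => // /sub. Qed.

Theorem theorem12 (R : realType) (P : fem_data R)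
    (amin amax rhomin rhomax : R) (f g : R * R -> R)
    (E : {fset R * R} -> eigensystem R) (astab : R)
    (u lamms : R * R -> R) :
  polygonal_domain (dom P) ->
  triangulation (dom P) (mH P) ->
  triangulation (dom P) (mh P) ->
  refinement (mh P) (mH P) ->
  meshsize (mh P) < meshsize (mH P) ->
  0 < amin -> 0 < amax -> 0 < rhomin -> 0 < rhomax ->
  (forall i j, Linfty (dom P) (fun x => coef P x i j)) ->
  {ae leb2 R, forall x, dom P x -> (coef P x)^T = coef P x} ->
  elliptic (dom P) (coef P) amin amax ->
  Linfty (dom P) (dens P) ->
  {ae leb2 R, forall x, dom P x -> rhomin <= dens P x <= rhomax} ->
  0 < target P ->
  L2 (dom P) f ->
  measurable_fun (dom P) g ->
  {ae leb2 R, forall x, dom P x -> f x = dens P x * g x} ->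
  (forall e tau tau', interior_edge P e ->
     tau \in mH P -> tau' \in mH P -> tau != tau' ->
     (e `<=` tau)%fset -> (e `<=` tau')%fset ->
     is_eigensystem P tau tau' e (E e)) ->
  1 < astab ->
  Vh P u -> (forall v, Vh P v -> aform P u v = load P g v) ->
  Lam_ms P E astab lamms ->
  (forall nu, Lam_ms P E astab nu -> sform P nu lamms = load P g (Tharm P nu)) ->
  let lam := u \_ (skeleton (mH P)) in
  tLam_tri P E astab (lam - lamms) /\
  H1A P (Tharm P lam - Tharm P lamms) ^+ 2 <=
    9 * astab * target P ^+ 2 * L2rho P g ^+ 2.
Proof.
move=> [domo _ _ domb _] trH trh refP _ amin0 _ rhomin0 _ hcoef hsym hell hrho hrhob.
move=> target0 [_ fL2] mg hf hE astab1 Vu hu msl hms lam.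
have /choice[A hA] (ij : 'I_2 * 'I_2) : exists A, [/\ pmeasurable R A, leb2 R A = 0%E &
    pbounded_off R (dom P) A (fun x => coef P x ij.1 ij.2)].
  exact: Linfty_bounded_off (hcoef ij.1 ij.2).
have [mA A0] : pmeasurable R (\bigcup_(ij in [set` index_enum ('I_2 * 'I_2)%type]) A ij) /\
    leb2 R (\bigcup_(ij in [set` index_enum ('I_2 * 'I_2)%type]) A ij) = 0%E.
  by apply: null_bigcup => ij _; have [] := hA ij.
have [B [mB B0 hB]] := Linfty_bounded_off hrho.
have [C1 [mC1 C10 hC1]] := ae_null_set2 hsym hell.
have [C2 [mC2 C20 hC2]] := ae_null_set2 hrhob hf.
(* One set for all data: the bounds on the matrix entries and on the density, symmetry with
   ellipticity, and the two-sided density bounds with [f = rho g]. *)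
pose N := \bigcup_(ij in [set` index_enum ('I_2 * 'I_2)%type]) A ij `|` B `|` (C1 `|` C2).
have mAB := measurableU _ _ mA mB.
have mC := measurableU _ _ mC1 mC2.
have mN : pmeasurable R N := measurableU _ _ mAB mC.
have AB0 := etrans (measureU0 mA mB B0) A0.
have C0 := etrans (measureU0 mC1 mC2 C20) C10.
have N0 : leb2 R N = 0%E := etrans (measureU0 mAB mC C0) AB0.
have cA i j : pbounded_off R (dom P) N (fun x => coef P x i j).
  have [_ _] := hA (i, j); apply: bounded_off_sub => x Ax.
  by left; left; exists (i, j) => //=; exact: mem_index_enum.
have cB : pbounded_off R (dom P) N (dens P).
  by apply: bounded_off_sub hB => x Bx; left; right.
have good x : ~ N x -> [/\ dom P x -> (coef P x)^T = coef P x,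
    dom P x -> forall b, amin * dotp b b <= dotp (coef P x *m b) b,
    dom P x -> rhomin <= dens P x & dom P x -> f x = dens P x * g x].
  move=> nN; have /hC1[h1 h2] : ~ C1 x by move=> Cx; apply: nN; right; left.
  have /hC2[h3 h4] : ~ C2 x by move=> Cx; apply: nN; right; right.
  split; [exact: h1| | |exact: h4] => Dx; first by move=> b; have /andP[] := h2 Dx b.
  by have /andP[] := h3 Dx.
have symA x : dom P x -> ~ N x -> (coef P x)^T = coef P x.
  by move=> Dx /good[h _ _ _]; exact: h.
have ellA x b : dom P x -> ~ N x -> amin * dotp b b <= dotp (coef P x *m b) b.
  by move=> Dx /good[_ h _ _]; exact: h.
have rho_ge x : dom P x -> ~ N x -> rhomin <= dens P x.
  by move=> Dx /good[_ _ h _]; exact: h.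
have fE x : dom P x -> ~ N x -> f x = dens P x * g x.
  by move=> Dx /good[_ _ _ h]; exact: h.
have ap := aform_psd domo domb trH trh mN N0 amin0 cA symA ellA.
have ad := aform_definite domo domb trH trh mN N0 amin0 cA symA ellA.
have ep tau : tau \in mH P -> psd_on (Vh P) (energy P (hull tau)°).
  move=> tH; apply: (energy_psd domo domb trH trh mN N0 amin0 cA symA ellA).
    exact: interior_measurable trH tH.
  exact: interior_sub_dom trH tH.
have ee v w : Vh P v -> Vh P w ->
    aform P v w = \sum_(tau <- mH P) energy P (hull tau)° v w.
  by move=> Vv Vw; exact: (energy_elements domo domb trH trh mN N0 cA trH Vv Vw).
have mp := mass_psd domo domb trH trh mN N0 rhomin0 cB rho_ge.
have me := mass_elements domo domb trH trh mN N0 cB.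
have m3 := mass_three domo domb trH trh mN N0 rhomin0 cB rho_ge.
have lb := load_bound domo domb trH trh mN N0 rhomin0 cB rho_ge fL2 mg fE.
split.
  exact: (lam_lamms_tri domo trH trh refP ap ad ep ee hE Vu hu msl hms).
exact: (ms_energy_estimate domo trH trh refP ap ad ep ee mp me m3 hE astab1 target0
  Vu hu msl hms).
Qed.
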